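(* Let $\varphi(x)=\frac{|x|^\alpha}{\alpha}$ with $1<\alpha\le2$, and let $\gamma$ be defined by $\frac1\alpha+\frac1\gamma=1$. Let $y=\{y(u),u\in\mathbb{R}\}$ be a real strictly $\varphi$-sub-Gaussian random process with determining constant $C_y$ and covariance function $\Gamma_y(s,t)=\mathsf E\,y(t)y(s)$ of finite variation. Let $N\ge1$ be an integer, $a_1,\dots,a_N\in\mathbb{R}$, let $\kappa$ be one of the functions $\kappa(v)=\cos v$ or $\kappa(v)=\sin v$, and let $$U(t,x)=\int_{-\infty}^\infty I(t,x,\lambda)\,dy(\lambda),\qquad I(t,x,\lambda)=\kappa\Big(\lambda x+t\sum_{k=1}^N a_k\lambda^{2k+1}(-1)^k\Big),\qquad a\le t\le b,\ c\le x\le d.$$ Put $\varepsilon_0=\sup_{a\le t\le b,\ c\le x\le d}\tau_\varphi(U(t,x))$ and $\varkappa=\max(b-a,d-c)$. Let the constant $\rho\in(0,1]$ be such that $$\int_{-\infty}^\infty\int_{-\infty}^\infty|\lambda|^{(2N+1)(\rho+1)}|\mu|^{(2N+1)(\rho+1)}\,d|\Gamma_y(\lambda,\mu)|<\infty,$$ and let $C_Z\ge 0$ be defined by $$C_Z^2=\int_{-\infty}^{\infty}\int_{-\infty}^{\infty}\Big(\big(\tfrac{|\lambda|}{2}\big)^\rho+\big|\tfrac12\sum_{k=1}^{N}a_k\lambda^{2k+1}(-1)^k\big|^\rho\Big)\Big(\big(\tfrac{|\mu|}{2}\big)^\rho+\big|\tfrac12\sum_{k=1}^{N}a_k\mu^{2k+1}(-1)^k\big|^\rho\Big)\,d|\Gamma_y(\lambda,\mu)|.$$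 Then: (i) $U(t,x)$ exists, is continuous with probability one, and for $0<h<\varkappa$ $$\sup_{\substack{t,t_1\in[a,b]:|t-t_1|\le h\\ x,x_1\in[c,d]:|x-x_1|\le h}}\tau_\varphi\big(U(t,x)-U(t_1,x_1)\big)\le 2C_ZC_y\,h^\rho .$$ (ii) For all $0<\theta<1$ such that $\theta\varepsilon_0<2C_ZC_y(\varkappa/2)^\rho$ and all $u>0$, $$P\Big\{\sup_{a\le t\le b,\ c\le x\le d}|U(t,x)|>u\Big\}\le 2\exp\Big\{-\frac{u^\gamma(1-\theta)^\gamma}{\gamma\varepsilon_0^\gamma}\Big\}(2eC_ZC_y)^{2/\rho}\varkappa^2(\theta\varepsilon_0)^{-2/\rho}.$$ In particular, if the process $y$ is (centered) Gaussian (so that $\varphi(x)=x^2/2$ and $C_y=1$), then $$P\Big\{\sup_{a\le t\le b,\ c\le x\le d}|U(t,x)|>u\Big\}\le 2\exp\Big\{-\frac{u^2(1-\theta)^2}{2\varepsilon_0^2}\Big\}(2eC_Z)^{2/\rho}\varkappa^2(\theta\varepsilon_0)^{-2/\rho}$$ for all $0<\theta<1$ such that $\theta\varepsilon_0<2C_Z(\varkappa/2)^\rho$ and all $u>0$.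
   Context: All random variables are real and live on a standard probability space $\{\Omega,L,\mathbf P\}$. For $\varphi$ as in the claim, a random variable $\zeta$ is $\varphi$-sub-Gaussian ($\zeta\in\mathrm{Sub}_\varphi(\Omega)$) if $\mathsf E\zeta=0$, $\mathsf E\exp\{\lambda\zeta\}$ exists for all $\lambda\in\mathbb{R}$, and there is $a>0$ with $\mathsf E\exp\{\lambda\zeta\}\le\exp\{\varphi(\lambda a)\}$ for all $\lambda\in\mathbb{R}$. Its norm is $\tau_\varphi(\zeta)=\inf\{a>0:\mathsf E\exp\{\lambda\zeta\}\le\exp\{\varphi(a\lambda)\}\ \text{for all }\lambda\in\mathbb{R}\}$. A family $\Delta\subset\mathrm{Sub}_\varphi(\Omega)$ is strictly $\varphi$-sub-Gaussian with determining constant $C_\Delta$ if for every countable set $\{\zeta_i\}_{i\in I}\subset\Delta$ and all $\lambda_i\in\mathbb{R}$, $\tau_\varphi(\sum_{i\in I}\lambda_i\zeta_i)\le C_\Delta\big(\mathsf E(\sum_{i\in I}\lambda_i\zeta_i)^2\big)^{1/2}$. A random process is strictly $\varphi$-sub-Gaussian if the family of its values is; $C_y$ denotes the determining constant of the process $y$. Integrals $\int\cdot\,dy(\lambda)$ are understood in the mean-square sense. $d|\Gamma_y(\lambda,\mu)|$ denotes integration with respect to the total variation of (the Lebesgue–Stieltjes bimeasure generated by) $\Gamma_y$. (The field $U$ represents the solution of $\sum_{k=1}^N a_k\,\partial^{2k+1}U/\partial x^{2k+1}=\partial U/\partial t$, $U(0,x)=\eta(x)$, with $\eta(x)=\int_{\mathbb{R}}\kappa(xu)\,dy(u)$.)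 *)

(* Defs.v *)
From HB Require Import structures.
From mathcomp Require Export all_boot all_order all_algebra.
From mathcomp Require Export all_classical all_reals all_analysis.
Export Order.TTheory GRing.Theory Num.Theory.
Export numFieldNormedType.Exports.

Set Implicit Arguments.
Unset Strict Implicit.
Unset Printing Implicit Defensive.

Local Open Scope classical_set_scope.
Local Open Scope ring_scope.

Section SubGaussian.
Context {disp : measure_display} {T : measurableType disp} {R : realType}.
Variable P : probability T R.
Implicit Types (phi : R -> R) (X Y : T -> R).

Definition powphi (alpha x : R) : R := `|x| `^ alpha / alpha.

Definition mgf_bounded phi X (a : R) : Prop :=
  forall l : R, ('M_P X l <= (expR (phi (l * a)))%:E)%E.

Definition sub_gaussian phi X : Prop :=
  [/\ ('E_P[X] = 0)%E,
      (forall l : R, 'M_P X l < +oo)%E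
    & exists2 a : R, 0 < a & mgf_bounded phi X a].

(* Extended-real valued, so that the infimum of the empty set is +oo and a
   finite bound on [tau] is never satisfied by default. *)
Definition tau phi X : \bar R :=
  ereal_inf [set a%:E | a in [set a : R | 0 < a /\ mgf_bounded phi X a]].

Definition sqdist X Y : \bar R := ('E_P[fun w => ((X w - Y w) ^+ 2)%R])%E.

Definition l2norm X : R := Num.sqrt (fine ('E_P[fun w => (X w ^+ 2)%R])%E).

(* A countable linear combination is the mean-square limit [xi] of its partial
   sums; finite combinations are those with eventually zero coefficients. *)
Definition strictly_sub_gaussian phi (Delta : set {RV P >-> R}) (C : R) : Prop :=
  (forall X : {RV P >-> R}, Delta X -> sub_gaussian phi X) /\
  forall (zeta : nat -> {RV P >-> R}) (l : nat -> R) (xi : {RV P >-> R}),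
    (forall i, Delta (zeta i)) ->
    sqdist (fun w => \sum_(i < n) l i * zeta i w) xi @[n --> \oo] --> 0%E ->
    (tau phi xi <= (C * l2norm xi)%:E)%E.

(* [normal_prob 0 s] is a Gaussian law only for [s != 0], whence the separate
   degenerate case. *)
Definition centered_gaussian X : Prop :=
  (exists2 s : R, 0 < s &
     forall A : set R, measurable A -> P (X @^-1` A) = normal_prob 0 s A) \/
  {ae P, forall w, X w = 0}.

Definition centered_gaussian_process (y : R -> {RV P >-> R}) : Prop :=
  forall (n : nat) (u l : 'I_n -> R),
    centered_gaussian (fun w => \sum_(i < n) l i * y (u i) w).

Definition cov_fun (y : R -> {RV P >-> R}) (s t : R) : R :=
  fine ('E_P[fun w => (y t w * y s w)%R])%E.

Definition RS_sum (f : R -> R) (y : R -> {RV P >-> R}) (A B : R) (s : seq R)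
    (xi : nat -> R) (w : T) : R :=
  \sum_(i < size s)
    f (xi i) * (y (nth B (A :: s) i.+1) w - y (nth B (A :: s) i) w).

(* Mean-square limit of Riemann-Stieltjes sums over tagged partitions of [A, B]
   as the mesh tends to 0. *)
Definition ms_integral_on (f : R -> R) (y : R -> {RV P >-> R}) (A B : R)
    (J : {RV P >-> R}) : Prop :=
  forall e : R, 0 < e -> exists2 del : R, 0 < del &
    forall (s : seq R) (xi : nat -> R), itv_partition A B s ->
      (forall i, (i < size s)%N ->
         [/\ nth B (A :: s) i <= xi i <= nth B (A :: s) i.+1
           & nth B (A :: s) i.+1 - nth B (A :: s) i < del]) ->
      (sqdist (RS_sum f y A B s xi) J < e%:E)%E.

(* [J] is a version of the improper integral of [f] against [dy] over R. *)
Definition ms_integral (f : R -> R) (y : R -> {RV P >-> R})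
    (J : {RV P >-> R}) : Prop :=
  exists JJ : R -> R -> {RV P >-> R},
    (forall A B, A < B -> ms_integral_on f y A B (JJ A B)) /\
    sqdist (JJ p.1 p.2) J @[p --> filter_prod (ninfty_nbhs R) (pinfty_nbhs R)]
      --> 0%E.

End SubGaussian.

Section Bimeasure.
Context {R : realType}.
Implicit Types G : R -> R -> R.

Definition rect_incr G (s s' t t' : R) : R :=
  G s' t' - G s t' - G s' t + G s t.

Definition finite_variation2 G : Prop :=
  exists M : R, forall (a b c d : R) (p q : seq R),
    itv_partition a b p -> itv_partition c d q ->
    \sum_(i < size p) \sum_(j < size q)
      `|rect_incr G (nth b (a :: p) i) (nth b (a :: p) i.+1)
                    (nth d (c :: q) j) (nth d (c :: q) j.+1)| <= M.

(* [nu] is the Lebesgue-Stieltjes signed measure of [G]. No continuity of [G]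
   is assumed, so the increments are taken at right limits, which exist when
   [G] has finite variation; for right-continuous [G] this says
   nu (]s, s'] * ]t, t']) = rect_incr G s s' t t'. *)
Definition LS_generated G (nu : {charge set (R * R)%type -> \bar R}) : Prop :=
  forall s s' t t' : R, s < s' -> t < t' ->
    (rect_incr G (s + p.1) (s' + p.1) (t + p.2) (t' + p.2))%:E
      @[p --> filter_prod (at_right (0 : R)) (at_right (0 : R))]
    --> nu (`]s, s'] `*` `]t, t']).

End Bimeasure.

Section Field.
Context {disp : measure_display} {T : measurableType disp} {R : realType}.
Variable P : probability T R.

Definition dispersion (N : nat) (coef : nat -> R) (l : R) : R :=
  \sum_(1 <= k < N.+1) coef k * l ^+ (2 * k + 1) * (-1) ^+ k.

Definition kernelI (kappa : R -> R) (N : nat) (coef : nat -> R) (t x l : R) : R :=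
  kappa (l * x + t * dispersion N coef l).

Definition CZ_weight (rho : R) (N : nat) (coef : nat -> R) (l : R) : R :=
  (`|l| / 2) `^ rho + `|2^-1 * dispersion N coef l| `^ rho.

(* A mean-square integral is determined almost surely for each fixed (t, x), so
   a field is any choice of versions. *)
Definition is_field (kappa : R -> R) (N : nat) (coef : nat -> R)
    (y : R -> {RV P >-> R}) (a b c d : R) (U : R -> R -> {RV P >-> R}) : Prop :=
  forall t x, a <= t <= b -> c <= x <= d ->
    ms_integral (kernelI kappa N coef t x) y (U t x).

Definition as_continuous (a b c d : R) (U : R -> R -> {RV P >-> R}) : Prop :=
  {ae P, forall w,
    {within `[a, b] `*` `[c, d],
      continuous (fun p : R * R => U p.1 p.2 w)}}.

Definition sup_tau (phi : R -> R) (a b c d : R) (U : R -> R -> {RV P >-> R})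
    : \bar R :=
  ereal_sup [set tau P phi (U p.1 p.2) | p in `[a, b] `*` `[c, d]].

Definition sup_tau_incr (phi : R -> R) (a b c d : R)
    (U : R -> R -> {RV P >-> R}) (h : R) : \bar R :=
  ereal_sup [set r | exists t t1 x x1 : R,
    [/\ [/\ a <= t <= b, a <= t1 <= b & `|t - t1| <= h],
        [/\ c <= x <= d, c <= x1 <= d & `|x - x1| <= h]
      & r = tau P phi (fun w => U t x w - U t1 x1 w)]].

(* The event {sup |U| > u}. It is only measurable for the completion of [P] when
   [U] is merely almost surely continuous; [mu_ext P] is the outer measure of
   [P], equal to [P] on measurable sets and to its completion on the events of
   the completed sigma-algebra. *)
Definition sup_exceeds (a b c d : R) (U : R -> R -> {RV P >-> R}) (u : R)
    : set T :=
  [set w | (u%:E < ereal_sup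
     [set (`|U p.1 p.2 w|)%:E | p in `[a, b] `*` `[c, d]])%E].

Definition prob_sup_exceeds (a b c d : R) (U : R -> R -> {RV P >-> R}) (u : R)
    : \bar R := mu_ext P (sup_exceeds a b c d U u).

End Field.

(* Main.v *)
(** Truncated Riemann-Stieltjes sums of two partitions differ by a step sum
    whose mean square is a double sum of increments of the covariance, so finite
    variation makes them Cauchy; passing to the limit over partitions shifted
    slightly to the right gives [E (int f dy)^2 <= int int |f||f| d|Gamma_y|].
    The norm [tau] of an integral is at most [C_y] times its [L^2] norm by Fatou's
    lemma applied to the exponential moments of the approximating sums. With
    [|kappa p - kappa q| <= 2 (|p - q| / 2)^rho] this bounds the increments of the
    field by [2 C_Z C_y h^rho]. Along finite nets of the rectangle on which
    successive increments have norm [eps0 theta^k], the weights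
    [(1 - theta) theta^k] and the convexity of the exponential bound the exponential
    moment of the supremum; Chernoff's bound, optimized through the conjugate
    exponent [gamma], gives the tail estimate. Nets with radii decreasing fast
    enough also yield the continuous version. *)
Require Import Defs.
From HB Require Import structures.
From mathcomp Require Import all_boot all_order all_algebra.
From mathcomp Require Import all_classical all_reals all_analysis.
From mathcomp Require Import measurable_realfun.
From mathcomp Require Import ring lra.
Import Order.TTheory GRing.Theory Num.Theory.
Import numFieldNormedType.Exports.
Set Implicit Arguments.
Unset Strict Implicit.
Unset Printing Implicit Defensive.
Local Open Scope classical_set_scope.
Local Open Scope ring_scope.

(** * Mean-square distance *)

Section L2.
Context {disp : measure_display} {T : measurableType disp} {R : realType}.
Variable P : probability T R.
Implicit Types X Y Z : T -> R.

(** The definition of strict sub-Gaussianity covers mean-square limits of the partial sums of a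
    single series. An integral is a limit of sums over unrelated partitions, so the definition is
    applied to finite combinations, and Fatou's lemma carries the bound to the limit. Squared
    distances are extended reals compared by Young's inequality with a free parameter [e]; letting
    [e] tend to 0 keeps the constant 1 in the bound of the second moment by the variation, which the
    constant [2 C_Z C_y] requires.

    In the tail bound, [vk^2 (2 C_Z C_y)^(2/rho) (theta eps0)^(-2/rho)] is [(vk / v_0)^2], the
    cardinality bound of the coarsest net, of radius [v_0]. At level [k] the cardinality bound grows
    by the factor [theta^(-2k/rho)]; averaged with the weights [(1 - theta) theta^k], this growth
    costs at most the factor [e^(2/rho)], because [theta ln(1/theta) <= 1 - theta].

    Two degenerate cases are treated apart: a negative [C_y] forces every value of [y] to vanish
    almost surely, and [eps0 = 0] makes the claimed bound equal to 0. *)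

Lemma sqdistE X Y : sqdist P X Y = (\int[P]_w ((X w - Y w) ^+ 2)%:E)%E.
Proof. by rewrite /sqdist unlock. Qed.

Lemma sqdist_ge0 X Y : (0 <= sqdist P X Y)%E.
Proof. by rewrite sqdistE integral_ge0// => w _; rewrite lee_fin sqr_ge0. Qed.

Lemma sqdistC X Y : sqdist P X Y = sqdist P Y X.
Proof.
rewrite !sqdistE; apply: eq_integral => w _.
by rewrite -[in LHS]opprB sqrrN.
Qed.

Lemma sqdistxx X : sqdist P X X = 0%E.
Proof.
rewrite sqdistE -[RHS](integral0 P setT); apply: eq_integral => w _.
by rewrite subrr expr0n.
Qed.

Lemma measurable_sqr_sub X Y :
  measurable_fun setT X -> measurable_fun setT Y ->
  measurable_fun setT (fun w => ((X w - Y w) ^+ 2)%:E).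
Proof.
move=> mX mY; apply/measurable_EFinP.
by apply: measurable_funX; exact: measurable_funB.
Qed.

(* Young's inequality [(a + b)^2 <= (1 + e) a^2 + (1 + 1/e) b^2] replaces the
   triangle inequality and avoids square roots of extended reals. *)
Lemma sqdist_triangle (e : R) X Y Z : 0 < e ->
  measurable_fun setT X -> measurable_fun setT Y -> measurable_fun setT Z ->
  (sqdist P X Z <= (1 + e)%:E * sqdist P X Y + (1 + e^-1)%:E * sqdist P Y Z)%E.
Proof.
move=> e0 mX mY mZ; rewrite !sqdistE.
have e1 : 0 <= 1 + e by rewrite addr_ge0// ltW.
have e2 : 0 <= 1 + e^-1 by rewrite addr_ge0// invr_ge0 ltW.
have := measurable_sqr_sub mX mY; have := measurable_sqr_sub mY mZ => m1 m2.
have p0 (U V : T -> R) w : (0 <= ((U w - V w) ^+ 2)%:E)%E.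
  by rewrite lee_fin sqr_ge0.
rewrite -ge0_integralZl_EFin// -ge0_integralZl_EFin//.
rewrite -ge0_integralD//; last 4 first.
- by move=> w _; rewrite mule_ge0.
- exact: measurable_funeM.
- by move=> w _; rewrite mule_ge0.
- exact: measurable_funeM.
apply: ge0_le_integral => //.
- exact: measurable_sqr_sub.
- by apply: emeasurable_funD; exact: measurable_funeM.
move=> w _; rewrite -!EFinM -EFinD lee_fin.
set a := X w - Y w; set b := Y w - Z w.
have -> : X w - Z w = a + b by rewrite /a /b; ring.
have h : 0 <= e^-1 * (e * a - b) ^+ 2.
  by rewrite mulr_ge0 ?sqr_ge0// invr_ge0 ltW.
rewrite -subr_ge0; apply: le_trans h _; rewrite le_eqVlt; apply/orP; left.
apply/eqP; field; exact: lt0r_neq0.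
Qed.

Lemma sqdist_triangle2 X Y Z :
  measurable_fun setT X -> measurable_fun setT Y -> measurable_fun setT Z ->
  (sqdist P X Z <= 2%:E * sqdist P X Y + 2%:E * sqdist P Y Z)%E.
Proof.
move=> mX mY mZ; have := sqdist_triangle (@ltr01 R) mX mY mZ.
by rewrite invr1.
Qed.

Lemma sqdist_triangle2_lt (a b : R) X Y Z :
  measurable_fun setT X -> measurable_fun setT Y -> measurable_fun setT Z ->
  (sqdist P X Y <= a%:E)%E -> (sqdist P Y Z <= b%:E)%E ->
  (sqdist P X Z <= (2 * a + 2 * b)%:E)%E.
Proof.
move=> mX mY mZ h1 h2; apply: (le_trans (sqdist_triangle2 mX mY mZ)).
by rewrite (EFinD (2 * a)) !EFinM; apply: leeD; rewrite lee_pmul2l.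
Qed.

Lemma ae_eq_sqdist0 X Y : measurable_fun setT X -> measurable_fun setT Y ->
  sqdist P X Y = 0%E -> {ae P, forall w, X w = Y w}.
Proof.
move=> mX mY; rewrite sqdistE => h.
have : (\int[P]_w `|((X w - Y w) ^+ 2)%:E| = 0)%E.
  rewrite -[RHS]h; apply: eq_integral => w _.
  by rewrite gee0_abs// lee_fin sqr_ge0.
move/(ae_eq_integral_abs _ measurableT (measurable_sqr_sub mX mY)).
apply: filterS => w /(_ I) /= [] /eqP.
by rewrite sqrf_eq0 subr_eq0 => /eqP.
Qed.

Lemma sqdist_ae_eq X X' Y : measurable_fun setT X -> measurable_fun setT X' ->
  measurable_fun setT Y ->
  {ae P, forall w, X w = X' w} -> sqdist P Y X = sqdist P Y X'.
Proof.
move=> mX mX' mY h; rewrite !sqdistE; apply: ge0_ae_eq_integral => //.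
- exact: measurable_sqr_sub.
- exact: measurable_sqr_sub.
- by move=> w _; rewrite lee_fin sqr_ge0.
- by move=> w _; rewrite lee_fin sqr_ge0.
- by apply: filterS h => w -> _.
Qed.

(** Fatou's lemma: almost everywhere the lower limit of [f n] is [g]. The bound on the integrals is
    asked for only eventually, as the approximations used later satisfy it from some index on. *)
Lemma le_integral_limit (f : nat -> T -> R) (g : T -> R) (b : \bar R) :
  (forall n, measurable_fun setT (f n)) -> measurable_fun setT g ->
  (forall n w, 0 <= f n w) -> (forall w, 0 <= g w) ->
  {ae P, forall w, f n w @[n --> \oo] --> g w} ->
  (\forall n \near \oo, (\int[P]_w (f n w)%:E <= b)%E) ->
  (\int[P]_w (g w)%:E <= b)%E.
Proof.
move=> mf mg f0 g0 fg fb.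
have mF n : measurable_fun setT (fun w => (f n w)%:E) by exact/measurable_EFinP.
apply: (@le_trans _ _ (\int[P]_w limn_einf (fun n => (f n w)%:E)))%E.
  apply: ae_ge0_le_integral => //.
  - by move=> w _; rewrite lee_fin.
  - exact/measurable_EFinP.
  - move=> w _; rewrite limn_einf_lim; apply: lime_ge; first exact: is_cvg_einfs.
    by apply: nearW => n; apply: le_ereal_inf_tmp => _ [m _ <-]; rewrite lee_fin.
  - by apply: measurableT_comp => //; apply: measurable_fun_limn_esup => n; exact: measurableT_comp.
  - apply: filterS fg => w fgw _.
    have : (fun n => (f n w)%:E) @ \oo --> (g w)%:E by apply/cvg_EFin => //; exact: nearW.
    by move=> /cvg_limn_einf_sup [-> _].
apply: (le_trans (fatou P measurableT mF _)).
  by move=> n w _; rewrite lee_fin.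
rewrite limn_einf_lim; apply: lime_le; first exact: is_cvg_einfs.
case: fb => N _ Nb; apply: nearW => n.
apply: (@le_trans _ _ (\int[P]_w (f (maxn n N) w)%:E)%E).
  by apply: ereal_inf_lbound; exists (maxn n N) => //=; exact: leq_maxl.
by apply: Nb => /=; exact: leq_maxr.
Qed.

(** By monotone convergence the sum of the series has integral at most [K / (1 - q)], so it is
    finite almost everywhere. *)
Lemma ae_summable_geometric (D : nat -> T -> R) (K q : R) :
  (forall n, measurable_fun setT (D n)) -> (forall n w, 0 <= D n w) ->
  0 <= q < 1 -> (forall n, (\int[P]_w (D n w)%:E <= (K * q ^+ n)%:E)%E) ->
  {ae P, forall w, cvgn (series (fun n => D n w))}.
Proof.
move=> mD D0 /andP[q0 q1] DK.
have mF n : measurable_fun setT (fun w => (D n w)%:E) by exact/measurable_EFinP.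
have K0 : 0 <= K.
  have := DK 0%N; rewrite expr0 mulr1 -lee_fin; apply: le_trans.
  by apply: integral_ge0 => w _; rewrite lee_fin.
have fin : (\int[P]_w (\sum_(n <oo) (D n w)%:E) < +oo)%E.
  rewrite integral_nneseries//; last by move=> n w _; rewrite lee_fin.
  apply: (@le_lt_trans _ _ (K / (1 - q))%:E); last by rewrite ltry.
  apply: lime_le.
    by apply: is_cvg_nneseries => n _ _; apply: integral_ge0 => w _; rewrite lee_fin.
  apply: nearW => n.
  apply: (@le_trans _ _ (\sum_(0 <= i < n) (K * q ^+ i)%:E)%E).
    by apply: lee_sum => i _.
  rewrite sumEFin lee_fin -mulr_sumr ler_wpM2l//.
  rewrite -[leRHS]mul1r ler_pdivlMr ?subr_gt0// big_mkord.
  have := subrX1 q n; rewrite -[(1 - q)]opprB mulrN mulrC => <-.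
  by rewrite opprB gerBl exprn_ge0.
have mS : measurable_fun setT (fun w => \sum_(n <oo) (D n w)%:E)%E.
  by apply: ge0_emeasurable_sum => // n w _ _; rewrite lee_fin.
have int : P.-integrable setT (fun w => \sum_(n <oo) (D n w)%:E)%E.
  apply/integrableP; split=> //.
  under eq_integral.
    move=> w _; rewrite gee0_abs; last first.
      by apply: nneseries_ge0 => n _ _; rewrite lee_fin.
    over.
  by [].
have := integrable_ae measurableT int.
apply: filterS => w /(_ I) h.
apply: nnseries_is_cvg => //.
by move: h; rewrite fin_numE => /andP[_]; rewrite ltey.
Qed.

(* An upper limit, hence measurable without any convergence hypothesis. *)
Definition limit_fun (X : nat -> T -> R) (w : T) : R :=
  fine (limn_esup (fun n => (X n w)%:E)).

Lemma measurable_limit_fun (X : nat -> T -> R) :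
  (forall n, measurable_fun setT (X n)) -> measurable_fun setT (limit_fun X).
Proof.
move=> mX; apply: measurableT_comp => //.
by apply: measurable_fun_limn_esup => n; exact/measurable_EFinP.
Qed.

Lemma limit_funE (X : nat -> T -> R) w (l : R) :
  X n w @[n --> \oo] --> l -> limit_fun X w = l.
Proof.
move=> h; have : (fun n => (X n w)%:E) @ \oo --> l%:E.
  by apply/cvg_EFin => //; exact: nearW.
by move=> /cvg_limn_einf_sup [_]; rewrite /limit_fun => ->.
Qed.

Lemma exists_RV (f : T -> R) : measurable_fun setT f ->
  exists X : {RV P >-> R}, X = f :> (T -> R).
Proof.
move=> mf; pose X : {mfun T >-> R} := mfun_Sub (mem_set mf).
by exists X.
Qed.

(** Indices with squared distance at most [2^-n] make the squares summable almost everywhere, so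
    they tend to 0. The relation [n <= f n] transfers eventual properties to the subsequence. *)
Lemma sqdist_cvg_ae_subseq (X : nat -> T -> R) (J : T -> R) :
  (forall n, measurable_fun setT (X n)) -> measurable_fun setT J ->
  (forall e : R, 0 < e -> \forall n \near \oo, (sqdist P (X n) J <= e%:E)%E) ->
  exists f : nat -> nat, (forall n, (n <= f n)%N) /\
    {ae P, forall w, X (f n) w @[n --> \oo] --> J w}.
Proof.
move=> mX mJ h.
have /choice[f hf] : forall n, exists m, (n <= m)%N /\
    (sqdist P (X m) J <= (2^-1 ^+ n)%:E)%E.
  move=> n; have [|N _ hN] := h (2^-1 ^+ n); first by rewrite exprn_gt0// invr_gt0.
  by exists (maxn n N); split; [exact: leq_maxl|apply: hN; exact: leq_maxr].
exists f; split; first by move=> n; have [] := hf n.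
have q01 : 0 <= (2^-1 : R) < 1 by rewrite invr_ge0 ler0n invf_lt1// ltr1n.
have := @ae_summable_geometric (fun n w => (X (f n) w - J w) ^+ 2) 1 2^-1 _ _ q01 _.
move=> H; apply: filterS (H _ _ _); first 1 last.
- by move=> n; apply: measurable_funX; exact: measurable_funB.
- by move=> n w; exact: sqr_ge0.
- by move=> n; rewrite mul1r -sqdistE; have [] := hf n.
move=> w /cvg_series_cvg_0 c0.
have : (fun n => Num.sqrt ((X (f n) w - J w) ^+ 2)) @ \oo --> (0 : R).
  by rewrite -[0]sqrtr0; apply: continuous_cvg => //; exact: sqrt_continuous.
under eq_fun do rewrite sqrtr_sqr.
by move=> /norm_cvg0P /subr_cvg0.
Qed.

(** Riesz-Fischer: a fast subsequence converges almost everywhere, and Fatou's lemma shows its limit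
    to be the mean-square limit of the whole sequence. *)
Lemma sqdist_complete (X : nat -> T -> R) :
  (forall n, measurable_fun setT (X n)) ->
  (forall e : R, 0 < e -> exists N, forall m n, (N <= m)%N -> (N <= n)%N ->
     (sqdist P (X m) (X n) <= e%:E)%E) ->
  exists J : {RV P >-> R},
    forall e : R, 0 < e -> \forall n \near \oo, (sqdist P (X n) J <= e%:E)%E.
Proof.
move=> mX h.
have /choice[f hf] : forall k, exists N, forall m n, (N <= m)%N -> (N <= n)%N ->
     (sqdist P (X m) (X n) <= (8^-1 ^+ k)%:E)%E.
  by move=> k; apply: h; rewrite exprn_gt0// invr_gt0.
(* Both [g k] and [g k.+1] lie beyond [f k], so consecutive terms have squared distance at most
   [8^-k]; the summand [k] makes [g] unbounded. *)
pose g k := (k + \max_(j < k.+1) f j)%N.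
have fg k : (f k <= g k)%N.
  by rewrite (leq_trans _ (leq_addl _ _))// (leq_bigmax (ord_max : 'I_k.+1)).
have fgS k : (f k <= g k.+1)%N.
  rewrite (leq_trans _ (leq_addl _ _))//.
  by have := leq_bigmax (F := fun j : 'I_k.+2 => f j) (widen_ord (leqnSn _) (ord_max : 'I_k.+1)).
pose D k w : R := `|X (g k.+1) w - X (g k) w|.
have mD k : measurable_fun setT (D k).
  by apply: measurableT_comp => //; exact: measurable_funB.
have q01 : 0 <= (2^-1 : R) < 1 by rewrite invr_ge0 ler0n invf_lt1// ltr1n.
have ser : {ae P, forall w, cvgn (series (fun n => D n w))}.
  apply: (@ae_summable_geometric D 2 2^-1) => //.
    by move=> n w; exact: normr_ge0.
  move=> k.
  (* [|x| <= 2^-k + 2^k x^2] bounds the first moment by the second without a square root. With the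
     rate [8^-k] the second term is at most [4^-k <= 2^-k]. *)
  apply: (@le_trans _ _ (\int[P]_w ((2^-1 ^+ k)%:E + (2 ^+ k)%:E *
      ((X (g k.+1) w - X (g k) w) ^+ 2)%:E))%E).
    apply: ge0_le_integral => //.
    - by move=> w _; rewrite lee_fin /D.
    - exact/measurable_EFinP.
    - apply: emeasurable_funD => //; apply: measurable_funeM.
      exact: measurable_sqr_sub.
    - move=> w _; rewrite -EFinM -EFinD lee_fin /D.
      set x := _ - _; rewrite -(real_normK (num_real x)).
      move: (normr_ge0 x) => {}; move: `|x| => y.
      have p0 : 0 < (2 : R) ^+ k by rewrite exprn_gt0.
      rewrite exprVn; move: p0; move: (2 ^+ k) => p p0.
      rewrite -(ler_pM2l p0) mulrDr divff ?gt_eqF//.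
      nra.
  rewrite ge0_integralD//=; last 2 first.
  - by move=> w _; rewrite -EFinM lee_fin mulr_ge0 ?sqr_ge0 ?exprn_ge0.
  - by apply: measurable_funeM; exact: measurable_sqr_sub.
  have -> : (\int[P]__ (2^-1 ^+ k)%:E)%E = (2^-1 ^+ k)%:E.
    by rewrite (integral_cst P measurableT)/= probability_setT mule1.
  rewrite ge0_integralZl_EFin//; last 2 first.
  - by move=> w _; rewrite lee_fin sqr_ge0.
  - exact: measurable_sqr_sub.
  have -> : 2 * 2^-1 ^+ k = 2^-1 ^+ k + 2^-1 ^+ k :> R by ring.
  rewrite -sqdistE EFinD leeD2l//.
  apply: (@le_trans _ _ ((2 ^+ k)%:E * (8^-1 ^+ k)%:E)%E).
    by rewrite lee_pmul2l ?lte_fin ?exprn_gt0// hf.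
  rewrite -EFinM lee_fin -exprMn; apply: lerXn2r; rewrite ?nnegrE; lra.
pose Y k := X (g k).
have mY k : measurable_fun setT (Y k) by exact: mX.
have [J JE] := exists_RV (measurable_limit_fun mY).
have YJ : {ae P, forall w, Y n w @[n --> \oo] --> J w}.
  apply: filterS ser => w hw.
  have hc : cvgn (series (fun n => Y n.+1 w - Y n w)).
    by apply: normed_cvg; exact: hw.
  have : cvgn (fun n => Y n w).
    have -> : (fun n => Y n w) =
        (fun n => Y 0%N w + series (fun n => Y n.+1 w - Y n w) n).
      apply/funext => n; rewrite /series /= telescope_sumr//.
      by rewrite addrC subrK.
    by apply: is_cvgD => //; exact: is_cvg_cst.
  move=> /cvg_ex[l hl]; rewrite JE (limit_funE hl); exact: hl.
exists J => e e0; have [N hN] := h e e0.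
exists N => // n /= Nn; rewrite sqdistE.
apply: (@le_integral_limit (fun k w => (X n w - Y k w) ^+ 2)) => //.
- by move=> k; apply: measurable_funX; exact: measurable_funB.
- by apply: measurable_funX; exact: measurable_funB.
- by move=> k w; exact: sqr_ge0.
- by move=> w; exact: sqr_ge0.
- apply: filterS YJ => w hw.
  have hc : (fun k => X n w - Y k w) @ \oo --> X n w - J w.
    by apply: cvgB => //; exact: cvg_cst.
  exact: (cvgM hc hc).
- exists N => // k /= Nk; rewrite -sqdistE; apply: hN => //.
  by rewrite (leq_trans Nk)// leq_addr.
Qed.

End L2.

(** * Partitions and variation *)

Section Partition.
Context {R : realType}.
Implicit Types (A B x z : R) (s t u : seq R).

(** Lists of consecutive pairs concatenate with the partitions, so sums over a partition can be
    split and refined without index arithmetic. *)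
Definition cells A s : seq (R * R) := zip (A :: s) s.

Lemma cells_cons A z s : cells A (z :: s) = (A, z) :: cells z s.
Proof. by []. Qed.

Lemma cells_cat A s t : cells A (s ++ t) = cells A s ++ cells (last A s) t.
Proof. by elim: s A => //= z s ih A; rewrite !cells_cons ih. Qed.

Lemma big_cells (V : nmodType) (F : R -> R -> V) x0 A s :
  \sum_(i < size s) F (nth x0 (A :: s) i) (nth x0 (A :: s) i.+1) =
  \sum_(c <- cells A s) F c.1 c.2.
Proof.
elim: s A => [|z s ih] A; first by rewrite big_ord0 big_nil.
by rewrite cells_cons big_cons big_ord_recl/= -ih.
Qed.

Lemma telescope_cells (Y : R -> R) A s :
  \sum_(c <- cells A s) (Y c.2 - Y c.1) = Y (last A s) - Y A.
Proof.
elim: s A => [|z s ih] A; first by rewrite big_nil subrr.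
by rewrite cells_cons big_cons ih/= addrC subrKA.
Qed.

Lemma path_ge_last A s z : path <%R A s -> z \in A :: s -> z <= last A s.
Proof.
elim: s A z => [|y s ih] A z /=; first by rewrite inE => _ /eqP ->.
move=> /andP[Ay ys]; rewrite inE => /predU1P[->|]; last exact: ih.
by apply: le_trans (ltW Ay) _; apply: ih => //; exact: mem_head.
Qed.

Lemma path_gt A s z : path <%R A s -> z \in s -> A < z.
Proof. by move=> /lt_path_min /allP h /h. Qed.

Lemma mem_cells A s (c : R * R) : path <%R A s -> c \in cells A s ->
  [/\ A <= c.1, c.1 < c.2 & c.2 <= last A s].
Proof.
elim: s A => [|z s ih] A //= /andP[Az zs]; rewrite cells_cons inE.
move=> /predU1P[->/=|/(ih _ zs)[h1 h2 h3]].
  by rewrite lexx Az; split => //; apply: (path_ge_last zs); exact: mem_head.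
by split => //; exact: le_trans (ltW Az) h1.
Qed.

Lemma cells_sep A s (c : R * R) z : path <%R A s -> c \in cells A s ->
  z \in s -> z <= c.1 \/ c.2 <= z.
Proof.
elim: s A => [|y s ih] A //= /andP[Ay ys]; rewrite cells_cons inE.
move=> /predU1P[->/= yz|cs].
  right; move: yz; rewrite inE => /predU1P[->//|h].
  by rewrite ltW// (path_gt ys).
rewrite inE => /predU1P[->|]; last exact: (ih y ys cs).
by left; have [] := mem_cells ys cs.
Qed.

Lemma count_le_nth x0 A s i : path <%R A s -> (i < size s)%N ->
  count (fun z => z <= nth x0 (A :: s) i) s = i.
Proof.
elim: s A i => [|y s ih] A [|i] //= /andP[Ay ys] si.
  rewrite leNgt Ay/= add0n; apply/eqP; rewrite -leqn0 leqNgt -has_count -all_predC.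
  apply/allP => z zs /=; rewrite -ltNge; apply: lt_trans Ay _.
  exact: path_gt zs.
rewrite (ih y i)//; suff -> : y <= nth x0 (y :: s) i by [].
have : nth x0 (y :: s) i \in y :: s by rewrite mem_nth//= ltnS ltnW.
by rewrite inE => /predU1P[->//|h]; rewrite ltW// (path_gt ys).
Qed.

Lemma count_le_cell A s (c : R * R) x : path <%R A s -> c \in cells A s ->
  c.1 <= x < c.2 -> count (fun z => z <= x) s = count (fun z => z <= c.1) s.
Proof.
move=> As cs /andP[cx xc]; apply: eq_in_count => z zs.
have [h|h] := cells_sep As cs zs; first by rewrite h (le_trans h).
have [_ c12 _] := mem_cells As cs.
by rewrite !leNgt (lt_le_trans xc h) (lt_le_trans c12 h).
Qed.

Lemma nth_count_le x0 A s x : path <%R A s -> A <= x < last A s ->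
  let i := count (fun z => z <= x) s in
  (i < size s)%N /\ nth x0 (A :: s) i <= x < nth x0 (A :: s) i.+1.
Proof.
elim: s A => [|y s ih] A /=; first by move=> _ /andP[/le_lt_trans h /h]; rewrite ltxx.
move=> /andP[Ay ys] /andP[Ax xl]; have [yx|xy] := leP y x.
  have [] := ih y ys; first by rewrite yx.
  by rewrite add1n ltnS.
have -> : count (fun z => z <= x) s = 0%N.
  apply/eqP; rewrite -leqn0 leqNgt -has_count -all_predC.
  apply/allP => z zs /=; rewrite -ltNge; apply: lt_trans xy _.
  exact: path_gt zs.
by rewrite addn0/= Ax xy.
Qed.

(** On the cells of [u] inside one cell of [s] the factor [g] is constant, and the increments of [Y]
    telescope to the increment over the large cell. *)
Lemma refine_sum (g Y : R -> R) A s u : path <%R A s -> path <%R A u ->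
  {subset s <= u} -> last A s = last A u ->
  (forall c, c \in cells A s -> forall x, c.1 <= x < c.2 -> g x = g c.1) ->
  \sum_(c <- cells A u) g c.1 * (Y c.2 - Y c.1) =
  \sum_(c <- cells A s) g c.1 * (Y c.2 - Y c.1).
Proof.
elim: s A u => [|z s ih] A u /=.
  move=> _ Au _; case: u Au => [|y u] //= /andP[Ay yu] Al _.
  have := path_ge_last yu (mem_head _ _).
  by rewrite -Al leNgt Ay.
move=> /andP[Az zs] + su lastE gc.
have zu : z \in u by apply: su; exact: mem_head.
(* [u] is cut at the first point [z] of [s]: the part up to [z] refines the first cell, the rest
   refines the remaining partition. *)
case/splitPr: zu su lastE => u1 u2 su.
rewrite -cat_rcons last_cat last_rcons => lastE.
rewrite cat_path last_rcons => /andP[Au1 zu2].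
rewrite cells_cat last_rcons big_cat/= cells_cons big_cons/=.
congr (_ + _).
  have := telescope_cells Y A (rcons u1 z); rewrite last_rcons => <-.
  rewrite mulr_sumr [LHS]big_seq [RHS]big_seq; apply: eq_bigr => c cu.
  have [h1 h2] := mem_cells Au1 cu; rewrite last_rcons => h3.
  have -> // : g c.1 = g A.
  by apply: (gc (A, z)); rewrite ?cells_cons ?mem_head//= h1 (lt_le_trans h2).
apply: ih => //.
  move=> y ys; have yz := path_gt zs ys.
  have : y \in u1 ++ z :: u2 by apply: su; rewrite inE ys orbT.
  rewrite mem_cat inE => /orP[yu1|/orP[/eqP yE|//]].
    have := path_ge_last Au1 (z := y); rewrite last_rcons inE mem_rcons inE yu1 !orbT.
    by move=> /(_ isT); rewrite leNgt yz.
  by move: yz; rewrite yE ltxx.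
by move=> c cs x; apply: gc; rewrite cells_cons inE cs orbT.
Qed.

Definition merge_part s t := sort <=%R (undup (s ++ t)).

Lemma mem_merge_part s t z : (z \in merge_part s t) = (z \in s) || (z \in t).
Proof. by rewrite mem_sort mem_undup mem_cat. Qed.

Lemma merge_partP A B s t : itv_partition A B s -> itv_partition A B t ->
  itv_partition A B (merge_part s t).
Proof.
move=> [As /eqP sB] [At /eqP tB].
have pm : path <%R A (merge_part s t).
  rewrite lt_path_sortedE sort_lt_sorted undup_uniq andbT.
  apply/allP => z; rewrite mem_merge_part => /orP[] h.
    exact: path_gt h.
  exact: path_gt h.
split=> //; rewrite eq_le; apply/andP; split.
  have := mem_last A (merge_part s t); rewrite inE => /predU1P[->|].
    by rewrite -sB; apply: path_ge_last => //; exact: mem_head.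
  rewrite mem_merge_part => /orP[] h.
    by rewrite -sB; apply: path_ge_last => //; rewrite inE h orbT.
  by rewrite -tB; apply: path_ge_last => //; rewrite inE h orbT.
apply: path_ge_last => //.
have := mem_last A s; rewrite sB !inE mem_merge_part => /predU1P[->|->].
  by rewrite eqxx.
by rewrite orbT.
Qed.

Lemma le_sum2_cat (I : Type) (F : I -> I -> R) (L1 L2 : seq I) :
  (forall i j, 0 <= F i j) ->
  \sum_(i <- L1) \sum_(j <- L1) F i j + \sum_(i <- L2) \sum_(j <- L2) F i j <=
  \sum_(i <- L1 ++ L2) \sum_(j <- L1 ++ L2) F i j.
Proof.
move=> F0; rewrite big_cat/=; apply: lerD; apply: ler_sum => i _;
  rewrite big_cat/= ?lerDl ?lerDr; exact: sumr_ge0.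
Qed.

(** * Variation of the covariance over square grids *)

Section Variation.
Variable G : R -> R -> R.
Hypothesis Gfv : finite_variation2 G.

Definition rect (c c' : R * R) := rect_incr G c.1 c.2 c'.1 c'.2.

(** Both variables run over the same cells, because the square of a step sum pairs its cells with
    one another. *)
Definition sqvar (L : seq (R * R)) := \sum_(c <- L) \sum_(c' <- L) `|rect c c'|.

Lemma sqvar_ge0 L : 0 <= sqvar L.
Proof. by apply: sumr_ge0 => c _; apply: sumr_ge0. Qed.

Lemma sqvar_bounded : exists2 V, 0 <= V &
  forall A B s, itv_partition A B s -> sqvar (cells A s) <= V.
Proof.
have [M hM] := Gfv; exists M => [|A B s AB].
  have p : itv_partition (0 : R) 0 [::] by split.
  by have := hM _ _ _ _ _ _ p p; rewrite !big_ord0.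
have := hM _ _ _ _ _ _ AB AB; rewrite /sqvar.
rewrite (big_cells (fun x y => \sum_(j < size s) `|rect_incr G x y
  (nth B (A :: s) j) (nth B (A :: s) j.+1)|)).
under eq_bigr do rewrite (big_cells (fun x y => `|rect_incr G _ _ x y|)).
by [].
Qed.

Lemma sqvar_tail (e : R) : 0 < e -> exists A0 B0, A0 <= B0 /\
  forall A' A B B' s1 s2, A < A0 -> B0 < B ->
    itv_partition A' A s1 -> itv_partition B B' s2 ->
    sqvar (cells A' s1 ++ cells B s2) <= e.
Proof.
move=> e0; have [V V0 hV] := sqvar_bounded.
pose S := [set v | exists A B s, itv_partition A B s /\ v = sqvar (cells A s)].
have hsS : has_sup S.
  split; first by exists (sqvar (cells 0 [::])), 0, 0, [::]; split.
  by exists V => _ [A [B [s [AB ->]]]]; exact: hV AB.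
have [v [A0 [B0 [u [ABu ->]]]] hv] := sup_adherent e0 hsS.
exists A0, B0; split; first exact: itv_partition_le ABu.
move=> A' A B B' s1 s2 AA0 BB0 p1 p2.
set K1 := cells A' s1; set K2 := cells B s2; set K := cells A0 u.
have [_ /eqP l1] := p1; have [_ /eqP lu] := ABu.
have pt : itv_partition A' B' (s1 ++ A0 :: u ++ B :: s2).
  apply: itv_partition_cat p1 _.
  have p3 : itv_partition A B0 (A0 :: u).
    by case: ABu => h1 h2; split => //=; rewrite AA0.
  have p4 : itv_partition B0 B' (B :: s2).
    by case: p2 => h1 h2; split => //=; rewrite BB0.
  exact: (itv_partition_cat p3 p4).
have permL : perm_eq (cells A' (s1 ++ A0 :: u ++ B :: s2))
                     ((K1 ++ K2) ++ K ++ [:: (A, A0); (B0, B)]).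
  rewrite cells_cat l1 cells_cons cells_cat lu cells_cons -/K1 -/K -/K2.
  rewrite -catA perm_cat2l; apply/permP => a; rewrite /= !(count_cat, cats0)/=.
  by ring.
have le1 : sqvar (cells A' (s1 ++ A0 :: u ++ B :: s2)) <= sup S.
  by apply: ub_le_sup; [case: hsS|exists A', B', (s1 ++ A0 :: u ++ B :: s2)].
have : sqvar (K1 ++ K2) + sqvar K <= sup S.
  apply: le_trans le1; rewrite /sqvar (perm_big _ permL)/=.
  under [leRHS]eq_bigr do rewrite (perm_big _ permL)/=.
  apply: le_trans (le_sum2_cat _ _ _) => //.
  rewrite lerD2l; apply: le_trans (le_sum2_cat _ _ _) => //.
  by rewrite lerDl; exact: sqvar_ge0.
by move=> h; lra.
Qed.

End Variation.
End Partition.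
Lemma ge0_cvg0P {R : realType} {I : Type} (F : set_system I) (FF : Filter F)
    (f : I -> \bar R) : (forall i, 0 <= f i)%E ->
  (f @ F --> 0%E) <-> (forall e : R, 0 < e -> \forall i \near F, (f i <= e%:E)%E).
Proof.
move=> f0; split.
  move=> /fine_cvgP[ffin /cvgr0Pnorm_le h] e e0.
  near=> i.
  have fi : f i \is a fin_num by near: i.
  rewrite -(fineK fi) lee_fin; apply: le_trans (ler_norm _) _.
  by near: i; exact: h.
move=> h; apply/fine_cvgP; split.
  apply: filterS (h 1 ltr01) => i fi.
  by rewrite ge0_fin_numE//; apply: le_lt_trans fi _; rewrite ltry.
apply/cvgr0Pnorm_le => e e0; apply: filterS (h e e0) => i fi /=.
rewrite ger0_norm ?fine_ge0// -lee_fin fineK//.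
by rewrite ge0_fin_numE//; apply: le_lt_trans fi _; rewrite ltry.
Unshelve. all: by end_near. Qed.

Lemma exists_fine_partition {R : realType} (A B d : R) : A <= B -> 0 < d ->
  exists s, itv_partition A B s /\
    forall c, c \in cells A s -> c.2 - c.1 < d.
Proof.
move=> AB d0; have d20 : 0 < d / 2 by rewrite divr_gt0.
have [n hn] : exists n : nat, B - A < d / 2 * n%:R.
  exists (Num.bound `|(B - A) / (d / 2)|); rewrite mulrC -ltr_pdivrMr//.
  by apply: le_lt_trans (ler_norm _) _; exact/archi_boundP/normr_ge0.
elim: n A AB hn => [|n ih] A AB.
  by rewrite mulr0 subr_lt0 ltNge AB.
move=> h; have [Ad|Ad] := leP (A + d / 2) B; last first.
  have [AB'|AB'] := ltP A B; last first.
    have -> : A = B by apply/eqP; rewrite eq_le AB AB'.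
    by exists [::]; split.
  exists [:: B]; split; first by split => //=; rewrite AB'.
  by move=> c; rewrite inE => /eqP ->/=; lra.
have [|s [ps hs]] := ih _ Ad; first by move: h; rewrite -[n.+1%:R]natr1 mulrDr; lra.
exists ((A + d / 2) :: s); split.
  by case: ps => h1 h2; split => //=; rewrite ltrDl d20.
move=> c; rewrite cells_cons inE => /predU1P[->/=|]; last exact: hs.
by lra.
Qed.

(** * Mean-square integrals *)

Section StepSums.
Context {disp : measure_display} {T : measurableType disp} {R : realType}.
Variable P : probability T R.
Variable y : R -> {RV P >-> R}.
Hypothesis yL2 : forall u, (\int[P]_w (y u w ^+ 2)%:E < +oo)%E.
Local Notation G := (cov_fun y).

(** Integrability and value are kept together, so that linearity extends to finite sums without
    separate side conditions. *)
Definition has_expectation (f : T -> R) (v : R) :=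
  P.-integrable setT (EFin \o f) /\ (\int[P]_w (f w)%:E)%E = v%:E.

Lemma has_expectationD f g a b : has_expectation f a -> has_expectation g b ->
  has_expectation (fun w => f w + g w) (a + b).
Proof.
move=> [If Ef] [Ig Eg]; split.
  exact: (integrableD measurableT If Ig).
have := integralD_EFin measurableT If Ig; rewrite -[RHS]/(_ + _)%E => H.
by rewrite EFinD -Ef -Eg -H.
Qed.

Lemma has_expectationZ f a k : has_expectation f a ->
  has_expectation (fun w => k * f w) (k * a).
Proof.
move=> [If Ef]; split; first exact: (integrableZl measurableT k If).
by under eq_integral do rewrite EFinM; rewrite integralZl// Ef EFinM.
Qed.

Lemma has_expectation_sum (I : Type) (s : seq I) f a :
  (forall i, has_expectation (f i) (a i)) ->
  has_expectation (fun w => \sum_(i <- s) f i w) (\sum_(i <- s) a i).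
Proof.
move=> h; elim: s => [|i s ih].
  rewrite big_nil; split.
    by apply: (eq_integrable _ _ _ _ (integrable0 P setT)) => // w _ /=; rewrite big_nil.
  by rewrite integral0_eq// => w _; rewrite big_nil.
rewrite big_cons; have := has_expectationD (h i) ih.
by under [in X in _ -> X]eq_fun do rewrite big_cons.
Qed.

Lemma cov_funE s t : has_expectation (fun w => y t w * y s w) (G s t).
Proof.
have int : P.-integrable setT (EFin \o (fun w => y t w * y s w)).
  apply/integrableP; split; first by apply/measurable_EFinP; exact: measurable_funM.
  apply: (@le_lt_trans _ _ (\int[P]_w ((y t w ^+ 2)%:E + (y s w ^+ 2)%:E))%E).
    apply: ge0_le_integral => //.
    - by apply/measurableT_comp => //; apply/measurable_EFinP; exact: measurable_funM.
    - by apply: emeasurable_funD; apply/measurable_EFinP; exact: measurable_funX.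
    - move=> w _ /=; rewrite lee_fin normrM -(real_normK (num_real (y t w))).
      rewrite -(real_normK (num_real (y s w))).
      by move: (normr_ge0 (y t w)) (normr_ge0 (y s w)); nra.
  rewrite ge0_integralD//=; first by rewrite lte_add_pinfty.
  - by move=> w _; rewrite lee_fin sqr_ge0.
  - by apply/measurable_EFinP; exact: measurable_funX.
  - by move=> w _; rewrite lee_fin sqr_ge0.
  - by apply/measurable_EFinP; exact: measurable_funX.
split=> //; rewrite /cov_fun unlock fineK//.
exact: integrable_fin_num.
Qed.

Definition step_sum (h : R * R -> R) (L : seq (R * R)) (w : T) : R :=
  \sum_(c <- L) h c * (y c.2 w - y c.1 w).

(** The increment of the covariance over a rectangle is the expected product of two increments of
    [y]; the square is expanded into such products. *)
Lemma integral_step_sum_sqr h L : (\int[P]_w (step_sum h L w ^+ 2)%:E)%E =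
  (\sum_(c <- L) \sum_(c' <- L) h c * h c' * rect G c c')%:E.
Proof.
have [_ H] : has_expectation
  (fun w => \sum_(c <- L) \sum_(c' <- L) h c * h c' *
     (y c'.2 w * y c.2 w + - 1 * (y c'.2 w * y c.1 w) +
      - 1 * (y c'.1 w * y c.2 w) + y c'.1 w * y c.1 w))
  (\sum_(c <- L) \sum_(c' <- L) h c * h c' *
     (G c.2 c'.2 + - 1 * G c.1 c'.2 + - 1 * G c.2 c'.1 + G c.1 c'.1)).
  apply: has_expectation_sum => c; apply: has_expectation_sum => c'.
  apply: has_expectationZ; apply: has_expectationD; last exact: cov_funE.
  apply: has_expectationD; last by apply: has_expectationZ; exact: cov_funE.
  apply: has_expectationD; last by apply: has_expectationZ; exact: cov_funE.
  exact: cov_funE.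
transitivity (\sum_(c <- L) \sum_(c' <- L) h c * h c' *
     (G c.2 c'.2 + - 1 * G c.1 c'.2 + - 1 * G c.2 c'.1 + G c.1 c'.1))%:E; last first.
  congr EFin; apply: eq_bigr => c _; apply: eq_bigr => c' _.
  by rewrite /rect /rect_incr; ring.
rewrite -H; apply: eq_integral => w _; congr EFin; rewrite /step_sum expr2 mulr_suml.
apply: eq_bigr => c _; rewrite mulr_sumr; apply: eq_bigr => c' _.
by ring.
Qed.

Lemma integral_step_sum_le h L b : (forall c, c \in L -> `|h c| <= b) ->
  (\int[P]_w (step_sum h L w ^+ 2)%:E <= (b ^+ 2 * sqvar G L)%:E)%E.
Proof.
move=> hb; rewrite integral_step_sum_sqr lee_fin /sqvar mulr_sumr.
rewrite big_seq [leRHS]big_seq; apply: ler_sum => c cL.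
rewrite mulr_sumr big_seq [leRHS]big_seq; apply: ler_sum => c' cL'.
apply: le_trans (ler_norm _) _; rewrite normrM ler_wpM2r// normrM expr2.
by apply: ler_pM => //; exact: hb.
Qed.

Lemma step_sumB h k L w : step_sum h L w - step_sum k L w =
  step_sum (fun c => h c - k c) L w.
Proof. by rewrite /step_sum -sumrB; apply: eq_bigr => c _; rewrite mulrBl. Qed.

Definition tagged (A B : R) s (xi : nat -> R) (d : R) :=
  forall i, (i < size s)%N ->
    [/\ nth B (A :: s) i <= xi i <= nth B (A :: s) i.+1
      & nth B (A :: s) i.+1 - nth B (A :: s) i < d].

(* [count (<= x) s] is the index of the cell containing [x], so that sums over
   different partitions become step sums over a common refinement. *)
Definition tag_fun (f : R -> R) s (xi : nat -> R) (x : R) : R :=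
  f (xi (count (fun z => z <= x) s)).

Lemma RS_sumE f A B s xi w : itv_partition A B s ->
  RS_sum f y A B s xi w = step_sum (fun c => tag_fun f s xi c.1) (cells A s) w.
Proof.
move=> [As _]; rewrite /step_sum.
rewrite -(big_cells (fun x z => tag_fun f s xi x * (y z w - y x w)) B).
by apply: eq_bigr => i _; rewrite /tag_fun count_le_nth.
Qed.

Lemma measurable_RS_sum f A B s xi : measurable_fun setT (RS_sum f y A B s xi).
Proof.
apply: measurable_sum => i; apply: measurable_funM => //.
exact: measurable_funB.
Qed.

Lemma RS_sum_left f A B s w :
  RS_sum f y A B s (fun i => nth B (A :: s) i) w =
  step_sum (fun c => f c.1) (cells A s) w.
Proof.
by rewrite /RS_sum /step_sum (big_cells (fun x z => f x * (y z w - y x w))).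
Qed.

Lemma tagged_left A B s d : itv_partition A B s ->
  (forall c, c \in cells A s -> c.2 - c.1 < d) ->
  tagged A B s (fun i => nth B (A :: s) i) d.
Proof.
move=> [As _] h i si.
have cin : (nth B (A :: s) i, nth B (A :: s) i.+1) \in cells A s.
  rewrite /cells; have := @nth_zip_cond _ _ (B, B) (A :: s) s i.
  rewrite size_zip/= (minn_idPr _)// si => <-.
  by apply: mem_nth; rewrite size_zip/= (minn_idPr _).
have [_ /= c12 _] := mem_cells As cin.
by split; [rewrite lexx ltW|exact: (h _ cin)].
Qed.

Definition modulus (f : R -> R) (A B d om : R) :=
  forall x z, A <= x <= B -> A <= z <= B -> `|x - z| < d -> `|f x - f z| <= om.

Lemma tag_fun_close f A B s xi d om x : itv_partition A B s ->
  tagged A B s xi d -> modulus f A B d om -> A <= x < B ->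
  `|tag_fun f s xi x - f x| <= om.
Proof.
move=> ps tg md /andP[Ax xB]; have [As /eqP sB] := ps.
have [] := nth_count_le B As (x := x); first by rewrite sB Ax.
rewrite /tag_fun; move: (count _ _) => i si /andP[ix xi1].
have [/andP[h1 h2] h3] := tg i si.
have p1 : A <= nth B (A :: s) i by apply: (itv_partition_nth_ge _ ps); rewrite ltnS ltnW.
have p2 : nth B (A :: s) i.+1 <= B by apply: (itv_partition_nth_le _ ps); rewrite ltnS.
apply: md.
- by rewrite (le_trans p1)//= (le_trans h2).
- by rewrite Ax ltW.
- by rewrite ltr_norml; apply/andP; split; lra.
Qed.

Lemma RS_sum_refine f A B s xi u w : itv_partition A B s -> itv_partition A B u ->
  {subset s <= u} ->
  RS_sum f y A B s xi w = step_sum (fun c => tag_fun f s xi c.1) (cells A u) w.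
Proof.
move=> ps pu su; rewrite (RS_sumE _ _ _ ps).
have [As /eqP sB] := ps; have [Au /eqP uB] := pu.
apply/esym; apply: (refine_sum (fun x => y x w)) => //; first by rewrite sB.
by move=> c cs x cx; rewrite /tag_fun (count_le_cell As cs cx).
Qed.

Variable V : R.
Hypothesis hV : forall A B s, itv_partition A B s -> sqvar G (cells A s) <= V.

(** On the merged partition both sums become step sums. Each coefficient differs by at most [om]
    from [f] at the left end of the cell, hence the two differ by at most [2 * om], whatever the
    tags. *)
Lemma RS_sum_close f A B s xi t eta d om :
  itv_partition A B s -> itv_partition A B t ->
  tagged A B s xi d -> tagged A B t eta d -> modulus f A B d om ->
  (sqdist P (RS_sum f y A B s xi) (RS_sum f y A B t eta)
     <= ((2 * om) ^+ 2 * V)%:E)%E.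
Proof.
move=> ps pt ts tt md; have pu := merge_partP ps pt.
rewrite sqdistE.
under eq_integral => w _.
  rewrite (RS_sum_refine _ _ _ ps pu); last by move=> z; rewrite mem_merge_part => ->.
  rewrite (RS_sum_refine _ _ _ pt pu); last by move=> z; rewrite mem_merge_part orbC => ->.
  rewrite step_sumB; over.
apply: le_trans (integral_step_sum_le (b := 2 * om) _) _.
  move=> c cu; have [Au /eqP uB] := pu.
  have [h1 h2 h3] := mem_cells Au cu; rewrite uB in h3.
  have cAB : A <= c.1 < B by rewrite h1 (lt_le_trans h2).
  have e1 := tag_fun_close ps ts md cAB; have e2 := tag_fun_close pt tt md cAB.
  rewrite (_ : _ - _ = (tag_fun f s xi c.1 - f c.1) - (tag_fun f t eta c.1 - f c.1)); last by ring.
  by apply: le_trans (ler_normB _ _) _; lra.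
by rewrite lee_fin ler_wpM2l ?sqr_ge0// (hV pu).
Qed.

(** The definition of the integral provides no rate. An auxiliary partition, finer than [d] and fine
    enough for [J], gives one that depends only on [om] and [V] up to [e], hence the same for all
    shifts of an interval. *)
Lemma RS_sum_rate f A B J s xi d om e : 0 < d -> 0 < e -> A <= B ->
  ms_integral_on f y A B J -> itv_partition A B s -> tagged A B s xi d ->
  modulus f A B d om ->
  (sqdist P (RS_sum f y A B s xi) J <= (8 * om ^+ 2 * V + e)%:E)%E.
Proof.
move=> d0 e0 AB hJ ps ts md.
have e2 : 0 < e / 2 by rewrite divr_gt0.
have [d' d'0 hd'] := hJ _ e2.
have [t [pt tt]] : exists t, itv_partition A B t /\
    forall c, c \in cells A t -> c.2 - c.1 < Num.min d d'.
  by apply: exists_fine_partition; rewrite // lt_min d0.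
have tg m : Num.min d d' <= m -> tagged A B t (fun i => nth B (A :: t) i) m.
  move=> mm; apply: tagged_left => // c /tt h; exact: lt_le_trans mm.
have h1 := RS_sum_close ps pt ts (tg d _) md.
have h2 := hd' t _ pt (tg d' _).
apply: le_trans (sqdist_triangle2_lt (Y := RS_sum f y A B t (fun i => nth B (A :: t) i)) _ _ _ (h1 _) (ltW (h2 _))) _.
- exact: measurable_RS_sum.
- exact: measurable_RS_sum.
- by [].
- by rewrite ge_min lexx.
- by rewrite ge_min lexx orbT.
rewrite lee_fin; lra.
Qed.

Lemma exists_ms_integral_on f A B : A < B ->
  (forall om : R, 0 < om -> exists2 d : R, 0 < d & modulus f A B d om) ->
  exists J : {RV P >-> R}, ms_integral_on f y A B J.
Proof.
move=> AB md.
have V0 : 0 <= V.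
  have p : itv_partition (0 : R) 0 [::] by split.
  by apply: le_trans (hV p); exact: sqvar_ge0.
have /choice[s hs] : forall n : nat, exists s, itv_partition A B s /\
    tagged A B s (fun i => nth B (A :: s) i) (n.+1%:R^-1).
  move=> n; have [|s [ps h]] := @exists_fine_partition R A B (n.+1%:R^-1) (ltW AB).
    by rewrite invr_gt0.
  by exists s; split=> //; exact: tagged_left.
pose X n := RS_sum f y A B (s n) (fun i => nth B (A :: s n) i).
have tagW t xi (a b : R) : a <= b -> tagged A B t xi a -> tagged A B t xi b.
  by move=> ab h i /h[h1 h2]; split=> //; exact: lt_le_trans ab.
have omega (e : R) : 0 < e -> exists2 d : R, 0 < d &
    forall t1 t2 x1 x2, itv_partition A B t1 -> itv_partition A B t2 ->
      tagged A B t1 x1 d -> tagged A B t2 x2 d ->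
      (sqdist P (RS_sum f y A B t1 x1) (RS_sum f y A B t2 x2) <= e%:E)%E.
  (* With this [om], [(2 om)^2 V = e V / (V + 1) <= e]; [V + 1] avoids a division by zero. *)
  move=> e0; pose om := Num.sqrt (e / (4 * (V + 1))).
  have V1 : 0 < 4 * (V + 1) by lra.
  have om0 : 0 < om by rewrite sqrtr_gt0 divr_gt0.
  have [d d0 hd] := md _ om0; exists d => // t1 t2 x1 x2 p1 p2 g1 g2.
  apply: le_trans (RS_sum_close p1 p2 g1 g2 hd) _.
  rewrite lee_fin exprMn sqr_sqrtr ?divr_ge0 ?(ltW e0) ?(ltW V1)//.
  have -> : 2 ^+ 2 * (e / (4 * (V + 1))) * V = e * (V / (V + 1)).
    by field; rewrite gt_eqF; lra.
  rewrite ler_piMr ?(ltW e0)// ler_pdivrMr; lra.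
have small (d : R) : 0 < d -> exists N, forall n, (N <= n)%N -> n.+1%:R^-1 <= d.
  move=> d0; exists (Num.bound `|d^-1|) => n Nn.
  rewrite -[leRHS]invrK lef_pV2 ?posrE ?invr_gt0//.
  apply: le_trans (ler_norm _) _; apply: le_trans (ltW (archi_boundP (normr_ge0 _))) _.
  by rewrite ler_nat (leq_trans Nn).
have mX n : measurable_fun setT (X n) by exact: measurable_RS_sum.
have [|J hJ] := @sqdist_complete _ _ _ P X mX.
  move=> e e0; have [d d0 hd] := omega _ e0; have [N hN] := small _ d0.
  exists N => m n Nm Nn; have [pm tm] := hs m; have [pn tn] := hs n.
  by apply: hd => //; [exact: (tagW _ _ _ _ (hN _ Nm) tm)|exact: (tagW _ _ _ _ (hN _ Nn) tn)].
exists J => e e0; have e4 : 0 < e / 5 by rewrite divr_gt0.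
have [d d0 hd] := omega _ e4; have [N1 hN1] := small _ d0.
have [N2 _ hN2] := hJ _ e4.
exists d => // t xi pt tt; pose n := maxn N1 N2.
have [pn tn] := hs n.
apply: le_lt_trans (sqdist_triangle2_lt (Y := X n) _ _ _ (a := e / 5) (b := e / 5) _ _) _ => //.
- exact: measurable_RS_sum.
- by apply: hd => //; exact: (tagW _ _ _ _ (hN1 _ (leq_maxl _ _)) tn).
- by apply: hN2 => /=; exact: leq_maxr.
- rewrite lte_fin; lra.
Qed.

End StepSums.

(** * Improper integrals over the line and their second moments *)

Section Integrals.
Context {disp : measure_display} {T : measurableType disp} {R : realType}.
Variable P : probability T R.
Variable y : R -> {RV P >-> R}.
Hypothesis yL2 : forall u, (\int[P]_w (y u w ^+ 2)%:E < +oo)%E.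
Local Notation G := (cov_fun y).
Hypothesis Gfv : finite_variation2 G.

Definition loc_unif_continuous (f : R -> R) := forall A B om : R, 0 < om ->
  exists2 d : R, 0 < d & modulus f A B d om.

Lemma loc_unif_continuousP (f : R -> R) : loc_unif_continuous f -> continuous f.
Proof.
move=> fluc x; apply/cvgrPdist_le => e e0.
have [d d0 hd] := fluc (x - 1) (x + 1) _ e0.
near=> z.
have zd : `|x - z| < d.
  by near: z; apply: (@cvgr_dist_lt _ _ _ (nbhs x) _ idfun x) => //; exact: cvg_id.
have z1 : `|x - z| < 1.
  by near: z; apply: (@cvgr_dist_lt _ _ _ (nbhs x) _ idfun x) => //; exact: cvg_id.
apply: hd => //; first by apply/andP; split; lra.
by move: z1; rewrite ltr_norml => /andP[h1 h2]; apply/andP; split; lra.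
Unshelve. all: by end_near. Qed.

(** A partition of the inner interval is extended to the outer one. With left tags the inner terms
    cancel, and the difference is a step sum over the outer cells alone, where the variation is
    small. *)
Lemma ms_integral_on_nested f b (e : R) : loc_unif_continuous f ->
  (forall x, `|f x| <= b) -> 0 < e ->
  exists A0 B0, A0 <= B0 /\ forall A' A B B' J J',
    A' <= A -> A < A0 -> B0 < B -> B <= B' ->
    ms_integral_on f y A B J -> ms_integral_on f y A' B' J' ->
    (sqdist P J' J <= e%:E)%E.
Proof.
move=> fluc fb e0.
(* The outer cells contribute at most [b^2 e / (8 (b^2 + 1)) <= e / 8]. With two approximation
   errors [e / 12], the triangle inequality used twice gives
   [2 (e/12) + 2 (2 (e/8) + 2 (e/12)) = e]. *)
have b2 : 0 < 8 * (b ^+ 2 + 1) by have := sqr_ge0 b; lra.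
have e1 : 0 < e / (8 * (b ^+ 2 + 1)) by rewrite divr_gt0.
have [A0 [B0 [AB0 tail]]] := sqvar_tail Gfv e1.
exists A0, B0; split=> // A' A B B' J J' A'A AA0 BB0 BB' hJ hJ'.
have e12 : 0 < e / 12 by rewrite divr_gt0.
have [d d0 hd] := hJ _ e12; have [d' d'0 hd'] := hJ' _ e12.
have dd0 : 0 < Num.min d d' by rewrite lt_min d0.
have AB : A <= B by rewrite ltW// (lt_le_trans AA0)// (le_trans AB0)// ltW.
have [s1 [p1 t1]] := exists_fine_partition A'A dd0.
have [s [p t]] := exists_fine_partition AB dd0.
have [s2 [p2 t2]] := exists_fine_partition BB' dd0.
have p' := itv_partition_cat p1 (itv_partition_cat p p2).
set s' := s1 ++ s ++ s2.
have cE : cells A' s' = cells A' s1 ++ cells A s ++ cells B s2.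
  have [_ /eqP l1] := p1; have [_ /eqP l] := p.
  by rewrite /s' !cells_cat l1 l.
have fine' c : c \in cells A' s' -> c.2 - c.1 < Num.min d d'.
  by rewrite cE !mem_cat => /or3P[/t1|/t|/t2].
pose X := RS_sum f y A B s (fun i => nth B (A :: s) i).
pose X' := RS_sum f y A' B' s' (fun i => nth B' (A' :: s') i).
have h : (sqdist P X J <= (e / 12)%:E)%E.
  apply/ltW/hd => //; apply: tagged_left => // c /t /lt_le_trans; apply.
  by rewrite ge_min lexx.
have h' : (sqdist P X' J' <= (e / 12)%:E)%E.
  apply/ltW/hd' => //; apply: tagged_left => // c /fine' /lt_le_trans; apply.
  by rewrite ge_min lexx orbT.
have hh : (sqdist P X' X <= (e / 8)%:E)%E.
  rewrite sqdistE.
  have -> : (\int[P]_w ((X' w - X w) ^+ 2)%:E =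
    \int[P]_w (step_sum y (fun c => f c.1) (cells A' s1 ++ cells B s2) w ^+ 2)%:E)%E.
    apply: eq_integral => w _; congr (EFin (_ ^+ 2)).
    rewrite /X /X' !RS_sum_left cE /step_sum !big_cat/=; ring.
  apply: le_trans (integral_step_sum_le yL2 (b := b) _) _ => //.
  rewrite lee_fin; have := tail _ _ _ _ _ _ AA0 BB0 p1 p2.
  rewrite ler_pdivlMr// => h2.
  have := sqvar_ge0 G (cells A' s1 ++ cells B s2); nra.
have mX : measurable_fun setT X by exact: measurable_RS_sum.
have mX' : measurable_fun setT X' by exact: measurable_RS_sum.
rewrite sqdistC in h'.
have h1 := sqdist_triangle2_lt mX' mX (measurable_funPT J) hh h.
have h2 := sqdist_triangle2_lt (measurable_funPT J') mX' (measurable_funPT J) h' h1.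
by apply: le_trans h2 _; rewrite lee_fin; lra.
Qed.

(** The limit is found along symmetric intervals with integer ends. An arbitrary large interval is
    then compared with a larger symmetric one. *)
Lemma exists_ms_integral f b : loc_unif_continuous f ->
  (forall x, `|f x| <= b) -> exists J : {RV P >-> R}, ms_integral f y J.
Proof.
move=> fluc fb.
have [V V0 hV] := sqvar_bounded Gfv.
have /choice[JJ hJJ] : forall p : R * R, exists J : {RV P >-> R},
    p.1 < p.2 -> ms_integral_on f y p.1 p.2 J.
  move=> [A B] /=; have [AB|AB] := ltP A B.
    by have [J hJ] := exists_ms_integral_on yL2 hV AB (fun om => @fluc A B om); exists J.
  by exists (y 0).
pose X n := JJ (- n.+1%:R, n.+1%:R).
have hX n : ms_integral_on f y (- n.+1%:R) n.+1%:R (X n).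
  by apply: (hJJ (- n.+1%:R, n.+1%:R)) => /=; have := ltr0Sn R n; lra.
have large (x : R) : exists N, forall n, (N <= n)%N -> x < n.+1%:R.
  exists (Num.bound `|x|) => n Nn; apply: le_lt_trans (ler_norm _) _.
  apply: lt_le_trans (archi_boundP (normr_ge0 _)) _.
  by rewrite ler_nat (leq_trans Nn).
have mX n : measurable_fun setT (X n) by [].
have [|J hJ] := @sqdist_complete _ _ _ P (fun n => X n) mX.
  move=> e e0; have [A0 [B0 [AB0 h]]] := ms_integral_on_nested fluc fb e0.
  have [N hN] := large (Num.max (- A0) B0).
  have key m n : (N <= m)%N -> (m <= n)%N -> (sqdist P (X n) (X m) <= e%:E)%E.
    move=> Nm mn; have := hN m Nm; rewrite gt_max => /andP[h1 h2].
    have mn' : (m.+1%:R : R) <= n.+1%:R by rewrite ler_nat.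
    by apply: (h _ _ _ _ _ _ _ _ h2 mn' (hX m) (hX n)); lra.
  exists N => m n Nm Nn; have [mn|/ltnW nm] := leqP m n.
    by rewrite sqdistC; exact: key.
  exact: key.
exists J, (fun A B => JJ (A, B)); split.
  by move=> A B AB; exact: (hJJ (A, B)).
apply/ge0_cvg0P; first by move=> i; exact: sqdist_ge0.
move=> e e0; have e4 : 0 < e / 4 by rewrite divr_gt0.
have [A0 [B0 [AB0 h]]] := ms_integral_on_nested fluc fb e4.
have [N1 _ hN1] := hJ _ e4.
exists ([set A | A < A0], [set B | B0 < B]).
  split => /=; first by exists A0; split; rewrite ?num_real.
  by exists B0; split; rewrite ?num_real.
move=> [A B] /= [AA0 BB0]; have [N2 hN2] := large (Num.max (- A) B).
pose n := maxn N1 N2; have := hN2 n (leq_maxr _ _); rewrite gt_max => /andP[h1 h2].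
have AB : A < B by apply: lt_trans AA0 (le_lt_trans AB0 BB0).
have q1 : (sqdist P (JJ (A, B)) (X n) <= (e / 4)%:E)%E.
  rewrite sqdistC; apply: (h _ _ _ _ _ _ _ AA0 BB0 (ltW h2) (hJJ (A, B) AB) (hX n)).
  by lra.
have q2 : (sqdist P (X n) J <= (e / 4)%:E)%E by apply: hN1; exact: leq_maxl.
have := sqdist_triangle2_lt (measurable_funPT (JJ (A, B))) (mX n) (measurable_funPT J) q1 q2.
by move=> /le_trans; apply; rewrite lee_fin; lra.
Qed.

Lemma cvg_sum_seq (I : eqType) (U : Type) (F : set_system U) (FF : Filter F)
    (s : seq I) (h : I -> U -> R) (l : I -> R) :
  (forall i, i \in s -> h i x @[x --> F] --> l i) ->
  \sum_(i <- s) h i x @[x --> F] --> \sum_(i <- s) l i.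
Proof.
elim: s => [|i s ih] hl.
  by rewrite big_nil; under eq_fun do rewrite big_nil; exact: cvg_cst.
rewrite big_cons; under eq_fun do rewrite big_cons.
apply: cvgD; first by apply: hl; exact: mem_head.
by apply: ih => j js; apply: hl; rewrite inE js orbT.
Qed.

(** The cells are half-open and disjoint, so at most one term is nonzero. *)
Lemma sum_cells_indic_le (F : R -> R) (a : R * R -> R) A s x :
  path <%R A s -> (forall z, 0 <= F z) ->
  (forall c, c \in cells A s -> forall z, c.1 < z <= c.2 -> a c <= F z) ->
  \sum_(c <- cells A s) a c * \1_(`]c.1, c.2]%classic) x <= F x.
Proof.
move=> + F0; elim: s A => [|z s ih] A /=; first by rewrite big_nil.
move=> /andP[Az zs] h; rewrite cells_cons big_cons/=.
have [xz|zx] := leP x z.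
  rewrite big_seq big1 ?addr0; last first.
    move=> c cs; rewrite indicE memNset ?mulr0//= in_itv/=.
    have [zc _ _] := mem_cells zs cs.
    by move=> /andP[]; rewrite ltNge (le_trans xz zc).
  have [Ax|xA] := ltP A x.
    by rewrite indicE mem_set/= ?in_itv/= ?Ax ?xz// mulr1; apply: h; rewrite ?mem_head//= Ax.
  by rewrite indicE memNset/= ?in_itv/= ?mulr0// ltNge xA.
rewrite indicE memNset/= ?in_itv/= ?mulr0 ?add0r; last first.
  by move=> /andP[_]; rewrite leNgt zx.
apply: ih => // c cs; apply: h; by rewrite cells_cons inE cs orbT.
Qed.

Variable nu : {charge set (R * R)%type -> \bar R}.
Variables (Pos Neg : set (R * R)%type).
Variable hahn : hahn_decomposition nu Pos Neg.
Hypothesis hnu : LS_generated G nu.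
Local Notation mu := (charge_variation hahn).

Lemma cells_map_add (p A : R) s :
  cells (A + p) [seq z + p | z <- s] = [seq (c.1 + p, c.2 + p) | c <- cells A s].
Proof. by elim: s A => //= z s ih A; rewrite !cells_cons/= ih. Qed.

Lemma measurable_luc f : loc_unif_continuous f -> measurable_fun setT f.
Proof. by move=> h; apply: continuous_measurable_fun => x; exact: loc_unif_continuousP. Qed.

Lemma measurable_prod_fun (f g : R -> R) : measurable_fun setT f ->
  measurable_fun setT g -> measurable_fun setT (fun z : R * R => f z.1 * g z.2).
Proof.
by move=> mf mg; apply: measurable_funM; apply: measurableT_comp => //.
Qed.

Lemma variation_fin_num : mu setT \is a fin_num.
Proof. exact: fin_num_measure. Qed.

(** [|nu|] of a rectangle is at most its variation, so the double sum is bounded by the integral of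
    a product of two step functions, each at most [|f| + om]. The error [om (|f z.1| + |f z.2|) +
    om^2 <= 2 b om + om^2] is integrated over a finite measure. *)
Lemma integral_cells_le (f : R -> R) (b om : R) A s : loc_unif_continuous f ->
  (forall x, `|f x| <= b) -> 0 <= om -> path <%R A s ->
  (forall c, c \in cells A s -> forall z, c.1 < z <= c.2 -> `|f c.1| <= `|f z| + om) ->
  ((\sum_(c <- cells A s) \sum_(c' <- cells A s)
      f c.1 * f c'.1 * fine (nu (`]c.1, c.2] `*` `]c'.1, c'.2])))%:E <=
   \int[mu]_z (`|f z.1| * `|f z.2|)%:E + ((2 * b * om + om ^+ 2) * fine (mu setT))%:E)%E.
Proof.
move=> fluc fb om0 As hc.
have b0 : 0 <= b by apply: le_trans (fb 0).
have mf := measurable_luc fluc.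
have mnf : measurable_fun setT (fun x => `|f x|) by exact: measurableT_comp.
pose Rc (c c' : R * R) : set (R * R) := `]c.1, c.2] `*` `]c'.1, c'.2].
have mRc c c' : measurable (Rc c c') by apply: measurableX; exact: measurable_itv.
apply: (@le_trans _ _ (\sum_(c <- cells A s) \sum_(c' <- cells A s)
    (`|f c.1| * `|f c'.1|)%:E * mu (Rc c c'))%E).
  rewrite -sumEFin; apply: lee_sum => c _; rewrite -sumEFin; apply: lee_sum => c' _.
  rewrite -/(Rc c c'); have nufin : nu (Rc c c') \is a fin_num by exact: fin_num_measure.
  apply: (@le_trans _ _ ((`|f c.1| * `|f c'.1|)%:E * `|nu (Rc c c')|)%E); last first.
    by apply: lee_wpmul2l; rewrite ?lee_fin ?mulr_ge0//; exact: abse_charge_variation.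
  rewrite -[in leRHS](fineK nufin) -EFinM lee_fin -!normrM; exact: ler_norm.
apply: (@le_trans _ _ (\int[mu]_z (\sum_(c <- cells A s) \sum_(c' <- cells A s)
    ((`|f c.1| * `|f c'.1|)%:E * (\1_(Rc c c') z)%:E)))%E).
  have t0 c c' z : (0 <= (`|f c.1| * `|f c'.1|)%:E * (\1_(Rc c c') z)%:E)%E.
    by rewrite -EFinM lee_fin !mulr_ge0.
  have mt c c' : measurable_fun setT (fun z => ((`|f c.1| * `|f c'.1|)%:E * (\1_(Rc c c') z)%:E)%E).
    by apply: measurable_funeM; apply/measurable_EFinP; exact: measurable_indic.
  rewrite ge0_integral_sum//; last 2 first.
  - by move=> c; apply: emeasurable_sum.
  - by move=> c z _; apply: sume_ge0.
  rewrite le_eqVlt; apply/orP; left; apply/eqP; apply: eq_bigr => c _.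
  rewrite ge0_integral_sum//; apply: eq_bigr => c' _.
  rewrite ge0_integralZl_EFin//; last first.
    by first [move=> z _; rewrite lee_fin|apply/measurable_EFinP; exact: measurable_indic].
  by rewrite integral_indic// setIT.
have -> : ((2 * b * om + om ^+ 2) * fine (mu setT))%:E =
    (\int[mu]_z (cst (2 * b * om + om ^+ 2)%:E z))%E.
  by rewrite integral_cst// EFinM fineK// variation_fin_num.
have mff : measurable_fun setT (fun z : R * R => `|f z.1| * `|f z.2|).
  exact: (measurable_prod_fun mnf mnf).
have com0 : 0 <= 2 * b * om + om ^+ 2 by rewrite addr_ge0 ?sqr_ge0// !mulr_ge0.
rewrite -ge0_integralD//; [|by [move=> z _; rewrite lee_fin|apply/measurable_EFinP]..].
apply: ge0_le_integral => //.
- by move=> z _; apply: sume_ge0 => c _; apply: sume_ge0 => c' _; rewrite -EFinM lee_fin !mulr_ge0.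
- apply: emeasurable_sum => c; apply: emeasurable_sum => c'.
  by apply: measurable_funeM; apply/measurable_EFinP; exact: measurable_indic.
- by apply/measurable_EFinP; exact: measurable_funD.
move=> [z1 z2] _ /=.
under eq_bigr do (under eq_bigr do rewrite -EFinM; rewrite sumEFin).
rewrite sumEFin -EFinD lee_fin.
have S1 z : \sum_(c <- cells A s) `|f c.1| * \1_(`]c.1, c.2]%classic) z <= `|f z| + om.
  by apply: (sum_cells_indic_le (F := fun z => `|f z| + om)) => // ?; rewrite addr_ge0.
have S0 z : 0 <= \sum_(c <- cells A s) `|f c.1| * \1_(`]c.1, c.2]%classic) z.
  by apply: sumr_ge0 => c _; rewrite mulr_ge0.
apply: (@le_trans _ _ ((\sum_(c <- cells A s) `|f c.1| * \1_(`]c.1, c.2]%classic) z1) *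
   (\sum_(c <- cells A s) `|f c.1| * \1_(`]c.1, c.2]%classic) z2))).
  rewrite mulr_suml; apply: ler_sum => c _; rewrite mulr_sumr; apply: ler_sum => c' _.
  by rewrite !indicE in_setX/= -mulnb natrM mulrACA.
apply: le_trans (ler_pM (S0 _) (S0 _) (S1 _) (S1 _)) _.
have := fb z1; have := fb z2; have := normr_ge0 (f z1); have := normr_ge0 (f z2).
by move: `|f z1| `|f z2| => u v; nra.
Qed.

(* The partition points are shifted by [p -> 0+], because [nu] is only known
   through right limits of the increments of [G]. *)
Lemma ms_integral_sqr_le f (b : R) J : loc_unif_continuous f ->
  (forall x, `|f x| <= b) -> ms_integral f y J ->
  (\int[P]_w (J w ^+ 2)%:E <= \int[mu]_z (`|f z.1| * `|f z.2|)%:E)%E.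
Proof.
move=> fluc fb [JJ [hJJ cvJ]].
have [V V0 hV] := sqvar_bounded Gfv.
set K := (\int[mu]_z _)%E.
have mf := measurable_luc fluc.
have mnf : measurable_fun setT (fun x => `|f x|) by exact: measurableT_comp.
have b0 : 0 <= b by apply: le_trans (fb 0).
have M0 : 0 <= fine (mu setT) by rewrite fine_ge0.
have K0 : (0 <= K)%E by apply: integral_ge0 => z _; rewrite lee_fin mulr_ge0.
have Kfin : K \is a fin_num.
  rewrite ge0_fin_numE//; apply: (@le_lt_trans _ _ (\int[mu]_z (cst (b * b)%:E z))%E).
    apply: ge0_le_integral => //.
    - by apply/measurable_EFinP; exact: (measurable_prod_fun mnf mnf).
    - by move=> z _; rewrite lee_fin ler_pM.
  rewrite integral_cst// lte_mul_pinfty// ?lee_fin ?mulr_ge0//.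
  by rewrite ltey_eq variation_fin_num.
suff main (e : R) : 0 < e ->
    (\int[P]_w (J w ^+ 2)%:E <= ((1 + e) * (fine K + e) + e)%:E)%E.
  apply/lee_addgt0Pr => e e0; have k0 : 0 <= fine K by rewrite fine_ge0.
  (* [(1 + e') (k + e') + e' <= k + e' (k + 3)] for [e' <= 1], with [k = fine K]. *)
  pose e' := Num.min 1 (e / (fine K + 3)).
  have e'0 : 0 < e' by rewrite lt_min ltr01 divr_gt0//; lra.
  apply: le_trans (main _ e'0) _; rewrite -(fineK Kfin) -EFinD lee_fin.
  have h1 : e' <= 1 by rewrite ge_min lexx.
  have h2 : e' * (fine K + 3) <= e.
    by rewrite -ler_pdivlMr; [rewrite ge_min lexx orbT|lra].
  by nra.
move=> e0; set M := fine (mu setT) in M0.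
have ei0 : 0 < 1 + e^-1 by rewrite addr_gt0// invr_gt0.
have [om om0 [omM omV]] : exists2 om : R, 0 < om &
    (2 * b * om + om ^+ 2) * M <= e /\ (1 + e^-1) * (16 * om ^+ 2 * V) <= e / 2.
  (* [om] has to control two errors: the passage from cells to the integral, and the mean-square
     error of a sum, which is multiplied by the Young factor [1 + e^-1]. As [om <= 1] gives
     [om^2 <= om], linear bounds in [om] suffice. *)
  pose k1 := (2 * b + 1) * M + 1; pose k2 := (1 + e^-1) * (16 * V) + 1.
  have k10 : 0 < k1 by rewrite /k1 ltr_pwDr// mulr_ge0//; lra.
  have k20 : 0 < k2 by rewrite /k2 ltr_pwDr// !mulr_ge0// ltW.
  pose om := Num.min 1 (Num.min (e / k1) (e / 2 / k2)).
  have om0 : 0 < om by rewrite !lt_min ltr01 !divr_gt0.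
  have om1 : om <= 1 by rewrite ge_min lexx.
  have omk1 : om * k1 <= e by rewrite -ler_pdivlMr// !ge_min lexx orbT.
  have omk2 : om * k2 <= e / 2 by rewrite -ler_pdivlMr// !ge_min lexx !orbT.
  have om2 : om ^+ 2 <= om by rewrite expr2 ler_piMr// ltW.
  exists om => //; split.
    apply: le_trans omk1; rewrite /k1.
    apply: (@le_trans _ _ ((2 * b * om + om) * M)); first by rewrite ler_wpM2r// lerD2l.
    by rewrite mulrDr mulr1 -subr_ge0; nra.
  apply: le_trans omk2; rewrite /k2.
  apply: (@le_trans _ _ ((1 + e^-1) * (16 * V) * om)); last by lra.
  have -> : (1 + e^-1) * (16 * om ^+ 2 * V) = (1 + e^-1) * (16 * V) * om ^+ 2 by ring.
  by rewrite ler_wpM2l// !mulr_ge0// ltW.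
have [e1 e10 he1] : exists2 e1 : R, 0 < e1 & (1 + e^-1) * (4 * e1) <= e / 2.
  exists (e / 8 / (1 + e^-1)); first by rewrite !divr_gt0.
  by rewrite le_eqVlt; apply/orP; left; apply/eqP; field; rewrite !gt_eqF//; lra.
(* The interval must serve every shift [p] in [(0, 1)], since [p] tends to 0 while the partition
   stays fixed; accordingly the modulus of [f] is taken on [[A, B + 1]]. *)
have [A [B [AB hAB]]] : exists A B : R, A < B /\ forall p : R, 0 < p < 1 ->
    (sqdist P (JJ (A + p)%R (B + p)%R) J <= e1%:E)%E.
  move: cvJ => /ge0_cvg0P-/(_ (fun=> sqdist_ge0 _ _ _))/(_ _ e10).
  move=> [[S1 S2] /= [[a0 [_ ha0]] [b0' [_ hb0]]] hS].
  have h1 : - a0 <= `|a0| by rewrite -normrN ler_norm.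
  have h2 : b0' <= `|b0'| by rewrite ler_norm.
  have h3 := normr_ge0 a0; have h4 := normr_ge0 b0'.
  pose A : R := - (`|a0| + `|b0'| + 2); pose B : R := `|b0'| + 1.
  exists A, B; split; first by rewrite /A /B; lra.
  move=> p /andP[p0 p1].
  have q1 : A + p < a0 by rewrite /A; lra.
  have q2 : b0' < B + p by rewrite /B; lra.
  exact: (hS (A + p, B + p) (conj (ha0 _ q1) (hb0 _ q2))).
have [d d0 hd] := fluc A (B + 1) _ om0.
have [s [ps hs]] := exists_fine_partition (ltW AB) d0.
have [As /eqP lB] := ps.
pose Q (p : R) := \sum_(c <- cells A s) \sum_(c' <- cells A s)
  f (c.1 + p) * f (c'.1 + p) * rect_incr G (c.1 + p) (c.2 + p) (c'.1 + p) (c'.2 + p).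
have JQ (p : R) : 0 < p < 1 -> (\int[P]_w (J w ^+ 2)%:E <= ((1 + e) * Q p + e)%:E)%E.
  move=> /[dup] p01 /andP[p0 p1]; pose sp := [seq z + p | z <- s].
  have psp : itv_partition (A + p) (B + p) sp.
    split; last by rewrite -lB (last_map (fun z => z + p)).
    by rewrite -[A + p]/((fun z => z + p) A) path_map; apply: sub_path As => u v /=; rewrite ltrD2r.
  have hsp c : c \in cells (A + p) sp -> c.2 - c.1 < d.
    by rewrite cells_map_add => /mapP[c' /hs h ->] /=; lra.
  pose S := RS_sum f y (A + p) (B + p) sp (fun i => nth (B + p) (A + p :: sp) i).
  have mS : measurable_fun setT S by exact: measurable_RS_sum.
  have AB' : A + p < B + p by rewrite ltrD2r.
  have mod : modulus f (A + p) (B + p) d om.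
    by move=> x z /andP[x1 x2] /andP[z1 z2]; apply: hd; apply/andP; split; lra.
  have r1 := RS_sum_rate yL2 hV d0 e10 (ltW AB') (hJJ _ _ AB') psp (tagged_left psp hsp) mod.
  have r2 := sqdist_triangle2_lt mS (measurable_funPT (JJ (A + p) (B + p)))
    (measurable_funPT J) r1 (hAB p p01).
  have m0 : measurable_fun setT (cst 0 : T -> R) by [].
  have := sqdist_triangle P e0 m0 mS (measurable_funPT J).
  rewrite (sqdistC _ (cst 0) J) (sqdistC _ (cst 0) S) !sqdistE.
  under eq_integral do rewrite subr0.
  under [in X in (_ <= X)%E]eq_integral do rewrite subr0.
  move=> /le_trans; apply.
  have -> : (\int[P]_w (S w ^+ 2)%:E = (Q p)%:E)%E.
    rewrite /S; under eq_integral do rewrite RS_sum_left.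
    rewrite integral_step_sum_sqr// cells_map_add big_map; congr EFin.
    by apply: eq_bigr => c _; rewrite big_map.
  rewrite [leRHS]EFinD -EFinM leeD2l//.
  rewrite sqdistE in r2.
  apply: le_trans (lee_wpmul2l _ r2) _; first by rewrite lee_fin ltW.
  by rewrite -EFinM lee_fin; lra.
(* The limit of [Q p]: [f] is continuous, and the right limits of the increments of the covariance
   are the masses of [nu] on half-open rectangles. *)
pose Q0 := \sum_(c <- cells A s) \sum_(c' <- cells A s)
      f c.1 * f c'.1 * fine (nu (`]c.1, c.2] `*` `]c'.1, c'.2])).
have QQ0 : Q p @[p --> 0^'+] --> Q0.
  have fcont := loc_unif_continuousP fluc.
  have fp (x : R) : f (x + p) @[p --> 0^'+] --> f x.
    apply: cvg_at_right_filter.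
    apply: (cvg_comp (fun p : R => x + p) f _ (fcont x)).
    have : x + p @[p --> (0 : R)] --> x + 0 by apply: cvgD; [exact: cvg_cst|exact: cvg_id].
    by rewrite addr0.
  apply: cvg_sum_seq => c cs; apply: cvg_sum_seq => c' cs'.
  apply: cvgM; first by apply: cvgM; exact: fp.
  have [_ c12 _] := mem_cells As cs; have [_ c12' _] := mem_cells As cs'.
  have := hnu c12 c12'.
  have nufin : nu (`]c.1, c.2] `*` `]c'.1, c'.2]) \is a fin_num.
    by apply: fin_num_measure; apply: measurableX; exact: measurable_itv.
  rewrite -{1}(fineK nufin) => /fine_cvgP[_ H].
  have pr : (fun p : R => (p, p)) @ 0^'+ --> filter_prod (at_right (0 : R)) (at_right (0 : R)).
    move=> S [[S1 S2] /= [h1 h2] sub].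
    by apply: filterS (filterI h1 h2) => p [p1 p2]; exact: (sub (p, p) (conj p1 p2)).
  exact: (cvg_comp _ _ pr H).
have Jfin : (\int[P]_w (J w ^+ 2)%:E)%E \is a fin_num.
  rewrite ge0_fin_numE; last by apply: integral_ge0 => w _; rewrite lee_fin sqr_ge0.
  have h12 : 0 < (2^-1 : R) < 1 by rewrite invr_gt0 ltr0n invf_lt1// ltr1n.
  by apply: le_lt_trans (JQ _ h12) _; rewrite ltry.
have JQ0 : fine (\int[P]_w (J w ^+ 2)%:E) <= (1 + e) * Q0 + e.
  have cv : (fun p => (1 + e) * Q p + e) @ 0^'+ --> (1 + e) * Q0 + e.
    by apply: cvgD; [apply: cvgM => //; exact: cvg_cst|exact: cvg_cst].
  rewrite -(cvg_lim _ cv)//; apply: limr_ge; first by apply/cvg_ex; eexists; exact: cv.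
  near=> p; rewrite -lee_fin fineK//; apply: JQ; apply/andP; split.
    by near: p; exact: nbhs_right_gt.
  by near: p; apply: nbhs_right_lt.
rewrite -(fineK Jfin) lee_fin; apply: le_trans JQ0 _; rewrite lerD2r ler_wpM2l//.
  by rewrite addr_ge0// ltW.
have := @integral_cells_le f b om A s fluc fb (ltW om0) As.
rewrite -/Q0 -/K -(fineK Kfin) -/M => H.
have : (Q0%:E <= (fine K)%:E + ((2 * b * om + om ^+ 2) * M)%:E)%E.
  apply: H => c cs z /andP[z1 z2].
  have [h1 h2 h3] := mem_cells As cs; have h4 := hs _ cs; rewrite lB in h3.
  have : `|f c.1 - f z| <= om.
    by apply: hd; rewrite ?ltr_norml; apply/andP; split; lra.
  by have := lerB_normD (f c.1) (- f z); rewrite normrN; lra.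
by rewrite -EFinD lee_fin; lra.
Unshelve. all: by end_near. Qed.

End Integrals.

(** * The norm tau *)

Section Tau.
Context {disp : measure_display} {T : measurableType disp} {R : realType}.
Variable P : probability T R.
Implicit Types X Y : T -> R.

Lemma mgfE X l : ('M_P X l = \int[P]_w (expR (X w * l))%:E)%E.
Proof. by rewrite /mmt_gen_fun unlock. Qed.

Lemma powphi_le (alpha x z : R) : 0 < alpha -> `|x| <= `|z| ->
  powphi alpha x <= powphi alpha z.
Proof.
move=> a0 xz; rewrite /powphi ler_wpM2r ?invr_ge0 ?(ltW a0)//.
by rewrite ge0_ler_powR ?nnegrE// ltW.
Qed.

Lemma powphi_ge0 (alpha x : R) : 0 < alpha -> 0 <= powphi alpha x.
Proof. by move=> a0; rewrite /powphi divr_ge0 ?powR_ge0// ltW. Qed.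

Lemma mgf_bounded_le (alpha a b : R) X : 0 < alpha -> 0 <= a -> a <= b ->
  mgf_bounded P (powphi alpha) X a -> mgf_bounded P (powphi alpha) X b.
Proof.
move=> al0 a0 ab h l; apply: le_trans (h l) _; rewrite lee_fin ler_expR.
apply: powphi_le => //; rewrite !normrM ler_wpM2l// !ger0_norm//.
exact: le_trans ab.
Qed.

Lemma tau_ge0 phi X : (0 <= tau P phi X)%E.
Proof.
apply: le_ereal_inf_tmp => _ [a [a0 _] <-]; rewrite lee_fin; exact: ltW.
Qed.

Lemma tau_lt_mgf_bounded (alpha a : R) X : 0 < alpha ->
  (tau P (powphi alpha) X < a%:E)%E -> 0 < a /\ mgf_bounded P (powphi alpha) X a.
Proof.
move=> al0 /ereal_inf_lt[_ [b [b0 hb] <-]]; rewrite lte_fin => ba.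
split; first exact: lt_trans ba.
exact: (mgf_bounded_le al0 (ltW b0) (ltW ba)).
Qed.

Lemma tau_le (phi : R -> R) (e : R) X : 0 <= e ->
  (forall a, e < a -> mgf_bounded P phi X a) -> (tau P phi X <= e%:E)%E.
Proof.
move=> e0 h; apply/lee_addgt0Pr => d d0; apply: ereal_inf_lbound.
by exists (e + d) => //; split; [lra|apply: h; lra].
Qed.

Lemma continuous_powphi (alpha x : R) : 0 < alpha ->
  {for x, continuous (powphi alpha)}.
Proof.
move=> a0; rewrite /powphi; apply: cvgM; last exact: cvg_cst.
have [->|x0] := eqVneq x 0; last first.
  have H : {for `|x|, continuous (fun z : R => z `^ alpha)}.
    apply: differentiable_continuous; apply/derivable1_diffP.
    by apply: derivable_powR; rewrite in_itv/= andbT normr_gt0.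
  exact: (cvg_comp _ _ (@norm_continuous _ R^o x) H).
rewrite normr0 powR0 ?gt_eqF//.
apply/cvgr0Pnorm_le => e e0; near=> z.
rewrite ger0_norm ?powR_ge0//.
have -> : e = (e `^ alpha^-1) `^ alpha.
  by rewrite -powRrM mulVf ?gt_eqF// powRr1// ltW.
rewrite ge0_ler_powR ?nnegrE ?powR_ge0 ?(ltW a0)//.
by near: z; apply: cvgr0_norm_le; [exact: cvg_id|rewrite powR_gt0].
Unshelve. all: by end_near. Qed.

(** The set defining [tau] excludes 0 and need not contain its infimum, so [a] decreases to [e] and
    continuity of [powphi] gives the bound at [e] itself, also for [e = 0]. *)
Lemma tau_le_mgf (alpha e l : R) X : 0 < alpha ->
  (tau P (powphi alpha) X <= e%:E)%E ->
  ('M_P X l <= (expR (powphi alpha (l * e)))%:E)%E.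
Proof.
move=> al0 h.
have Ml a : e < a -> ('M_P X l <= (expR (powphi alpha (l * a)))%:E)%E.
  move=> ea; have [_ ->//] := tau_lt_mgf_bounded al0 (le_lt_trans h (ea : (e%:E < a%:E)%E)).
have M0 : (0 <= 'M_P X l)%E by rewrite mgfE; apply: integral_ge0 => w _; rewrite lee_fin expR_ge0.
have Mfin : 'M_P X l \is a fin_num.
  by rewrite ge0_fin_numE//; apply: le_lt_trans (Ml (e + 1) _) _; rewrite ?ltry//; lra.
rewrite -(fineK Mfin) lee_fin.
have cv : expR (powphi alpha (l * a)) @[a --> e^'+] --> expR (powphi alpha (l * e)).
  apply: cvg_at_right_filter.
  apply: (cvg_comp (fun a => powphi alpha (l * a)) (@expR R)); last exact: continuous_expR.
  apply: (cvg_comp (fun a => l * a) (powphi alpha)); last exact: continuous_powphi.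
  by apply: cvgM; [exact: cvg_cst|exact: cvg_id].
rewrite -(cvg_lim _ cv)//; apply: limr_ge; first by apply/cvg_ex; eexists; exact: cv.
near=> a; rewrite -lee_fin fineK//; apply: Ml.
by near: a; exact: nbhs_right_gt.
Unshelve. all: by end_near. Qed.

Lemma measurable_expRM X l : measurable_fun setT X ->
  measurable_fun setT (fun w => expR (X w * l)).
Proof.
by move=> mX; apply: measurableT_comp => //; exact: measurable_funM.
Qed.

Lemma sqr_le_expR (x : R) : x ^+ 2 <= 2 * (expR x + expR (- x)).
Proof.
have key (z : R) : 0 <= z -> z ^+ 2 <= 2 * expR z.
  by move=> z0; have := expR_ge1Dxn 1 z0; rewrite (_ : 2`! = 2)%N// => h; lra.
have := expR_gt0 x; have := expR_gt0 (- x); have [x0|x0] := leP 0 x.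
  by have := key _ x0; lra.
by have := key (- x); rewrite sqrrN; lra.
Qed.

Lemma sub_gaussian_L2 (phi : R -> R) X : measurable_fun setT X ->
  sub_gaussian P phi X -> (\int[P]_w (X w ^+ 2)%:E < +oo)%E.
Proof.
move=> mX [_ Mfin _].
have m1 l : measurable_fun setT (fun w => (expR (X w * l))%:E).
  by apply/measurable_EFinP; exact: measurable_expRM.
apply: (@le_lt_trans _ _ (\int[P]_w (2%:E * ((expR (X w * 1))%:E + (expR (X w * -1))%:E)))%E).
  apply: ge0_le_integral => //.
  - by move=> w _; rewrite lee_fin sqr_ge0.
  - by apply/measurable_EFinP; exact: measurable_funX.
  - by apply: measurable_funeM; exact: emeasurable_funD.
  - by move=> w _; rewrite -EFinD -EFinM lee_fin mulr1 mulrN1 sqr_le_expR.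
rewrite ge0_integralZl_EFin//; [|by [move=> w _; rewrite adde_ge0// lee_fin expR_ge0|exact: emeasurable_funD]..].
rewrite ge0_integralD//; [|by move=> w _; rewrite lee_fin expR_ge0..].
by rewrite lte_mul_pinfty// -!mgfE lte_add_pinfty.
Qed.

Lemma l2normE X : l2norm P X = Num.sqrt (fine (\int[P]_w (X w ^+ 2)%:E)%E).
Proof. by rewrite /l2norm unlock. Qed.

Lemma integral_sqr_ge0 X : (0 <= \int[P]_w (X w ^+ 2)%:E)%E.
Proof. by apply: integral_ge0 => w _; rewrite lee_fin sqr_ge0. Qed.

Lemma integral_sqr_le (e : R) X Y : 0 < e ->
  measurable_fun setT X -> measurable_fun setT Y ->
  (\int[P]_w (Y w ^+ 2)%:E <=
   (1 + e)%:E * \int[P]_w (X w ^+ 2)%:E + (1 + e^-1)%:E * sqdist P X Y)%E.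
Proof.
move=> e0 mX mY; have m0 : measurable_fun setT (cst 0 : T -> R) by [].
have := sqdist_triangle P e0 m0 mX mY.
rewrite (sqdistC _ (cst 0) X) (sqdistC _ (cst 0) Y) !sqdistE.
under eq_integral do rewrite subr0.
by under [in X in (_ <= X)%E]eq_integral do rewrite subr0.
Qed.

Lemma l2norm_limit (X : nat -> T -> R) (J : T -> R) (b : R) :
  (forall n, measurable_fun setT (X n)) -> measurable_fun setT J ->
  (\int[P]_w (J w ^+ 2)%:E < +oo)%E ->
  (forall e : R, 0 < e -> \forall n \near \oo, (sqdist P (X n) J <= e%:E)%E) ->
  l2norm P J < b -> \forall n \near \oo, l2norm P (X n) < b.
Proof.
move=> mX mJ J2 h; have b0 := le_lt_trans (sqrtr_ge0 _) _.
rewrite l2normE; set s := fine _ => sb.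
have Jfin : (\int[P]_w (J w ^+ 2)%:E)%E \is a fin_num.
  by rewrite ge0_fin_numE// integral_sqr_ge0.
have s0 : 0 <= s by rewrite fine_ge0// integral_sqr_ge0.
have {}b0 : 0 < b by apply: le_lt_trans sb; exact: sqrtr_ge0.
have sb2 : s < b ^+ 2.
  by rewrite -(sqr_sqrtr s0) ltrXn2r ?nnegrE ?sqrtr_ge0 ?(ltW b0).
(* Chosen so that [(1 + e) * s + e] is the midpoint of [s] and [b^2]. *)
pose e := (b ^+ 2 - s) / (2 * (s + 1)).
have e0 : 0 < e by rewrite divr_gt0//; lra.
have ei0 : 0 < 1 + e^-1 by rewrite addr_gt0// invr_gt0.
have d0 : 0 < e / (1 + e^-1) by rewrite divr_gt0.
apply: filterS (h _ d0) => n hn; rewrite l2normE.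
have : (\int[P]_w (X n w ^+ 2)%:E <= ((1 + e) * s + e)%:E)%E.
  apply: le_trans (integral_sqr_le e0 mJ (mX n)) _.
  rewrite -(fineK Jfin) -EFinM [leRHS]EFinD leeD2l//.
  rewrite sqdistC; apply: le_trans (lee_wpmul2l _ hn) _; first by rewrite lee_fin ltW.
  by rewrite -EFinM lee_fin mulrC divfK// gt_eqF.
move=> hle; have Xfin : (\int[P]_w (X n w ^+ 2)%:E)%E \is a fin_num.
  by rewrite ge0_fin_numE ?integral_sqr_ge0//; apply: le_lt_trans hle _; rewrite ltry.
move: hle; rewrite -{1}(fineK Xfin) lee_fin => hle.
rewrite -[ltRHS](ger0_norm (ltW b0)) -sqrtr_sqr ltr_sqrt ?exprn_gt0//.
apply: le_lt_trans hle _.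
have -> : (1 + e) * s + e = s + (b ^+ 2 - s) / 2.
  by rewrite /e; field; rewrite gt_eqF//; lra.
by lra.
Qed.

(** For fixed [a] above the claimed bound, the norms of [X n] are eventually below [a], so the
    exponential moments obey one common bound, which Fatou's lemma passes to the limit along an
    almost everywhere convergent subsequence. *)
Lemma tau_limit (alpha C : R) (X : nat -> T -> R) (J : T -> R) : 0 < alpha -> 0 <= C ->
  (forall n, measurable_fun setT (X n)) -> measurable_fun setT J ->
  (\int[P]_w (J w ^+ 2)%:E < +oo)%E ->
  (forall e : R, 0 < e -> \forall n \near \oo, (sqdist P (X n) J <= e%:E)%E) ->
  (forall n, (tau P (powphi alpha) (X n) <= (C * l2norm P (X n))%:E)%E) ->
  (tau P (powphi alpha) J <= (C * l2norm P J)%:E)%E.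
Proof.
move=> al0 C0 mX mJ J2 h ht.
have [f [nf hf]] := sqdist_cvg_ae_subseq mX mJ h.
apply: tau_le; first by rewrite mulr_ge0// l2normE sqrtr_ge0.
move=> a aC l; have a0 : 0 < a.
  by apply: le_lt_trans aC; rewrite mulr_ge0// l2normE sqrtr_ge0.
have ta : \forall n \near \oo, C * l2norm P (X n) < a.
  move: C0; rewrite le_eqVlt => /predU1P[<-|C0].
    by apply: nearW => n; rewrite mul0r.
  have : l2norm P J < a / C by rewrite ltr_pdivlMr// mulrC.
  move=> /(l2norm_limit mX mJ J2 h); apply: filterS => n.
  by rewrite ltr_pdivlMr// mulrC.
rewrite mgfE; apply: (@le_integral_limit _ _ _ P (fun n w => expR (X (f n) w * l))) => //.
- by move=> n; exact: measurable_expRM.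
- exact: measurable_expRM.
- apply: filterS hf => w hw.
  apply: (cvg_comp (fun n => X (f n) w * l) (@expR R)); last exact: continuous_expR.
  by apply: cvgM => //; exact: cvg_cst.
- case: ta => N _ hN; exists N => // n /= Nn.
  have : (tau P (powphi alpha) (X (f n)) < a%:E)%E.
    apply: le_lt_trans (ht _) _; rewrite lte_fin; apply: hN => /=.
    exact: leq_trans (nf n).
  by move=> /(tau_lt_mgf_bounded al0)[_ /(_ l)]; rewrite mgfE.
Qed.

End Tau.

(** * Finite linear combinations of values of the process *)

Section LinComb.
Context {disp : measure_display} {T : measurableType disp} {R : realType}.
Variable P : probability T R.
Variable y : R -> {RV P >-> R}.

Definition lincomb (s : seq (R * R)) (w : T) : R := \sum_(p <- s) p.1 * y p.2 w.

Lemma measurable_lincomb s : measurable_fun setT (lincomb s).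
Proof. by apply: measurable_sum => p; exact: measurable_funM. Qed.

Lemma step_sum_lincomb h L : exists s, step_sum y h L =1 lincomb s.
Proof.
elim: L => [|c L [s hs]].
  by exists [::] => w; rewrite /step_sum /lincomb !big_nil.
exists [:: (h c, c.2), (- h c, c.1) & s] => w.
have := hs w; rewrite /step_sum /lincomb !big_cons/= => ->.
by rewrite addrA mulrBr mulNr.
Qed.

Lemma ms_integral_approx f (J : {RV P >-> R}) (e : R) : ms_integral f y J -> 0 < e ->
  exists s, (sqdist P (lincomb s) J <= e%:E)%E.
Proof.
move=> [JJ [hJJ cvJ]] e0; have e4 : 0 < e / 4 by rewrite divr_gt0.
have [A [B [AB hAB]]] : exists A B : R, A < B /\ (sqdist P (JJ A B) J <= (e / 4)%:E)%E.
  move: cvJ => /ge0_cvg0P-/(_ (fun=> sqdist_ge0 _ _ _))/(_ _ e4).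
  move=> [[S1 S2] /= [[a0 [_ ha0]] [b0 [_ hb0]]] hS].
  have h1 : - a0 <= `|a0| by rewrite -normrN ler_norm.
  have h2 : b0 <= `|b0| by rewrite ler_norm.
  have h3 := normr_ge0 a0; have h4 := normr_ge0 b0.
  exists (- (`|a0| + 1)), (`|b0| + 1); split; first lra.
  by apply: (hS (- (`|a0| + 1), `|b0| + 1)); split => /=; [apply: ha0|apply: hb0]; lra.
have [d d0 hd] := hJJ _ _ AB _ e4.
have [s [ps ts]] := exists_fine_partition (ltW AB) d0.
have := hd _ _ ps (tagged_left ps ts) => h.
have [l hl] := step_sum_lincomb (fun c => f c.1) (cells A s).
exists l; have -> : lincomb l = RS_sum f y A B s (fun i => nth B (A :: s) i).
  by apply/funext => w; rewrite RS_sum_left hl.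
have m : measurable_fun setT (RS_sum f y A B s (fun i => nth B (A :: s) i)).
  exact: measurable_RS_sum.
have := sqdist_triangle2_lt m (measurable_funPT (JJ A B)) (measurable_funPT J) (ltW h) hAB.
by move=> /le_trans; apply; rewrite lee_fin; lra.
Qed.

Lemma ms_integralB f g (J K JK : {RV P >-> R}) : JK = (fun w => J w - K w) :> (T -> R) ->
  ms_integral f y J -> ms_integral g y K ->
  ms_integral (fun x => f x - g x) y JK.
Proof.
move=> JKE [JJ [hJ cJ]] [KK [hK cK]].
(* The two terms are replaced one at a time, through [Y1 - X2]. *)
have key (X1 X2 Y1 Y2 : T -> R) (e : R) :
    measurable_fun setT X1 -> measurable_fun setT X2 ->
    measurable_fun setT Y1 -> measurable_fun setT Y2 ->
    (sqdist P X1 Y1 <= e%:E)%E -> (sqdist P X2 Y2 <= e%:E)%E ->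
    (sqdist P (X1 \- X2)%R (Y1 \- Y2)%R <= (4 * e)%:E)%E.
  move=> mX1 mX2 mY1 mY2 h1 h2.
  have := @sqdist_triangle2_lt _ _ _ P e e (fun w => X1 w - X2 w)
    (fun w => Y1 w - X2 w) (fun w => Y1 w - Y2 w).
  have -> : 4 * e = 2 * e + 2 * e by lra.
  apply; try exact: measurable_funB.
    apply: le_trans h1; rewrite !sqdistE le_eqVlt; apply/orP; left; apply/eqP.
    by apply: eq_integral => w _; congr (EFin (_ ^+ 2)); ring.
  apply: le_trans h2; rewrite !sqdistE le_eqVlt; apply/orP; left; apply/eqP.
  by apply: eq_integral => w _; congr EFin; ring.
have /choice[D hD] : forall p : R * R, exists D : {RV P >-> R},
    D = (fun w => JJ p.1 p.2 w - KK p.1 p.2 w) :> (T -> R).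
  by move=> p; apply: exists_RV; exact: measurable_funB.
exists (fun A B => D (A, B)); split.
  move=> A B AB e e0; have e5 : 0 < e / 5 by rewrite divr_gt0.
  have [d1 d10 h1] := hJ A B AB _ e5; have [d2 d20 h2] := hK A B AB _ e5.
  exists (Num.min d1 d2); first by rewrite lt_min d10.
  move=> s xi ps ts.
  have t1 : tagged A B s xi d1.
    by move=> i /ts[h h']; split => //; apply: lt_le_trans h' _; rewrite ge_min lexx.
  have t2 : tagged A B s xi d2.
    by move=> i /ts[h h']; split => //; apply: lt_le_trans h' _; rewrite ge_min lexx orbT.
  have mR h : measurable_fun setT (RS_sum h y A B s xi) by exact: measurable_RS_sum.
  have -> : RS_sum (fun x => f x - g x) y A B s xi =
     (fun w => RS_sum f y A B s xi w - RS_sum g y A B s xi w).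
    by apply/funext => w; rewrite /RS_sum -sumrB; apply: eq_bigr => i _; rewrite mulrBl.
  rewrite hD; apply: (@le_lt_trans _ _ (4 * (e / 5))%:E); last by rewrite lte_fin; lra.
  by apply: key => //; apply: ltW; [exact: h1|exact: h2].
apply/ge0_cvg0P; first by move=> i; exact: sqdist_ge0.
move=> e e0; have e4 : 0 < e / 4 by rewrite divr_gt0.
move: cJ => /ge0_cvg0P-/(_ (fun=> sqdist_ge0 _ _ _))/(_ _ e4) h1.
move: cK => /ge0_cvg0P-/(_ (fun=> sqdist_ge0 _ _ _))/(_ _ e4) h2.
apply: filterS2 h1 h2 => -[A B] h1 h2; rewrite hD JKE.
have -> : e = 4 * (e / 4) by lra.
exact: key.
Qed.

Lemma tau_ms_integral (alpha C : R) f (J : {RV P >-> R}) : 0 < alpha -> 0 <= C ->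
  (forall s, (tau P (powphi alpha) (lincomb s) <= (C * l2norm P (lincomb s))%:E)%E) ->
  (\int[P]_w (J w ^+ 2)%:E < +oo)%E ->
  ms_integral f y J -> (tau P (powphi alpha) J <= (C * l2norm P J)%:E)%E.
Proof.
move=> al0 C0 ht J2 hJ.
have /choice[s hs] : forall n, exists s, (sqdist P (lincomb s) J <= (2^-1 ^+ n)%:E)%E.
  by move=> n; apply: (ms_integral_approx hJ); rewrite exprn_gt0// invr_gt0.
apply: (@tau_limit _ _ _ P alpha C (fun n => lincomb (s n))) => //.
- by move=> n; exact: measurable_lincomb.
- move=> e e0.
  have : (fun n => (2^-1 : R) ^+ n) @ \oo --> 0.
    by apply: cvg_expr; rewrite ger0_norm ?invr_ge0// invf_lt1// ltr1n.
  move=> /cvgr0Pnorm_le /(_ _ e0); apply: filterS => n hn.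
  by apply: le_trans (hs n) _; rewrite lee_fin; apply: le_trans hn; exact: ler_norm.
Qed.

(** A list is padded by zero coefficients to a sequence, whose partial sums are eventually constant.
    [|C|] replaces [C] because the passage to the limit asks for a nonnegative constant; [normC_CZ]
    restores the sign later. *)
Lemma strictly_sub_gaussian_tau_lincomb (alpha C : R) s : 0 < alpha ->
  strictly_sub_gaussian (powphi alpha) (range y) C ->
  (tau P (powphi alpha) (lincomb s) <= (`|C| * l2norm P (lincomb s))%:E)%E.
Proof.
move=> al0 [_ hC].
have [X XE] := exists_RV P (measurable_lincomb s).
have := hC (fun i => y (nth (0, 0) s i).2) (fun i => (nth (0, 0) s i).1) X.
have h : sqdist P (fun w : T => \sum_(i < n) (nth (0, 0) s i).1 * y (nth (0, 0) s i).2 w) X @[n --> \oo] --> 0%E.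
  apply: cvg_near_cst; exists (size s) => // n /= sn.
  rewrite XE -[RHS](sqdistxx P (lincomb s)); congr (sqdist P _ _).
  apply/funext => w; rewrite /lincomb (big_nth (0, 0)) big_mkord.
  rewrite -(subnKC sn) big_split_ord/= [X in _ + X]big1 ?addr0// => i _.
  by rewrite nth_default ?leq_addr//= mul0r.
move=> /(_ _ h); rewrite XE; move=> /(_ _)/le_trans; apply; first by move=> i; exists (nth (0, 0) s i).2.
by rewrite lee_fin ler_wpM2r ?ler_norm// l2normE sqrtr_ge0.
Qed.

End LinComb.

(** * Chaining *)

Section Nets.
Context {R : realType}.

(** The points are midpoints of consecutive intervals of length [2 v], cut off at [b]. Their number
    is at most [(b - a) / (2 v) + 1], and [2 v <= D] absorbs the 1 into [D / v]. *)
Lemma interval_net (a b v D : R) : a <= b -> 0 < v -> b - a <= D -> 2 * v <= D ->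
  exists s : seq R, [/\ s != [::], (size s)%:R <= D / v,
    (forall q, q \in s -> a <= q <= b) &
    forall t, a <= t <= b -> exists2 q, q \in s & `|t - q| <= v].
Proof.
move=> ab v0 baD vD; have v20 : 0 < 2 * v by rewrite mulr_gt0.
pose N := (Num.truncn ((b - a) / (2 * v))).+1.
pose p (i : nat) := Num.min b (a + (2 * i%:R + 1) * v).
exists [seq p i | i <- iota 0 N]; split.
- by [].
- rewrite size_map size_iota /N -natr1.
  have h : (Num.truncn ((b - a) / (2 * v)))%:R <= (b - a) / (2 * v).
    by rewrite truncn_le divr_ge0 ?subr_ge0// ltW.
  apply: (@le_trans _ _ ((b - a) / (2 * v) + 1)); first by rewrite lerD2r.
  rewrite -(ler_pM2r v20) mulrDl mul1r divfK ?gt_eqF//.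
  have -> : D / v * (2 * v) = 2 * D by field; rewrite gt_eqF.
  by lra.
- move=> q /mapP[i _ ->]; rewrite /p ge_min lexx/= le_min ab/= lerDl.
  by rewrite mulr_ge0 ?(ltW v0)// addr_ge0// mulr_ge0.
- move=> t /andP[at_ tb].
  have ta0 : 0 <= (t - a) / (2 * v) by rewrite divr_ge0 ?subr_ge0// ltW.
  have /andP[h1 h2] := truncn_itv ta0.
  set i := Num.truncn ((t - a) / (2 * v)) in h1 h2.
  exists (p i).
    apply/mapP; exists i => //; rewrite mem_iota/= add0n /N ltnS.
    rewrite truncn_ge_nat ?divr_ge0 ?subr_ge0 ?(ltW v20)//; apply: le_trans h1 _.
    by rewrite ler_pM2r ?invr_gt0// lerD2r.
  rewrite ler_pdivlMr// in h1; rewrite ltr_pdivrMr// -natr1 in h2.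
  rewrite /p ler_norml; have [hb|hb] := leP b (a + (2 * i%:R + 1) * v).
    by apply/andP; split; lra.
  by apply/andP; split; lra.
Qed.

Lemma rectangle_net (a b c d v D : R) : a <= b -> c <= d -> 0 < v ->
  b - a <= D -> d - c <= D -> 2 * v <= D ->
  exists s : seq (R * R), [/\ s != [::], (size s)%:R <= (D / v) ^+ 2,
    (forall q, q \in s -> a <= q.1 <= b /\ c <= q.2 <= d) &
    forall p, a <= p.1 <= b -> c <= p.2 <= d ->
      exists2 q, q \in s & `|p.1 - q.1| <= v /\ `|p.2 - q.2| <= v].
Proof.
move=> ab cd v0 bD dD vD.
have [s1 [n1 sz1 in1 cv1]] := interval_net ab v0 bD vD.
have [s2 [n2 sz2 in2 cv2]] := interval_net cd v0 dD vD.
exists [seq (x, z) | x <- s1, z <- s2]; split.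
- by case: s1 n1 {sz1 in1 cv1} => // x s1 _; case: s2 n2 {sz2 in2 cv2}.
- by rewrite size_allpairs natrM expr2 ler_pM.
- by move=> q /allpairsP[[x z] [/= /in1 h1 /in2 h2 ->]].
- move=> [x z] /= /cv1[q1 q1s h1] /cv2[q2 q2s h2].
  by exists (q1, q2) => //; apply/allpairsP; exists (q1, q2).
Qed.

End Nets.

(** * Exponential moments of finite maxima *)

Section MaxAbs.
Context {disp : measure_display} {T : measurableType disp} {R : realType}.
Variable P : probability T R.
Context {I : eqType}.
Variable F : I -> T -> R.
Hypothesis mF : forall i, measurable_fun setT (F i).

Definition maxabs (s : seq I) (w : T) : R := \big[Num.max/0]_(i <- s) `|F i w|.

Lemma maxabs_ge0 s w : 0 <= maxabs s w.
Proof.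
by rewrite /maxabs; elim/big_rec: _ => // i x _ x0; rewrite le_max x0 orbT.
Qed.

Lemma le_maxabs s i w : i \in s -> `|F i w| <= maxabs s w.
Proof.
rewrite /maxabs; elim: s => // j s ih; rewrite inE big_cons => /predU1P[->|/ih h].
  by rewrite le_max lexx.
by rewrite le_max h orbT.
Qed.

Lemma measurable_maxabs s : measurable_fun setT (maxabs s).
Proof.
rewrite /maxabs; elim: s => [|i s ih].
  by under eq_fun do rewrite big_nil; exact: measurable_cst.
under eq_fun do rewrite big_cons.
by apply: measurable_maxr => //; exact: measurableT_comp.
Qed.

(** The exponential of a maximum is at most the sum of the exponentials, and an absolute value is
    attained by one of the two signs. For empty [s] the left side would be 1 and the right side
    0. *)
Lemma expR_maxabs_le (l : R) s w : 0 <= l -> s != [::] ->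
  expR (l * maxabs s w) <= \sum_(i <- s) (expR (F i w * l) + expR (F i w * - l)).
Proof.
move=> l0; rewrite /maxabs.
have E i : expR (l * `|F i w|) <= expR (F i w * l) + expR (F i w * - l).
  have [h|h] := leP 0 (F i w).
    by rewrite ger0_norm// mulrC lerDl expR_ge0.
  by rewrite ltr0_norm// mulrC mulNr -mulrN lerDr expR_ge0.
case: s => // i s _; elim: s i => [|j s ih] i.
  by rewrite !big_cons !big_nil addr0 max_l.
rewrite big_cons [leRHS]big_cons.
set m := \big[_/_]_(_ <- _) _; have := ih j; rewrite -/m => h.
have p0 : 0 <= \sum_(i <- j :: s) (expR (F i w * l) + expR (F i w * - l)).
  by apply: sumr_ge0 => k _; rewrite addr_ge0 ?expR_ge0.
have [hm|hm] := leP `|F i w| m.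
  by apply: le_trans h _; rewrite lerDr addr_ge0 ?expR_ge0.
by apply: le_trans (E i) _; rewrite lerDl.
Qed.

Variables (alpha e : R).
Hypothesis alpha0 : 0 < alpha.

Lemma integral_expR_maxabs (l : R) s : 0 <= l -> s != [::] ->
  (forall i, i \in s -> (tau P (powphi alpha) (F i) <= e%:E)%E) ->
  (\int[P]_w (expR (l * maxabs s w))%:E <=
   ((size s)%:R * (2 * expR (powphi alpha (l * e))))%:E)%E.
Proof.
move=> l0 sn ht.
have mE i k : measurable_fun setT (fun w => (expR (F i w * k))%:E).
  by apply/measurable_EFinP; exact: measurable_expRM.
apply: (@le_trans _ _ (\int[P]_w (\sum_(i <- s) ((expR (F i w * l))%:E + (expR (F i w * - l))%:E)))%E).
  apply: ge0_le_integral => //.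
  - apply/measurable_EFinP; apply: measurableT_comp => //.
    by apply: measurable_funM => //; exact: measurable_maxabs.
  - by apply: emeasurable_sum => i; exact: emeasurable_funD.
  - move=> w _; under [leRHS]eq_bigr do rewrite -EFinD.
    by rewrite sumEFin lee_fin expR_maxabs_le.
rewrite ge0_integral_sum//; last 2 first.
- by move=> i; exact: emeasurable_funD.
- by move=> i w _; rewrite adde_ge0// lee_fin expR_ge0.
apply: (@le_trans _ _ (\sum_(i <- s) (2 * expR (powphi alpha (l * e)))%:E)%E).
  rewrite big_seq [leRHS]big_seq; apply: lee_sum => i /ht hi.
  rewrite ge0_integralD//; [|by move=> w _; rewrite lee_fin expR_ge0..].
  rewrite -!mgfE mulr_natl mulr2n EFinD; apply: leeD; first exact: tau_le_mgf.
  have -> : powphi alpha (l * e) = powphi alpha (- l * e).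
    by rewrite /powphi mulNr normrN.
  exact: tau_le_mgf.
by rewrite sumEFin big_const_seq count_predT iter_addr_0 -[_ *+ size s]mulr_natl.
Qed.

End MaxAbs.

(** * Chaining with geometric weights *)

Section Chaining.
Context {R : realType}.

(** Jensen's inequality with the missing mass [1 - W] placed at 0, obtained by averaging the tangent
    of [expR] at the mean [z]. *)
Lemma expR_wsum_le n (w x : nat -> R) : (forall k, 0 <= w k) ->
  \sum_(k < n) w k <= 1 ->
  expR (\sum_(k < n) w k * x k) <=
  \sum_(k < n) w k * expR (x k) + (1 - \sum_(k < n) w k).
Proof.
move=> w0 w1; set z := \sum_(k < n) _ * _; set W := \sum_(k < n) w k in w1 *.
have tangent t : expR z * (1 + (t - z)) <= expR t.
  have -> : expR t = expR z * expR (t - z) by rewrite -expRD addrC subrK.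
  by rewrite ler_wpM2l ?expR_ge0// expR_ge1Dx.
have h0 := tangent 0; rewrite expR0 in h0.
have h1 : \sum_(k < n) w k * (expR z * (1 + (x k - z))) <= \sum_(k < n) w k * expR (x k).
  by apply: ler_sum => k _; rewrite ler_wpM2l.
have E : \sum_(k < n) w k * (expR z * (1 + (x k - z))) = expR z * (W * (1 - z) + z).
  rewrite /W mulr_suml {3}/z -big_split/= mulr_sumr; apply: eq_bigr => k _; ring.
rewrite E in h1.
have h2 : (1 - W) * (expR z * (1 + (0 - z))) <= 1 - W.
  by rewrite -[leRHS]mulr1 ler_wpM2l// subr_ge0.
have -> : expR z = expR z * (W * (1 - z) + z) + (1 - W) * (expR z * (1 + (0 - z))) by ring.
exact: lerD.
Qed.

Lemma geometric_weights (th : R) n : \sum_(k < n) (1 - th) * th ^+ k = 1 - th ^+ n.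
Proof.
by rewrite -mulr_sumr -[LHS]opprK -mulNr opprB -subrX1 opprB.
Qed.

(** The bound is the mean of the full geometric law; the closed form [E] shows what the truncation
    removes. *)
Lemma geometric_weights_mean (th : R) n : 0 < th < 1 ->
  \sum_(k < n) (1 - th) * th ^+ k * k%:R <= th / (1 - th).
Proof.
move=> /andP[th0 th1]; have d0 : 0 < 1 - th by rewrite subr_gt0.
have E : \sum_(k < n) (1 - th) * th ^+ k * k%:R =
    (th - th ^+ n) / (1 - th) - (n%:R - 1) * th ^+ n.
  elim: n => [|n ih]; first by rewrite big_ord0 expr0; field; rewrite gt_eqF.
  rewrite big_ord_recr/= ih exprS -[n.+1%:R]natr1; field; by rewrite gt_eqF.
rewrite E; case: n {E} => [|n].
  rewrite expr0 mulr1 (_ : _ - _ = 0); last by field; rewrite gt_eqF.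
  by rewrite divr_ge0// ltW.
have p1 : 0 <= th ^+ n.+1 / (1 - th) by rewrite divr_ge0 ?exprn_ge0// ltW.
have p2 : 0 <= (n.+1%:R - 1) * th ^+ n.+1.
  by rewrite mulr_ge0 ?exprn_ge0 ?(ltW th0)// subr_ge0 ler1n.
by rewrite mulrBl; lra.
Qed.

Context {disp : measure_display} {T : measurableType disp}.
Variable P : probability T R.
Context {I : eqType}.
Variables (F : nat -> I -> T -> R) (L : nat -> seq I).
Hypothesis mF : forall k i, measurable_fun setT (F k i).
Variables (alpha gamma eps0 th Q q r : R).
Hypothesis alpha0 : 0 < alpha.
Hypothesis ag : alpha^-1 + gamma^-1 = 1.
Hypothesis gamma0 : 0 < gamma.
Hypothesis eps00 : 0 < eps0.
Hypothesis th01 : 0 < th < 1.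
Hypothesis Ln : forall k, L k != [::].
Hypothesis tauF : forall k i, i \in L k ->
  (tau P (powphi alpha) (F k i) <= (eps0 * th ^+ k)%:E)%E.
Hypothesis Q1 : 1 <= Q.
Hypothesis q0 : 0 <= q.
Hypothesis qr : q * (th / (1 - th)) <= r.
Hypothesis sizeL : forall k, (size (L k))%:R <= Q * expR (q * k%:R).

Definition chain_max n w := \sum_(k < n) maxabs (F k) (L k) w.

Lemma measurable_chain_max n : measurable_fun setT (chain_max n).
Proof. by apply: measurable_sum => k; exact: measurable_maxabs. Qed.

(* Convexity of [exp] with the weights [w k] proportional to [th ^+ k] plays the
   role of Hoelder's inequality. *)
Lemma chain_max_mgf n (l : R) : 0 < l ->
  (\int[P]_w (expR (l * chain_max n w))%:E <=
   (2 * expR (powphi alpha (l * (eps0 / (1 - th)))) * Q * expR r)%:E)%E.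
Proof.
move=> l0; have /andP[th0 th1] := th01; have d0 : 0 < 1 - th by rewrite subr_gt0.
set ph := powphi _ _; have ph0 : 0 <= ph by exact: powphi_ge0.
pose w k := (1 - th) * th ^+ k.
have w0 k : 0 < w k by rewrite mulr_gt0// exprn_gt0.
(* [b k] is the logarithm of the bound for the exponential moment at level [k]. Subtracting it
   normalizes each level to mean at most 1, and the weighted sum of the [b k] becomes the factor
   outside. *)
pose b k := ln 2 + ph + ln Q + q * k%:R.
have Qp : 0 < Q by apply: lt_le_trans Q1.
have bE k : expR (b k) = 2 * expR ph * Q * expR (q * k%:R).
  by rewrite /b !expRD !lnK ?posrE.
have W1 : \sum_(k < n) w k <= 1 by rewrite geometric_weights gerBl exprn_ge0// ltW.
pose b0 := ln 2 + ph + ln Q + r.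
have b0E : expR b0 = 2 * expR ph * Q * expR r by rewrite /b0 !expRD !lnK ?posrE.
have sumb : \sum_(k < n) w k * b k <= b0.
  have -> : \sum_(k < n) w k * b k =
      (\sum_(k < n) w k) * (ln 2 + ph + ln Q) + q * \sum_(k < n) w k * k%:R.
    by rewrite mulr_suml mulr_sumr -big_split/=; apply: eq_bigr => k _; rewrite /b; ring.
  apply: lerD.
    rewrite ler_piMl// !addr_ge0// ln_ge0//; lra.
  by apply: le_trans qr; rewrite ler_wpM2l// geometric_weights_mean.
pose x k t := l / w k * maxabs (F k) (L k) t - b k.
have lE t : l * chain_max n t = \sum_(k < n) w k * x k t + \sum_(k < n) w k * b k.
  rewrite /chain_max mulr_sumr -big_split/=; apply: eq_bigr => k _.
  by rewrite /x; field; rewrite gt_eqF.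
have mx k : measurable_fun setT (fun t => expR (x k t)).
  apply: measurableT_comp => //; apply: measurable_funB => //.
  by apply: measurable_funM => //; exact: measurable_maxabs.
have intx k : (\int[P]_t (expR (x k t))%:E <= 1)%E.
  have -> : (\int[P]_t (expR (x k t))%:E =
      (expR (- b k))%:E * \int[P]_t (expR (l / w k * maxabs (F k) (L k) t))%:E)%E.
    rewrite -ge0_integralZl_EFin ?expR_ge0//.
    - by apply: eq_integral => t _; rewrite -EFinM -expRD addrC.
    - apply/measurable_EFinP; apply: measurableT_comp => //.
      by apply: measurable_funM => //; exact: measurable_maxabs.
  have lw0 : 0 <= l / w k by rewrite divr_ge0// ltW.
  have := integral_expR_maxabs (mF k) alpha0 lw0 (Ln k) (@tauF k).
  (* The rate [l / w k] cancels the decay of the norms: the exponent is the same at every level. *)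
  have -> : l / w k * (eps0 * th ^+ k) = l * (eps0 / (1 - th)).
    by rewrite /w; field; rewrite !gt_eqF// exprn_gt0.
  rewrite -/ph => h.
  apply: (@le_trans _ _ ((expR (- b k))%:E * ((size (L k))%:R * (2 * expR ph))%:E)%E).
    by apply: lee_wpmul2l => //; rewrite lee_fin expR_ge0.
  rewrite -EFinM lee_fin expRN mulrC ler_pdivrMr ?expR_gt0// mul1r bE.
  rewrite (_ : 2 * expR ph * Q * _ = (Q * expR (q * k%:R)) * (2 * expR ph)); last by ring.
  by rewrite ler_wpM2r// mulr_ge0// expR_ge0.
rewrite -b0E.
apply: (@le_trans _ _ (\int[P]_t ((expR b0)%:E *
   (\sum_(k < n) (w k)%:E * (expR (x k t))%:E + (1 - \sum_(k < n) w k)%:E)))%E).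
  apply: ge0_le_integral => //.
  - apply/measurable_EFinP; apply: measurableT_comp => //.
    by apply: measurable_funM => //; exact: measurable_chain_max.
  - apply: measurable_funeM; apply: emeasurable_funD => //.
    by apply: emeasurable_sum => k; apply: measurable_funeM; exact/measurable_EFinP.
  - move=> t _; under eq_bigr do rewrite -EFinM.
    rewrite sumEFin -EFinD -EFinM lee_fin lE expRD mulrC.
    apply: ler_pM; rewrite ?expR_ge0 ?ler_expR//.
    by apply: (@expR_wsum_le n w (x ^~ t)) => // k; exact: ltW.
have s0 t : (0 <= \sum_(k < n) (w k)%:E * (expR (x k t))%:E)%E.
  by apply: sume_ge0 => k _; rewrite -EFinM lee_fin mulr_ge0 ?expR_ge0// ltW.
have c0 : (0 <= (1 - \sum_(k < n) w k)%:E)%E by rewrite lee_fin subr_ge0.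
have ms : measurable_fun setT (fun t => \sum_(k < n) (w k)%:E * (expR (x k t))%:E)%E.
  by apply: emeasurable_sum => k; apply: measurable_funeM; exact/measurable_EFinP.
rewrite ge0_integralZl_EFin ?expR_ge0//; last 2 first.
- by move=> t _; rewrite adde_ge0.
- exact: emeasurable_funD.
rewrite -[leRHS]mule1; apply: lee_wpmul2l; first by rewrite lee_fin expR_ge0.
rewrite ge0_integralD//.
have -> : (\int[P]__ (1 - \sum_(k < n) w k)%:E)%E = (1 - \sum_(k < n) w k)%:E.
  by rewrite (integral_cst P measurableT)/= probability_setT mule1.
rewrite ge0_integral_sum//; last 2 first.
- by move=> k; apply: measurable_funeM; exact/measurable_EFinP.
- by move=> k t _; rewrite -EFinM lee_fin mulr_ge0 ?expR_ge0// ltW.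
apply: (@le_trans _ _ ((\sum_(k < n) w k)%:E + (1 - \sum_(k < n) w k)%:E)%E); last first.
  by rewrite -EFinD addrC subrK.
apply: leeD => //; rewrite -sumEFin; apply: lee_sum => k _.
rewrite ge0_integralZl_EFin//; [|by first [exact/measurable_EFinP|exact: ltW]..].
by rewrite -[leRHS]mule1 lee_wpmul2l// lee_fin ltW.
Qed.

(** The bound on the exponential moment is uniform in [n], hence so is Chernoff's; the events
    increase with [n], and continuity from below gives their union. *)
Lemma chain_max_tail (u : R) : 0 < u ->
  (P (\bigcup_n [set w | u < chain_max n w]%R) <=
   (2 * expR (- ((u * (1 - th) / eps0) `^ gamma / gamma)) * Q * expR r)%:E)%E.
Proof.
move=> u0; have /andP[th0 th1] := th01; have d0 : 0 < 1 - th by rewrite subr_gt0.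
have mE n : measurable [set w | u < chain_max n w]%R.
  rewrite -[X in measurable X]setTI.
  have := measurable_chain_max n => /(_ measurableT `]u, +oo[%classic (measurable_itv _)).
  by congr measurable; congr (_ `&` _); apply/seteqP; split => w /=; rewrite in_itv/= andbT.
have nd : {homo (fun n => [set w | u < chain_max n w]%R) : n m / (n <= m)%N >-> (n <= m)%O}.
  move=> n m nm; apply/subsetPset => w /= h; apply: lt_le_trans h _.
  rewrite /chain_max -(subnKC nm) big_split_ord/= lerDl.
  by apply: sumr_ge0 => k _; exact: maxabs_ge0.
have cv := nondecreasing_cvg_mu (mu := P) mE (bigcupT_measurable _ mE) nd.
rewrite -(cvg_lim _ cv)//; apply: lime_le.
  by apply/cvg_ex; eexists; exact: cv.
apply: nearW => n /=.
pose z := u * (1 - th) / eps0; have z0 : 0 < z by rewrite divr_gt0// mulr_gt0.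
(* [z^(gamma - 1)] is the minimizer of [s^alpha / alpha - s z], since [(alpha - 1) (gamma - 1) = 1];
   the minimum is [- z^gamma / gamma]. *)
pose s := z `^ (gamma - 1); have s0 : 0 < s by rewrite powR_gt0.
pose l := s * (1 - th) / eps0; have l0 : 0 < l by rewrite divr_gt0// mulr_gt0.
have [X XE] := exists_RV P (measurable_chain_max n).
apply: (@le_trans _ _ (P [set w | u <= X w]%R)).
  apply: le_measure; rewrite ?inE//.
    rewrite -[X in measurable X]setTI.
    have := measurable_funPT X => /(_ measurableT `[u, +oo[%classic (measurable_itv _)).
    by congr measurable; congr (_ `&` _); apply/seteqP; split => w /=; rewrite in_itv/= andbT.
  by move=> w /= /ltW; rewrite XE.
apply: le_trans (chernoff X u l0) _.
rewrite mgfE XE; under eq_integral do rewrite mulrC.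
apply: le_trans (lee_wpmul2r _ (chain_max_mgf n l0)) _; first by rewrite lee_fin expR_ge0.
rewrite -EFinM lee_fin -/z.
have -> : l * (eps0 / (1 - th)) = s by rewrite /l; field; rewrite !gt_eqF.
have lu : l * u = z `^ gamma.
  have -> : l * u = z * z `^ (gamma - 1) by rewrite /l /s /z; field; rewrite gt_eqF.
  by rewrite mulr_powRB1// ltW.
have sa : s `^ alpha = z `^ gamma.
  rewrite /s -powRrM; congr (_ `^ _).
  have h1 : alpha * gamma * (alpha^-1 + gamma^-1) = alpha * gamma by rewrite ag mulr1.
  have h2 : alpha * gamma * (alpha^-1 + gamma^-1) = gamma + alpha.
    by field; rewrite !gt_eqF.
  by lra.
rewrite /powphi gtr0_norm// sa lu.
set zg := z `^ gamma.
have -> : - (zg / gamma) = zg / alpha - zg.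
  by rewrite (_ : alpha^-1 = 1 - gamma^-1); [ring|move: ag; lra].
by rewrite expRD le_eqVlt; apply/orP; left; apply/eqP; ring.
Qed.

End Chaining.

(** * Continuous fields with Hoelder increments *)

Section WithinContinuity.
Context {R : realType}.

Lemma within_continuous2P (A : set (R * R)) (f : R * R -> R) :
  {within A, continuous f} <->
  forall p, A p -> forall e : R, 0 < e -> exists2 d : R, 0 < d &
    forall q, A q -> `|p.1 - q.1| <= d -> `|p.2 - q.2| <= d -> `|f p - f q| <= e.
Proof.
split.
  move=> /subspace_continuousP h p Ap e e0.
  have /cvgr_dist_le/(_ _ e0) := h p Ap.
  move=> /nbhs_ballP[d /= d0 hd]; exists (d / 2); first by rewrite divr_gt0.
  move=> q Aq h1 h2; apply: (hd q) => //; split; rewrite -ball_normE /=; lra.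
move=> h; apply/subspace_continuousP => p Ap; apply/cvgrPdist_le => e e0.
have [d d0 hd] := h p Ap e e0; apply/nbhs_ballP; exists d => //= q [b1 b2] Aq.
by apply: hd => //; apply: ltW; move: b1 b2; rewrite -!ball_normE.
Qed.

End WithinContinuity.

(** * Suprema and continuous versions over the rectangle *)

Section Field.
Context {disp : measure_display} {T : measurableType disp} {R : realType}.
Variable P : probability T R.

Lemma ae_all_seq (I : eqType) (s : seq I) (Q : I -> T -> Prop) :
  (forall i, i \in s -> {ae P, forall w, Q i w}) ->
  {ae P, forall w, forall i, i \in s -> Q i w}.
Proof.
elim: s => [|i s ih] h; first by apply: aeW.
have h1 := h i (mem_head _ _).
have h2 : {ae P, forall w, forall i, i \in s -> Q i w}.
  by apply: ih => j js; apply: h; rewrite inE js orbT.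
by apply: filterS2 h1 h2 => w w1 w2 j; rewrite inE => /predU1P[->|/w2].
Qed.

(** The exponential moments at 1 and -1 are at most 1, so the nonnegative variable [(e^(X/2) -
    e^(-X/2))^2 = e^X + e^(-X) - 2] has mean at most 0. *)
Lemma tau_le0_ae (alpha : R) (X : T -> R) : 0 < alpha -> measurable_fun setT X ->
  (tau P (powphi alpha) X <= 0%:E)%E -> {ae P, forall w, X w = 0}.
Proof.
move=> al0 mX h.
have M1 l : (\int[P]_w (expR (X w * l))%:E <= 1%:E)%E.
  by rewrite -mgfE; have := tau_le_mgf l al0 h; rewrite mulr0 /powphi normr0 powR0 ?gt_eqF// mul0r expR0.
pose g w := (expR (X w / 2) - expR (- (X w / 2))) ^+ 2.
have mg : measurable_fun setT g.
  apply: measurable_funX; apply: measurable_funB; apply: measurableT_comp => //.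
    exact: measurable_funM.
  by apply: measurableT_comp => //; exact: measurable_funM.
have gE w : g w + 2 = expR (X w * 1) + expR (X w * - 1).
  have e1 : expR (X w * 1) = expR (X w / 2) ^+ 2.
    by rewrite expr2 -expRD; congr expR; lra.
  have e2 : expR (X w * - 1) = expR (- (X w / 2)) ^+ 2.
    by rewrite expr2 -expRD; congr expR; lra.
  have AB := expRxMexpNx_1 (X w / 2).
  by rewrite /g e1 e2 sqrrB AB; lra.
have mE l : measurable_fun setT (fun w => (expR (X w * l))%:E).
  by apply/measurable_EFinP; exact: measurable_expRM.
have le2 : (\int[P]_w ((g w)%:E + 2%:E) <= 2%:E)%E.
  under eq_integral do rewrite -EFinD gE EFinD.
  rewrite ge0_integralD//; [|by move=> w _; rewrite lee_fin expR_ge0..].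
  have -> : 2%:E = (1%:E + 1%:E)%E :> \bar R by rewrite -EFinD.
  exact: leeD.
have g0 w : (0 <= (g w)%:E)%E by rewrite lee_fin sqr_ge0.
have mg' : measurable_fun setT (fun w => (g w)%:E) by exact/measurable_EFinP.
rewrite ge0_integralD// in le2.
have c2 : (\int[P]__ 2%:E)%E = 2%:E.
  by rewrite (integral_cst P measurableT)/= probability_setT mule1.
rewrite c2 -[leRHS]add0e leeD2rE// in le2.
have : (\int[P]_w `|(g w)%:E| = 0)%E.
  under eq_integral do rewrite gee0_abs//.
  by apply/eqP; rewrite eq_le le2 integral_ge0.
move/(ae_eq_integral_abs _ measurableT mg'); apply: filterS => w /(_ I) /= [] /eqP.
rewrite sqrf_eq0 subr_eq0 => /eqP /expR_inj; lra.
Qed.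

Variable U : R -> R -> {RV P >-> R}.
Variables (a b c d : R).
Hypotheses (ab : a <= b) (cd : c <= d).
Local Notation rect := (`[a, b] `*` `[c, d] : set (R * R)).
Local Notation vk := (Num.max (b - a) (d - c)).

Lemma vk_ge0 : 0 <= vk.
Proof. by rewrite le_max subr_ge0 ab. Qed.

Lemma rectP p : rect p <-> a <= p.1 <= b /\ c <= p.2 <= d.
Proof. by split=> -[]; rewrite /= !in_itv. Qed.

Definition covers (V : seq (R * R)) (v : R) := forall p : R * R, rect p ->
  exists2 q, q \in V & `|p.1 - q.1| <= v /\ `|p.2 - q.2| <= v.

Lemma continuous_net_bound (f : R * R -> R) (V : nat -> seq (R * R)) (v : nat -> R) B :
  {within rect, continuous f} ->
  (forall n q, q \in V n -> rect q) -> (forall n, covers (V n) (v n)) ->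
  v n @[n --> \oo] --> 0 -> (forall n q, q \in V n -> `|f q| <= B) ->
  forall p, rect p -> `|f p| <= B.
Proof.
move=> /within_continuous2P fc Vr Vc v0 fB p rp; apply/ler_addgt0Pr => e e0.
have [dl dl0 hd] := fc p rp e e0.
move: v0 => /cvgr0Pnorm_le/(_ _ dl0)[N _ /(_ N (leqnn N)) vN].
have {}vN : v N <= dl by apply: le_trans vN; exact: ler_norm.
have [q qV [h1 h2]] := Vc N p rp.
have := hd q (Vr _ _ qV) (le_trans h1 vN) (le_trans h2 vN).
have := fB _ _ qV; have := lerB_normD (f p) (- f q); rewrite normrN; lra.
Qed.

Variables (alpha gamma K rho : R).
Hypothesis alpha0 : 0 < alpha.
Hypothesis rho0 : 0 < rho.
Hypothesis hinc : forall t t1 x x1 h : R, a <= t <= b -> a <= t1 <= b ->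
  c <= x <= d -> c <= x1 <= d -> `|t - t1| <= h -> `|x - x1| <= h ->
  (tau P (powphi alpha) (fun w => U t x w - U t1 x1 w)%R <= (K * h `^ rho)%:E)%E.

(** [G] holds outside the null set [N]. The outer measure is monotone and agrees with [P] on the
    measurable union of [E] and [N]. *)
Lemma sup_exceeds_ae (u : R) (E : set T) (G : T -> Prop) : measurable E ->
  {ae P, forall w, G w} ->
  (forall w, G w -> sup_exceeds a b c d U u w -> E w) ->
  (prob_sup_exceeds a b c d U u <= P E)%E.
Proof.
move=> mE [N [mN PN hN]] h.
rewrite -(measureU0 mE mN PN) /prob_sup_exceeds.
rewrite -(measurable_mu_extE P (measurableU _ _ mE mN)).
apply: le_mu_ext => w sw; have [Gw|Gw] := pselect (G w); first by left; exact: h.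
by right; apply: hN.
Qed.

Lemma sup_exceedsP (u : R) w : sup_exceeds a b c d U u w ->
  exists2 p, rect p & u < `|U p.1 p.2 w|.
Proof.
by move=> /ereal_sup_gt[_ [p rp <-]]; rewrite lte_fin => h; exists p.
Qed.

Section Tail.
Variables (eps0 th u : R).
Hypothesis ag : alpha^-1 + gamma^-1 = 1.
Hypothesis gamma0 : 0 < gamma.
Hypothesis th01 : 0 < th < 1.
Hypothesis Ucont : as_continuous a b c d U.
Hypothesis tauU : forall t x, a <= t <= b -> c <= x <= d ->
  (tau P (powphi alpha) (U t x) <= eps0%:E)%E.
Hypothesis small : th * eps0 < K * (vk / 2) `^ rho.
Hypothesis u0 : 0 < u.

Lemma sup_tail : 0 < eps0 ->
  (prob_sup_exceeds a b c d U u <=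
   (2 * expR (- ((u * (1 - th) / eps0) `^ gamma / gamma))
     * (vk ^+ 2 * K `^ (2 / rho) * (th * eps0) `^ (- (2 / rho)))
     * expR (2 / rho))%:E)%E.
Proof.
move=> eps00; have /andP[th0 th1] := th01.
have te0 : 0 < th * eps0 by rewrite mulr_gt0.
have K0 : 0 < K.
  rewrite ltNge; apply/negP => K0; have := lt_trans te0 small.
  by rewrite ltNge mulr_le0_ge0// powR_ge0.
have vk0 : 0 < vk.
  rewrite lt_neqAle vk_ge0 andbT; apply/eqP => h; have := lt_trans te0 small.
  by rewrite -h mul0r powR0 ?gt_eqF// mulr0 ltxx.
(* The radius solving [K v^rho = eps0 th^(k+1)]: a link from the net of level [k+1] to the net of
   radius [v k] has at most this norm, while level 0 has the norm [eps0]. *)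
pose v k := (th * eps0 * th ^+ k / K) `^ rho^-1.
have tk k : 0 < th ^+ k by rewrite exprn_gt0.
have v0 k : 0 < v k by rewrite powR_gt0// divr_gt0// mulr_gt0.
have Kv k : K * v k `^ rho = eps0 * th ^+ k.+1.
  rewrite /v -powRrM mulVf ?gt_eqF// powRr1; last by rewrite divr_ge0 ?mulr_ge0 ?ltW.
  by rewrite exprS; field; rewrite gt_eqF.
(* The smallness condition says that [v 0], the largest radius, is below [vk / 2]; this is what the
   count of net points requires. *)
have vvk k : 2 * v k <= vk.
  suff : v k <= vk / 2 by lra.
  have : K * v k `^ rho <= K * (vk / 2) `^ rho.
    rewrite Kv; apply: le_trans (ltW small); rewrite exprS mulrA [th * _]mulrC.
    by rewrite ler_piMr ?exprn_ile1 ?mulr_ge0 ?(ltW th0) ?(ltW eps00)// ltW.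
  rewrite ler_pM2l// => h; rewrite leNgt; apply/negP => h2.
  have := gt0_ltr_powR rho0 _ _ h2; rewrite !nnegrE (ltW (v0 k)) divr_ge0 ?(ltW vk0)//.
  by move=> /(_ isT isT); rewrite ltNge h.
have /choice[V hV] : forall k, exists s : seq (R * R),
    [/\ s != [::], (size s)%:R <= (vk / v k) ^+ 2,
      (forall q, q \in s -> a <= q.1 <= b /\ c <= q.2 <= d) & covers s (v k)].
  move=> k; have [||s [s1 s2 s3 s4]] := rectangle_net ab cd (v0 k) _ _ (vvk k).
  - by rewrite le_max lexx.
  - by rewrite le_max lexx orbT.
  by exists s; split => // p /rectP[]; exact: s4.
have /choice[al hal] : forall kp : nat * (R * R), exists q, rect kp.2 ->
    [/\ q \in V kp.1, `|kp.2.1 - q.1| <= v kp.1 & `|kp.2.2 - q.2| <= v kp.1].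
  move=> [k p] /=; have [rp|rp] := pselect (rect p); last by exists p.
  by have [_ _ _ /(_ p rp)[q qV [h1 h2]]] := hV k; exists q.
pose F (k : nat) (p : R * R) : T -> R := if k is k'.+1 then
    fun w => U p.1 p.2 w - U (al (k', p)).1 (al (k', p)).2 w
  else U p.1 p.2.
have mF k p : measurable_fun setT (F k p).
  by case: k => [|k] //=; exact: measurable_funB.
have Vr k q : q \in V k -> rect q.
  by move=> qV; apply/rectP; have [_ _ + _] := hV k; apply.
have tauF k p : p \in V k -> (tau P (powphi alpha) (F k p) <= (eps0 * th ^+ k)%:E)%E.
  move=> pV; have rp := Vr _ _ pV; have [p1 p2] := (iffLR (rectP p)) rp.
  case: k pV => [|k] pV /=; first by rewrite expr0 mulr1; exact: tauU.
  have [qV h1 h2] := hal (k, p) rp; have [q1 q2] := (iffLR (rectP _)) (Vr _ _ qV).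
  by rewrite -Kv; exact: hinc.
(* [Q] is [(vk / v 0)^2], and [q] is the increase of the logarithm of [(vk / v k)^2] per level. *)
pose Q := vk ^+ 2 * K `^ (2 / rho) * (th * eps0) `^ (- (2 / rho)).
pose q := 2 / rho * - ln th.
have lnth : ln th <= 0 by rewrite ln_le0// ltW.
have q0 : 0 <= q by rewrite mulr_ge0 ?oppr_ge0// divr_ge0// ltW.
have vE k : (vk / v k) ^+ 2 = Q * expR (q * k%:R).
  have p1 : 0 < th * eps0 * th ^+ k by rewrite mulr_gt0.
  have -> : (vk / v k) ^+ 2 = vk ^+ 2 * (v k `^ (- 2)).
    by rewrite powR_invn ?(ltW (v0 k))// expr_div_n.
  have rE : rho^-1 * - 2 = - (2 / rho) by ring.
  have KE : K^-1 `^ (- (2 / rho)) = K `^ (2 / rho).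
    by rewrite -[K^-1]powR_inv1 ?(ltW K0)// -powRrM; congr (_ `^ _); ring.
  have thE : (th ^+ k) `^ (- (2 / rho)) = expR (q * k%:R).
    by rewrite /powR gt_eqF// lnXn// /q -mulr_natr; congr expR; ring.
  rewrite /v -powRrM rE powRM ?invr_ge0 ?(ltW K0) ?(ltW p1)//.
  rewrite powRM ?(ltW te0) ?(ltW (tk k))// KE thE /Q; ring.
have Q1 : 1 <= Q.
  have := vE 0%N; rewrite mulr0 expR0 mulr1 => <-; rewrite exprn_ege1//.
  by rewrite ler_pdivlMr// mul1r; have := vvk 0%N; have := v0 0%N; lra.
(* The source of [e^(2/rho)]: [ln (1/th) <= 1/th - 1] gives [q th / (1 - th) <= 2 / rho]. *)
have qr : q * (th / (1 - th)) <= 2 / rho.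
  have r0 : 0 < 2 / rho by rewrite divr_gt0.
  rewrite /q -mulrA -[leRHS]mulr1 ler_wpM2l ?(ltW r0)//.
  have d0 : 0 < 1 - th by rewrite subr_gt0.
  rewrite mulrA ler_pdivrMr// mul1r -lnV ?posrE//.
  have h : ln th^-1 <= th^-1 - 1.
    have := @le_ln1Dx _ (th^-1 - 1); rewrite [1 + _]addrC subrK; apply.
    by rewrite ltrBrDl subrr invr_gt0.
  apply: le_trans (ler_wpM2r (ltW th0) h) _.
  by rewrite mulrBl mulVf ?gt_eqF// mul1r.
have sizeV k : (size (V k))%:R <= Q * expR (q * k%:R) by rewrite -vE; have [] := hV k.
have Vn k : V k != [::] by have [] := hV k.
have := chain_max_tail mF alpha0 ag gamma0 eps00 th01 Vn tauF Q1 q0 qr sizeV u0.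
apply: le_trans; apply: sup_exceeds_ae Ucont _.
  apply: bigcupT_measurable => n; rewrite -[X in measurable X]setTI.
  have := measurable_chain_max V mF n => /(_ measurableT `]u, +oo[%classic (measurable_itv _)).
  by congr measurable; congr (_ `&` _); apply/seteqP; split => w /=; rewrite in_itv/= andbT.
move=> w cw /sup_exceedsP[p rp up]; apply: contrapT => nE.
(* A point of the net of level [n] is followed down to level 0 through the projections [al]; each
   link is one of the variables maximized at its level. *)
have chain n p' : p' \in V n -> `|U p'.1 p'.2 w| <= chain_max F V n.+1 w.
  elim: n p' => [|n ih] p' pV.
    by rewrite /chain_max big_ord_recr big_ord0/= add0r; exact: (le_maxabs (F 0) w pV).
  rewrite /chain_max big_ord_recr/=.
  have [qV _ _] := hal (n, p') (Vr _ _ pV).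
  have h1 := ih _ qV; have h2 := le_maxabs (F n.+1) w pV.
  rewrite /= in h2; apply: le_trans (lerD h1 h2).
  have := lerB_normD (U p'.1 p'.2 w) (- U (al (n, p')).1 (al (n, p')).2 w).
  by rewrite normrN; lra.
have vcv : v n @[n --> \oo] --> 0.
  have -> : v = (fun n => ((th * eps0 / K) `^ rho^-1) * (th `^ rho^-1) ^+ n).
    apply/funext => n; rewrite /v mulrAC (@powRM _ (th * eps0 / K) (th ^+ n)) ?divr_ge0 ?(ltW te0) ?(ltW K0) ?(ltW (tk n))//.
    congr (_ * _); by rewrite -powR_mulrn ?(ltW th0)// powRAC powR_mulrn ?powR_ge0.
  rewrite -[X in _ --> X](mulr0 ((th * eps0 / K) `^ rho^-1)).
  apply: cvgM; first exact: cvg_cst.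
  apply: cvg_expr; rewrite ger0_norm ?powR_ge0//.
  by rewrite /powR gt_eqF// expR_lt1 pmulr_rlt0 ?invr_gt0// ln_lt0// th0.
have := @continuous_net_bound (fun p => U p.1 p.2 w) V v u cw Vr
  (fun n => let: And4 _ _ _ h := hV n in h) vcv _ p rp.
rewrite leNgt up => /(_ _)/notF; apply => n q' q'V; rewrite leNgt; apply/negP => h.
apply: nE; exists n.+1 => //=; apply: lt_le_trans h _; exact: chain.
Qed.

(** The field vanishes almost surely at all of the countably many net points, and a continuous path
    vanishing there vanishes on the rectangle. *)
Lemma sup_tail0 : eps0 <= 0 -> (prob_sup_exceeds a b c d U u <= 0)%E.
Proof.
move=> e0; pose v n : R := 2^-1 ^+ n.
have v0 n : 0 < v n by rewrite exprn_gt0// invr_gt0.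
have v1 n : v n <= 1 by rewrite exprn_ile1// ?invr_ge0// invf_le1// ler1n.
have /choice[V hV] : forall k, exists s : seq (R * R),
    (forall q, q \in s -> rect q) /\ covers s (v k).
  move=> k; have [|||s [_ _ s3 s4]] := @rectangle_net _ a b c d (v k) (vk + 2) ab cd (v0 k).
  - by apply: ler_wpDr; rewrite // le_max lexx.
  - by apply: ler_wpDr; rewrite // le_max lexx orbT.
  - by have := v1 k; have := vk_ge0; lra.
  exists s; split; first by move=> q /s3 ?; exact/rectP.
  by move=> p /rectP[]; exact: s4.
have ae0 : {ae P, forall w, forall n q, q \in V n -> U q.1 q.2 w = 0}.
  apply/ae_foralln => n; apply: ae_all_seq => q qV.
  have [h1 h2] := (iffLR (rectP q)) ((hV n).1 q qV).
  by apply: (tau_le0_ae alpha0) => //; apply: le_trans (tauU h1 h2) _; rewrite lee_fin.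
rewrite -(measure0 P).
apply: (@sup_exceeds_ae u set0 (fun w => {within rect, continuous (fun p => U p.1 p.2 w)} /\
  forall n q, q \in V n -> U q.1 q.2 w = 0)) => //.
  by apply: filterS2 Ucont ae0.
move=> w [cw w0] /sup_exceedsP[p rp up].
have vcv : v n @[n --> \oo] --> 0.
  by apply: cvg_expr; rewrite ger0_norm ?invr_ge0// invf_lt1// ltr1n.
have := @continuous_net_bound (fun p => U p.1 p.2 w) V v 0 cw
  (fun n => (hV n).1) (fun n => (hV n).2) vcv _ p rp.
by rewrite leNgt (lt_trans u0 up) => /(_ _)/notF; apply => n q /w0 ->; rewrite normr0.
Qed.

End Tail.

(** [x <= l + e^(x - l)] is integrated with [x = maxabs / e]: the mean of a maximum grows only
    linearly in the bound [l] for the logarithm of the cardinality. *)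
Lemma integral_maxabs_le (I : eqType) (F : I -> T -> R) (s : seq I) (e l : R) :
  (forall i, measurable_fun setT (F i)) -> 0 < e -> 0 <= l -> s != [::] ->
  (forall i, i \in s -> (tau P (powphi alpha) (F i) <= e%:E)%E) ->
  (size s)%:R <= expR l ->
  (\int[P]_w (maxabs F s w)%:E <= (e * (l + 2 * expR (powphi alpha 1)))%:E)%E.
Proof.
move=> mF e0 l0 sn ht sl.
have mM := measurable_maxabs mF s.
have mE : measurable_fun setT (fun w => (expR (e^-1 * maxabs F s w))%:E).
  by apply/measurable_EFinP; apply: measurableT_comp => //; exact: measurable_funM.
have el0 : 0 <= e * expR (- l) by rewrite mulr_ge0 ?expR_ge0// ltW.
apply: (@le_trans _ _ (\int[P]_w ((e * l)%:E +
   (e * expR (- l))%:E * (expR (e^-1 * maxabs F s w))%:E))%E).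
  apply: ge0_le_integral => //.
  - by move=> w _; rewrite lee_fin maxabs_ge0.
  - exact/measurable_EFinP.
  - by apply: emeasurable_funD => //; exact: measurable_funeM.
  - move=> w _; rewrite -EFinM -EFinD lee_fin -mulrA -mulrDr -expRD.
    rewrite -ler_pdivrMl//; set x := e^-1 * _.
    by have := expR_ge1Dx (- l + x); lra.
rewrite ge0_integralD//; last 3 first.
- by move=> w _; rewrite lee_fin mulr_ge0// ltW.
- by move=> w _; rewrite -EFinM lee_fin mulr_ge0 ?expR_ge0.
- exact: measurable_funeM.
rewrite (integral_cst P measurableT)/= probability_setT mule1.
rewrite ge0_integralZl_EFin//.
have ei0 : 0 <= e^-1 by rewrite invr_ge0 ltW.
have := integral_expR_maxabs mF alpha0 ei0 sn ht; rewrite mulVf ?gt_eqF// => h.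
rewrite mulrDr EFinD leeD2l//; apply: le_trans (lee_wpmul2l _ h) _; first by rewrite lee_fin.
rewrite -EFinM lee_fin.
apply: (@le_trans _ _ (e * expR (- l) * (expR l * (2 * expR (powphi alpha 1))))).
  by rewrite ler_wpM2l// ler_wpM2r// mulr_ge0// expR_ge0.
rewrite le_eqVlt; apply/orP; left; apply/eqP.
by have := expRxMexpNx_1 l; move: (expR l) (expR (- l)) => x z xz; rewrite -mulrA [z * _]mulrA [z * x]mulrC xz mul1r.
Qed.

(* Kolmogorov-type continuity: along nets [V k] whose radius makes the
   increments of norm [4^-k], the expected maximal increments are summable. *)
Lemma exists_continuous_modification : 0 < K ->
  (forall t t1 x x1 h : R, a <= t <= b -> a <= t1 <= b ->
    c <= x <= d -> c <= x1 <= d -> `|t - t1| <= h -> `|x - x1| <= h ->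
    (sqdist P (U t x) (U t1 x1) <= ((K * h `^ rho) ^+ 2)%:E)%E) ->
  exists U' : R -> R -> {RV P >-> R}, as_continuous a b c d U' /\
    forall t x, a <= t <= b -> c <= x <= d -> {ae P, forall w, U t x w = U' t x w}.
Proof.
move=> K0 hsq.
(* The division by 3 is due to the distance of the compared points: projections onto one net of two
   points within [v k] of each other are within [3 v k]. Projections of one point onto consecutive
   nets are closer. *)
pose v k : R := (4^-1 ^+ k / K) `^ rho^-1 / 3.
have q0 k : 0 < (4^-1 : R) ^+ k by rewrite exprn_gt0// invr_gt0.
have v0 k : 0 < v k by rewrite divr_gt0// powR_gt0// divr_gt0.
have Kv k : K * (3 * v k) `^ rho = 4^-1 ^+ k.
  have -> : 3 * v k = (4^-1 ^+ k / K) `^ rho^-1 by rewrite /v; field.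
  rewrite -powRrM mulVf ?gt_eqF// powRr1 ?divr_ge0 ?(ltW K0) ?(ltW (q0 k))//.
  by rewrite mulrC divfK ?gt_eqF.
have vE k : v k = v 0%N * expR (- (k%:R * (ln 4 / rho))).
  have qE : (4^-1 ^+ k) `^ rho^-1 = expR (- (k%:R * (ln 4 / rho))) :> R.
    rewrite /powR gt_eqF// lnXn ?invr_gt0// lnV ?posrE//.
    by congr expR; rewrite -mulr_natr; ring.
  rewrite /v expr0 powRM ?invr_ge0 ?(ltW K0) ?(ltW (q0 k))// qE mul1r; ring.
have ln4 : 0 <= ln (4 : R) by rewrite ln_ge0// ler1n.
have vS k : v k.+1 <= v k.
  rewrite vE [leRHS]vE ler_wpM2l ?(ltW (v0 0%N))// ler_expR lerN2 ler_wpM2r ?ler_nat//.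
  by rewrite divr_ge0// ltW.
have vle0 k : v k <= v 0%N by elim: k => // k ih; exact: le_trans (vS k) ih.
(* [vk] may be 0; the summand [2 * v 0] makes [D] positive and at least [2 * v k] at all levels. *)
pose D := vk + 2 * v 0%N.
have D0 : 0 < D by have := vk_ge0; have := v0 0%N; rewrite /D; lra.
have /choice[V hV] : forall k, exists s : seq (R * R),
    [/\ s != [::], (size s)%:R <= (D / v k) ^+ 2,
      (forall q, q \in s -> rect q) & covers s (v k)].
  have v20 : 0 <= 2 * v 0%N by rewrite mulr_ge0// ltW.
  move=> k; have [|||s [s1 s2 s3 s4]] := @rectangle_net _ a b c d (v k) D ab cd (v0 k).
  - by apply: ler_wpDr; rewrite // le_max lexx.
  - by apply: ler_wpDr; rewrite // le_max lexx orbT.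
  - by have := vle0 k; have := vk_ge0; rewrite /D; lra.
  exists s; split; [exact: s1|exact: s2|by move=> q /s3 h; apply/rectP|].
  by move=> p /rectP[]; exact: s4.
have Vr k q : q \in V k -> rect q by move=> qV; have [_ _ + _] := hV k; apply.
have /choice[al hal] : forall kp : nat * (R * R), exists q, rect kp.2 ->
    [/\ q \in V kp.1, `|kp.2.1 - q.1| <= v kp.1 & `|kp.2.2 - q.2| <= v kp.1].
  move=> [k p] /=; have [rp|rp] := pselect (rect p); last by exists p.
  by have [_ _ _ /(_ p rp)[q qV [h1 h2]]] := hV k; exists q.
pose close k (pq : (R * R) * (R * R)) :=
  (`|pq.1.1 - pq.2.1| <= 3 * v k) && (`|pq.1.2 - pq.2.2| <= 3 * v k).
(* Two consecutive nets are joined, so that one maximum controls the links within a level and those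
   to the next. *)
pose W k := V k ++ V k.+1.
pose L k := [seq pq <- [seq (p, q) | p <- W k, q <- W k] | close k pq].
pose F (pq : (R * R) * (R * R)) : T -> R :=
  fun w => U pq.1.1 pq.1.2 w - U pq.2.1 pq.2.2 w.
have mF pq : measurable_fun setT (F pq) by exact: measurable_funB.
have Wr k q : q \in W k -> rect q by rewrite mem_cat => /orP[] /Vr.
have mem_L k p q : p \in W k -> q \in W k -> `|p.1 - q.1| <= 3 * v k ->
    `|p.2 - q.2| <= 3 * v k -> (p, q) \in L k.
  move=> pW qW h1 h2; rewrite mem_filter /close/= h1 h2/=.
  by apply/allpairsP; exists (p, q).
have tauF k pq : pq \in L k -> (tau P (powphi alpha) (F pq) <= (4^-1 ^+ k)%:E)%E.
  rewrite mem_filter => /andP[/andP[h1 h2] /allpairsP[[p q] [/= /Wr rp /Wr rq E]]].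
  rewrite E/= in h1 h2 *; have [p1 p2] := (iffLR (rectP _)) rp.
  by have [q1 q2] := (iffLR (rectP _)) rq; rewrite -Kv; exact: hinc.
have Ln k : L k != [::].
  have [+ _ _ _] := hV k; case E : (V k) => [//|p s] _.
  have pW : p \in W k by rewrite mem_cat E mem_head.
  have : (p, p) \in L k.
    by apply: mem_L => //; rewrite subrr normr0 mulr_ge0// ltW.
  by case: (L k).
pose c1 := ln (D / v 0%N); pose c2 := ln 4 / rho.
have Dv k : D / v k = expR (c1 + k%:R * c2).
  have -> : D / v k = D / v 0%N * expR (k%:R * c2).
    by rewrite vE expRN -/c2; field; rewrite !gt_eqF// expR_gt0.
  by rewrite expRD lnK// posrE divr_gt0.
have c10 : 0 <= c1.
  rewrite ln_ge0// ler_pdivlMr// mul1r /D; have := vk_ge0; have := v0 0%N; lra.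
have c20 : 0 <= c2 by rewrite divr_ge0// ltW.
pose l k := 2 * (ln 2 + 2 * (c1 + k.+1%:R * c2)).
have l0 k : 0 <= l k.
  by rewrite /l mulr_ge0// addr_ge0 ?ln_ge0 ?ler1n// mulr_ge0// addr_ge0// mulr_ge0.
have sizeL k : (size (L k))%:R <= expR (l k).
  have h j : (j <= k.+1)%N -> (size (V j))%:R <= expR (2 * (c1 + k.+1%:R * c2)).
    move=> jk; have [_ h _ _] := hV j; apply: le_trans h _.
    rewrite Dv -expRM_natl ler_expR ler_wpM2l// lerD2l ler_wpM2r// ler_nat//.
  have hW : (size (W k))%:R <= expR (ln 2 + 2 * (c1 + k.+1%:R * c2)).
    rewrite expRD lnK ?posrE// size_cat natrD.
    by have := h k (leqnSn k); have := h k.+1 (leqnn _); lra.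
  rewrite /l expRM_natl expr2.
  apply: (@le_trans _ _ ((size (W k))%:R * (size (W k))%:R)); last by rewrite ler_pM.
  by rewrite -natrM -(size_allpairs pair) ler_nat size_filter count_size.
pose Dk k := maxabs F (L k).
have D0' k w : 0 <= Dk k w by exact: maxabs_ge0.
have mD k : measurable_fun setT (Dk k) by exact: measurable_maxabs.
(* [l k] grows linearly in [k]; one factor [2^-k] of [4^-k] absorbs it through [k <= 2^k]. *)
pose c3 := 2 * (ln 2 + 2 * (c1 + c2)) + 4 * c2 + 2 * expR (powphi alpha 1).
have Dint k : (\int[P]_w (Dk k w)%:E <= (c3 * 2^-1 ^+ k)%:E)%E.
  apply: le_trans (integral_maxabs_le mF (q0 k) (l0 k) (Ln k) (@tauF k) (sizeL k)) _.
  rewrite lee_fin.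
  have -> : (4^-1 : R) ^+ k = 2^-1 ^+ k * 2^-1 ^+ k by rewrite -exprMn; congr (_ ^+ _); lra.
  rewrite -mulrA [leRHS]mulrC ler_wpM2l ?exprn_ge0 ?invr_ge0//.
  rewrite exprVn mulrC ler_pdivrMr ?exprn_gt0//.
  have k2 : (k%:R : R) <= 2 ^+ k by rewrite -natrX ler_nat ltnW// ltn_expl.
  have p1 : (1 : R) <= 2 ^+ k by rewrite exprn_ege1// ler1n.
  have z0 : 0 <= 2 * (ln 2 + 2 * (c1 + c2)) + 2 * expR (powphi alpha 1).
    rewrite addr_ge0// mulr_ge0 ?expR_ge0// addr_ge0 ?ln_ge0 ?ler1n// mulr_ge0// addr_ge0//.
  rewrite /l /c3 -[k.+1%:R]natr1.
  have h1 := ler_wpM2l z0 p1; have h2 := ler_wpM2l c20 k2.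
  move: h1 h2; move: (2 ^+ k) (expR (powphi alpha 1)) (ln 2) => A B C; lra.
have q01 : 0 <= (2^-1 : R) < 1 by rewrite invr_ge0 ler0n invf_lt1// ltr1n.
have good := ae_summable_geometric mD D0' q01 Dint.
have /choice[U' hU'] : forall p : R * R, exists Z : {RV P >-> R},
    Z = limit_fun (fun k => U (al (k, p)).1 (al (k, p)).2) :> (T -> R).
  by move=> p; apply: exists_RV; apply: measurable_limit_fun => k.
pose X k p w := U (al (k, p)).1 (al (k, p)).2 w.
have stepX k p w : rect p -> `|X k.+1 p w - X k p w| <= Dk k w.
  move=> rp; have [q1 h1 h2] := hal (k, p) rp; have [q1' h1' h2'] := hal (k.+1, p) rp.
  apply: (le_maxabs F w (i := (al (k.+1, p), al (k, p)))).
  rewrite /= in h1 h2 h1' h2' q1 q1'; have vs := vS k; have v0k := v0 k.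
  by apply: mem_L; rewrite ?mem_cat ?q1 ?q1' ?orbT//; move: h1 h2 h1' h2';
    rewrite !ler_norml => /andP[? ?] /andP[? ?] /andP[? ?] /andP[? ?]; apply/andP; split; lra.
have cvX w p : cvgn (series (fun n => Dk n w)) -> rect p ->
    X k p w @[k --> \oo] --> U' p w /\
    forall n, `|U' p w - X n p w| <= limn (series (fun n => Dk n w)) - series (fun n => Dk n w) n.
  move=> hs rp.
  have cv : X k p w @[k --> \oo] --> U' p w.
    have hc : cvgn (series (fun n => X n.+1 p w - X n p w)).
      apply: normed_cvg.
      apply: (@series_le_cvg _ (fun n => `|X n.+1 p w - X n p w|) (fun n => Dk n w)) => //.
      by move=> k; exact: stepX.
    have : cvgn (fun n => X n p w).
      have -> : (fun n => X n p w) =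
          (fun n => X 0%N p w + series (fun n => X n.+1 p w - X n p w) n).
        by apply/funext => n; rewrite /series /= telescope_sumr// addrC subrK.
      by apply: is_cvgD => //; exact: is_cvg_cst.
    move=> /cvg_ex[z hz]; rewrite hU' (limit_funE hz); exact: hz.
  split=> // n.
  have step m : (n <= m)%N -> `|X m p w - X n p w| <= series (fun n => Dk n w) m - series (fun n => Dk n w) n.
    move=> nm; rewrite -(subnKC nm); elim: (m - n)%N => [|j ih].
      by rewrite addn0 !subrr normr0.
    rewrite addnS seriesSr; have := stepX (n + j)%N p w rp => h.
    have := ler_normD (X (n + j).+1 p w - X (n + j)%N p w) (X (n + j)%N p w - X n p w).
    by rewrite subrKA; lra.
  have cn : `|X m p w - X n p w| @[m --> \oo] --> `|U' p w - X n p w|.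
    by apply: cvg_norm; apply: cvgB => //; exact: cvg_cst.
  rewrite -(cvg_lim _ cn)//; apply: limr_le; first by apply/cvg_ex; eexists; exact: cn.
  exists n => // m /= nm; apply: le_trans (step m nm) _; rewrite lerD2r.
  apply: nondecreasing_cvgn_le => //; apply/nondecreasing_seqP => j.
  by rewrite seriesSr lerDl.
exists (fun t x => U' (t, x)); split.
  apply: filterS good => w hs; apply/within_continuous2P => p rp e e0.
  have : series (fun n => Dk n w) @ \oo --> limn (series (fun n => Dk n w)) by exact: hs.
  move=> /cvgr_dist_le/(_ (e / 3)) []; first by rewrite divr_gt0.
  move=> N _ /(_ N (leqnn N)) hN; exists (v N) => // q rq h1 h2.
  have [_ /(_ N) b1] := cvX w p hs rp; have [_ /(_ N) b2] := cvX w q hs rq.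
  have [p1 p2 p3] := hal (N, p) rp; have [r1 r2 r3] := hal (N, q) rq.
  have b3 : `|X N p w - X N q w| <= Dk N w.
    apply: (le_maxabs F w (i := (al (N, p), al (N, q)))).
    rewrite /= in p1 p2 p3 r1 r2 r3.
    have v0N := v0 N.
    by apply: mem_L; rewrite ?mem_cat ?p1 ?r1//; move: h1 h2 p2 p3 r2 r3;
      rewrite !ler_norml => /andP[? ?] /andP[? ?] /andP[? ?] /andP[? ?] /andP[? ?] /andP[? ?];
      apply/andP; split; lra.
  have b4 : Dk N w <= limn (series (fun n => Dk n w)) - series (fun n => Dk n w) N.
    rewrite lerBrDl -(seriesSr (fun n => Dk n w)).
    apply: nondecreasing_cvgn_le => //; apply/nondecreasing_seqP => j.
    by rewrite seriesSr lerDl.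
  have b5 := le_trans (ler_norm _) hN.
  rewrite -!surjective_pairing.
  have -> : U' p w - U' q w = (U' p w - X N p w) + (X N p w - X N q w) - (U' q w - X N q w) by ring.
  have := ler_normB ((U' p w - X N p w) + (X N p w - X N q w)) (U' q w - X N q w).
  have := ler_normD (U' p w - X N p w) (X N p w - X N q w); lra.
move=> t x ht hx; set p := (t, x).
have rp : rect p by apply/rectP.
apply: ae_eq_sqdist0 => //; apply/eqP; rewrite eq_le sqdist_ge0 andbT.
apply/lee_addgt0Pr => e e0; rewrite add0e sqdistE.
(* Fatou's lemma identifies the pathwise limit [U' p] with [U t x], to which [X k p] converges in
   mean square. *)
apply: (@le_integral_limit _ _ _ P (fun k w => (U t x w - X k p w) ^+ 2)) => //.
- by move=> k; apply: measurable_funX; exact: measurable_funB.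
- by apply: measurable_funX; exact: measurable_funB.
- by move=> k w; exact: sqr_ge0.
- by move=> w; exact: sqr_ge0.
- apply: filterS good => w hs; have [cv _] := cvX w p hs rp.
  have hc : (fun k => U t x w - X k p w) @ \oo --> U t x w - U' p w.
    by apply: cvgB => //; exact: cvg_cst.
  exact: (cvgM hc hc).
- have cq : (fun n => (4^-1 : R) ^+ n) @ \oo --> 0.
    by apply: cvg_expr; rewrite ger0_norm ?invr_ge0// invf_lt1// ltr1n.
  have h1 : forall n, (4^-1 : R) ^+ n <= 1.
    by move=> n; rewrite exprn_ile1// ?invr_ge0// invf_le1// ler1n.
  move: cq => /cvgr0Pnorm_le/(_ _ e0); apply: filterS => n hn.
  rewrite -sqdistE; have [qV h2 h3] := hal (n, p) rp.
  have [q1 q2] := (iffLR (rectP _)) (Vr _ _ qV).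
  have v3 : v n <= 3 * v n by have := v0 n; lra.
  apply: le_trans (hsq _ _ _ _ (3 * v n) ht q1 hx q2 (le_trans h2 v3) (le_trans h3 v3)) _.
  rewrite Kv lee_fin expr2; apply: (@le_trans _ _ (4^-1 ^+ n)).
    by rewrite ler_piMr// ltW.
  by apply: le_trans hn; exact: ler_norm.
Qed.

End Field.

(** * Gaussian processes *)

Section NormalLaw.
Context {R : realType}.
Local Notation mu := (@lebesgue_measure R).

(** The Radon-Nikodym derivative of the law and the explicit density have equal integrals over all
    measurable sets, so they agree almost everywhere. *)
Lemma ge0_integral_normal_prob (m s : R) (f : R -> \bar R) :
  (forall x, 0 <= f x)%E -> measurable_fun setT f ->
  (\int[normal_prob m s]_x f x = \int[mu]_x (f x * (normal_pdf m s x)%:E))%E.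
Proof.
move=> f0 mf; have dom := normal_prob_dominates m s.
rewrite -(Radon_Nikodym_SigmaFinite.change_of_variables dom)//.
have ig := Radon_Nikodym_SigmaFinite.f_integrable dom.
apply: ae_eq_integral => //.
- by apply: emeasurable_funM => //; exact: measurable_int ig.
- apply: emeasurable_funM => //; apply/measurable_EFinP; exact: measurable_normal_pdf.
- apply: ae_eqe_mul2l; apply: integral_ae_eq => //.
  + by apply/measurable_EFinP; exact: measurable_normal_pdf.
  + by move=> E _ mE; rewrite -Radon_Nikodym_SigmaFinite.f_integral.
Qed.

(** Completing the square: an exponential tilt shifts the mean to [l * s ^+ 2]. *)
Lemma normal_pdf_tilt (s l x : R) : s != 0 ->
  expR (x * l) * normal_pdf 0 s x =
  expR ((l * s) ^+ 2 / 2) * normal_pdf (l * s ^+ 2) s x.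
Proof.
move=> s0; rewrite !normal_pdfE// !mulrA ![_ * normal_peak s]mulrC -!mulrA; congr (_ * _).
rewrite /normal_fun -!expRD; congr expR; field; exact: s0.
Qed.

Lemma normal_prob_mgf (s l : R) : s != 0 ->
  (\int[normal_prob 0 s]_x (expR (x * l))%:E = (expR ((l * s) ^+ 2 / 2))%:E)%E.
Proof.
move=> s0; rewrite ge0_integral_normal_prob//; last first.
  by apply/measurable_EFinP; apply: measurableT_comp => //; exact: measurable_funM.
under eq_integral do rewrite -EFinM normal_pdf_tilt// EFinM.
rewrite ge0_integralZl_EFin ?expR_ge0//.
- by rewrite integral_normal_pdf mule1.
- by move=> x _; rewrite lee_fin normal_pdf_ge0.
- by apply/measurable_EFinP; exact: measurable_normal_pdf.
Qed.

End NormalLaw.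

Section Gaussian.
Context {disp : measure_display} {T : measurableType disp} {R : realType}.
Variable P : probability T R.
Implicit Types X : T -> R.

Lemma powphi2 (x : R) : powphi 2 x = x ^+ 2 / 2.
Proof. by rewrite /powphi powR_mulrn// real_normK// num_real. Qed.

Lemma ge0_integral_law {d1} {T1 : measurableType d1} (X : T -> T1)
  (m : {measure set T1 -> \bar R}) (f : T1 -> \bar R) :
  measurable_fun setT X -> (forall A, measurable A -> P (X @^-1` A) = m A) ->
  measurable_fun setT f -> (forall x, 0 <= f x)%E ->
  (\int[m]_x f x = \int[P]_w f (X w))%E.
Proof.
move=> mX XE mf f0.
transitivity (\int[pushforward P X]_x f x)%E; last by rewrite ge0_integral_pushforward.
by apply: eq_measure_integral => A mA _; rewrite -XE.
Qed.

Lemma gaussian_mgf X (s l : R) : measurable_fun setT X -> s != 0 ->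
  (forall A, measurable A -> P (X @^-1` A) = normal_prob 0 s A) ->
  ('M_P X l = (expR ((l * s) ^+ 2 / 2))%:E)%E.
Proof.
move=> mX s0 XE; rewrite mgfE -(normal_prob_mgf l s0).
apply/esym; refine (@ge0_integral_law _ (g_sigma_algebraType R.-ocitv.-measurable) X (normal_prob 0 s) _ mX XE _ _).
  by apply/measurable_EFinP; apply: measurableT_comp => //; exact: measurable_funM.
by move=> x; rewrite lee_fin expR_ge0.
Qed.

(** For [z >= 0] the left side is [e^z (1 - e^(-z))^2], and [0 <= 1 - e^(-z) <= z]. *)
Lemma expR_sum2_le (z : R) : expR z + expR (- z) - 2 <= z ^+ 2 * expR `|z|.
Proof.
wlog z0 : z / 0 <= z.
  move=> h; have [/h//|/ltW z0] := leP 0 z.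
  by have := h (- z); rewrite oppr_ge0 => /(_ z0); rewrite opprK sqrrN normrN; lra.
rewrite ger0_norm//; have h1 := expR_ge1Dx (- z); have p := expR_gt0 (- z).
have E : expR z * expR (- z) = 1 by rewrite -expRD subrr expR0.
have p1 := expR_gt0 z.
have h2 : expR (- z) <= 1 by rewrite -expR0 ler_expR oppr_le0.
have -> : expR z + expR (- z) - 2 = expR z * (1 - expR (- z)) ^+ 2.
  by rewrite sqrrB expr1n mulrDr mulrBr expr2 mulrA E; ring: E.
rewrite mulrC ler_wpM2r ?expR_ge0// lerXn2r ?nnegrE//; lra.
Qed.

End Gaussian.

(** * Variables with a Gaussian exponential moment *)

Section GaussianMgf.
Context {disp : measure_display} {T : measurableType disp} {R : realType}.
Variable P : probability T R.
Variables (X : T -> R) (s : R).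
Hypothesis mX : measurable_fun setT X.
Hypothesis s0 : 0 <= s.
Hypothesis MX : forall l, ('M_P X l = (expR ((l * s) ^+ 2 / 2))%:E)%E.

Let mexp l : measurable_fun setT (fun w => (expR (X w * l))%:E).
Proof. by apply/measurable_EFinP; exact: measurable_expRM. Qed.

Let expR_norm_le (z : R) : expR `|z| <= expR z + expR (- z).
Proof.
have := expR_gt0 z; have := expR_gt0 (- z).
by have [z0|z0] := leP 0 z; [rewrite ger0_norm//|rewrite ltr0_norm//]; lra.
Qed.

Let integrable_expR l : P.-integrable setT (fun w => (expR (X w * l))%:E).
Proof.
apply/integrableP; split => //; under eq_integral do rewrite gee0_abs ?lee_fin ?expR_ge0//.
by rewrite -mgfE MX ltry.
Qed.

(** With mean [m], [1 + l m <= E e^(l X) = e^(l^2 s^2 / 2)], so [l m] is bounded by a multiple of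
    [l^2] for both signs of [l]; small [l] forces [m = 0]. *)
Lemma gaussian_mgf_expectation : ('E_P[X] = 0)%E.
Proof.
have iX : P.-integrable setT (EFin \o X).
  apply: (@le_integrable _ _ _ P setT measurableT _
    (fun w => (expR (X w * 1))%:E + (expR (X w * -1))%:E)%E) => //.
  - exact/measurable_EFinP.
  - move=> w _; rewrite -EFinD !abse_EFin lee_fin mulr1 mulrN1.
    rewrite [leRHS]ger0_norm ?addr_ge0 ?expR_ge0//; apply: le_trans (expR_norm_le _).
    by have := expR_ge1Dx `|X w|; lra.
  - by apply: integrableD => //; exact: integrable_expR.
rewrite unlock; have fX : (\int[P]_w (X w)%:E)%E \is a fin_num.
  exact: integrable_fin_num.
set m := (\int[P]_w _)%E in fX *; rewrite -(fineK fX); congr EFin.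
have key l : 1 + l * fine m <= expR ((l * s) ^+ 2 / 2).
  rewrite -lee_fin -MX mgfE EFinD EFinM fineK// /m -integralZl//.
  have <- : (\int[P]_w 1%:E = 1%:E)%E.
    by rewrite (integral_cst P measurableT)/= probability_setT mule1.
  rewrite -integralD//=; last first.
  - exact: integrableZl.
  - exact: finite_measure_integrable_cst.
  apply: le_integral => //=.
  - apply: integrableD => //; first exact: finite_measure_integrable_cst.
    exact: integrableZl.
  - by move=> w _; rewrite -EFinM -EFinD lee_fin mulrC expR_ge1Dx.
have bound (v : R) : expR v - 1 <= v * expR v.
  have := expR_ge1Dx (- v); have E : expR v * expR (- v) = 1 by rewrite -expRD subrr expR0.
  by have := expR_gt0 v => p h; have := ler_wpM2l (ltW p) h; rewrite E; lra.
have key2 l : `|l| <= 1 -> l * fine m <= l ^+ 2 * (s ^+ 2 / 2 * expR (s ^+ 2 / 2)).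
  move=> l1; have := key l; have := bound ((l * s) ^+ 2 / 2).
  have l21 : l ^+ 2 <= 1 by rewrite -real_normK ?num_real// exprn_ile1.
  have e1 : expR ((l * s) ^+ 2 / 2) <= expR (s ^+ 2 / 2).
    by rewrite ler_expR ler_wpM2r// exprMn ler_piMl ?sqr_ge0.
  have := ler_wpM2l (_ : 0 <= (l * s) ^+ 2 / 2) e1; rewrite divr_ge0 ?sqr_ge0// => /(_ isT).
  by rewrite exprMn; lra.
set K := s ^+ 2 / 2 * expR (s ^+ 2 / 2) in key2.
have K0 : 0 <= K by rewrite mulr_ge0 ?expR_ge0// divr_ge0 ?sqr_ge0.
apply/eqP; rewrite -normr_le0; apply/ler_addgt0Pl => e e0; rewrite addr0.
pose l := Num.min 1 (e / (K + 1)).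
have l0 : 0 < l by rewrite lt_min ltr01 divr_gt0//; lra.
have l1 : `|l| <= 1 by rewrite gtr0_norm// ge_min lexx.
have lK : l * K <= e.
  apply: (@le_trans _ _ (e / (K + 1) * K)); first by rewrite ler_wpM2r// ge_min lexx orbT.
  rewrite mulrAC ler_pdivrMr; last lra.
  by rewrite ler_wpM2l ?(ltW e0)//; lra.
rewrite ler_norml; apply/andP; split.
  have := key2 (- l); rewrite normrN => /(_ l1); rewrite sqrrN expr2 -mulrA mulNr -mulrN ler_pM2l//.
  lra.
have := key2 l l1; rewrite expr2 -mulrA ler_pM2l//; lra.
Qed.

(* [e^(lX) + e^(-lX) - 2] has mean at least [l^2 s^2] and is at most
   [l^2 X^2 e^(l|X|)]; let [l] tend to 0. *)
Lemma gaussian_mgf_variance : ((s ^+ 2)%:E <= \int[P]_w (X w ^+ 2)%:E)%E.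
Proof.
pose l n : R := n.+1%:R^-1.
have l0 n : 0 < l n by rewrite invr_gt0.
have l1 n : l n <= 1 by rewrite invf_le1// ler1n.
pose g n w := (X w ^+ 2 * expR (l n * `|X w|))%:E.
have mg n : measurable_fun setT (g n).
  apply/measurable_EFinP; apply: measurable_funM; first exact: measurable_funX.
  apply: measurableT_comp => //; apply: measurable_funM => //.
  exact: measurableT_comp.
have lower n : ((s ^+ 2)%:E <= \int[P]_w g n w)%E.
  have : ((2 * expR ((l n * s) ^+ 2 / 2))%:E <=
      2%:E + (l n ^+ 2)%:E * \int[P]_w g n w)%E.
    have -> : ((2 * expR ((l n * s) ^+ 2 / 2))%:E =
        \int[P]_w ((expR (X w * l n))%:E + (expR (X w * - l n))%:E))%E.
      rewrite ge0_integralD//; [|by move=> w _; rewrite lee_fin expR_ge0..].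
      by rewrite -!mgfE !MX -EFinD mulNr sqrrN; congr EFin; ring.
    rewrite -ge0_integralZl_EFin//; [|by move=> w _; rewrite lee_fin mulr_ge0 ?sqr_ge0 ?expR_ge0|by rewrite sqr_ge0].
    have <- : (\int[P]_w 2%:E = 2%:E)%E.
      by rewrite (integral_cst P measurableT)/= probability_setT mule1.
    rewrite -ge0_integralD//; last 2 first.
    - by move=> w _; rewrite lee_fin mulr_ge0 ?sqr_ge0// mulr_ge0 ?sqr_ge0 ?expR_ge0.
    - exact: measurable_funeM.
    apply: ge0_le_integral => //.
    - by move=> w _; rewrite adde_ge0// lee_fin expR_ge0.
    - exact: emeasurable_funD.
    - by apply: emeasurable_funD => //; exact: measurable_funeM.
    - move=> w _; rewrite -EFinM -!EFinD lee_fin mulrN.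
      have := expR_sum2_le (X w * l n).
      by rewrite normrM (gtr0_norm (l0 n)) exprMn [`|_| * _]mulrC; lra.
  have l2 : 0 < l n ^+ 2 by rewrite exprn_gt0.
  have h := expR_ge1Dx ((l n * s) ^+ 2 / 2).
  have : (0 <= \int[P]_w g n w)%E.
    by apply: integral_ge0 => w _; rewrite lee_fin mulr_ge0 ?sqr_ge0 ?expR_ge0.
  case: (\int[P]_w g n w)%E => [r| |]//=; last by move=> *; rewrite leey.
  move=> _; rewrite -EFinM -EFinD !lee_fin => h2.
  by rewrite -(ler_pM2l l2); move: h; rewrite exprMn; move: h2; rewrite exprMn; lra.
have lim : (\int[P]_w g n w @[n --> \oo] --> \int[P]_w (X w ^+ 2)%:E)%E.
  apply: (@dominated_cvg _ _ _ P setT measurableT g _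
     (fun w => 4%:E * ((expR (X w * 2))%:E + (expR (X w * -2))%:E))%E) => //.
  - move=> w _; apply: cvg_EFin; first exact: nearW.
    rewrite -[X in _ --> X]mulr1; apply: cvgM; first exact: cvg_cst.
    rewrite -[X in _ --> X]expR0 -(mul0r `|X w|).
    apply: (cvg_comp (fun n => l n * `|X w|) (@expR R)); last exact: continuous_expR.
    by apply: cvgM; [exact: cvg_harmonic|exact: cvg_cst].
  - by apply: integrableZl => //; apply: integrableD => //; exact: integrable_expR.
  - move=> n w _; rewrite gee0_abs; last first.
      by rewrite lee_fin; apply: mulr_ge0; [exact: sqr_ge0|exact: expR_ge0].
    rewrite -EFinD -EFinM lee_fin.
    have -> : X w * 2 = X w + X w by ring.
    have -> : X w * -2 = - X w - X w by ring.
    rewrite !expRD.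
    have h1 := sqr_le_expR (X w).
    have h2 : expR (l n * `|X w|) <= expR (X w) + expR (- X w).
      by apply: le_trans (expR_norm_le _); rewrite ler_expR ler_piMl.
    apply: le_trans (ler_pM (sqr_ge0 _) (expR_ge0 _) h1 h2) _.
    by have := sqr_ge0 (expR (X w) - expR (- X w)); rewrite sqrrB; lra.
rewrite -(cvg_lim _ lim)//; apply: lime_ge; first by apply/cvg_ex; eexists; exact: lim.
exact: nearW.
Qed.

(** The exponential moment has parameter [s], and the lower bound for the second moment says that
    [s] is at most the [L^2] norm. *)
Lemma gaussian_mgf_tau : (tau P (powphi 2) X <= (l2norm P X)%:E)%E.
Proof.
have X2 : (\int[P]_w (X w ^+ 2)%:E < +oo)%E.
  apply: (@sub_gaussian_L2 _ _ _ P (powphi 2)) => //; split.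
  - exact: gaussian_mgf_expectation.
  - by move=> l; rewrite MX ltry.
  - exists (s + 1); first exact: ltr_wpDl.
    move=> l; rewrite MX lee_fin ler_expR powphi2 ler_wpM2r// !exprMn ler_wpM2l ?sqr_ge0//.
    by rewrite lerXn2r ?nnegrE ?addr_ge0 ?lerDl.
have X2f : (\int[P]_w (X w ^+ 2)%:E)%E \is a fin_num by rewrite ge0_fin_numE// integral_sqr_ge0.
have sl : s <= l2norm P X.
  rewrite l2normE -[leLHS](ger0_norm s0) -sqrtr_sqr ler_sqrt ?fine_ge0 ?integral_sqr_ge0//.
  by rewrite -lee_fin fineK// gaussian_mgf_variance.
apply: tau_le; first by rewrite l2normE sqrtr_ge0.
move=> a la l; rewrite MX lee_fin ler_expR powphi2 ler_wpM2r// !exprMn ler_wpM2l ?sqr_ge0//.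
have sa := le_trans sl (ltW la).
by rewrite lerXn2r// nnegrE (le_trans s0).
Qed.

End GaussianMgf.

(** * Gaussian processes as strictly sub-Gaussian processes *)

Section GaussianProcess.
Context {disp : measure_display} {T : measurableType disp} {R : realType}.
Variable P : probability T R.

(** The value [s = 0] stands for the degenerate law, so both cases of the definition share one
    formula. *)
Lemma centered_gaussian_mgf (X : T -> R) : measurable_fun setT X ->
  centered_gaussian P X ->
  exists2 s : R, 0 <= s & forall l, ('M_P X l = (expR ((l * s) ^+ 2 / 2))%:E)%E.
Proof.
move=> mX [[s s0 hs]|X0].
  exists s; first exact: ltW.
  by move=> l; apply: gaussian_mgf => //; rewrite gt_eqF.
exists 0 => // l; rewrite mulr0 expr0n mul0r expR0 mgfE.
rewrite -[RHS]mule1 -(probability_setT P) -(integral_cst P measurableT).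
apply: ge0_ae_eq_integral => //.
- by apply/measurable_EFinP; exact: measurable_expRM.
- by apply: filterS X0 => w /= -> _; rewrite mul0r expR0 probability_setT.
Qed.

Lemma centered_gaussian_sub_gaussian (X : T -> R) : measurable_fun setT X ->
  centered_gaussian P X ->
  sub_gaussian P (powphi 2) X /\ (tau P (powphi 2) X <= (l2norm P X)%:E)%E.
Proof.
move=> mX /(centered_gaussian_mgf mX)[s s0 MX]; split; last exact: gaussian_mgf_tau MX.
split.
- exact: gaussian_mgf_expectation MX.
- by move=> l; rewrite MX ltry.
- exists (s + 1); first exact: ltr_wpDl.
  move=> l; rewrite MX lee_fin ler_expR powphi2 ler_wpM2r// !exprMn ler_wpM2l ?sqr_ge0//.
  by rewrite lerXn2r ?nnegrE//; lra.
Qed.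

(** Partial sums are Gaussian by assumption and satisfy the bound; their mean-square limit inherits
    it through [tau_limit], without its law being identified. *)
Lemma centered_gaussian_process_strictly_sub_gaussian (y : R -> {RV P >-> R}) :
  centered_gaussian_process y -> strictly_sub_gaussian (powphi 2) (range y) 1.
Proof.
move=> hy; have h u : sub_gaussian P (powphi 2) (y u).
  have := hy 1 (fun=> u) (fun=> 1).
  have -> : (fun w => \sum_(i < 1) 1 * y u w) = y u.
    by apply/funext => w; rewrite big_ord1 mul1r.
  by move=> /(centered_gaussian_sub_gaussian (measurable_funPT (y u)))[].
split; first by move=> X [u _ <-].
move=> zeta l xi hz cv.
have /choice[u hu] : forall i, exists u, zeta i = y u.
  by move=> i; have [u _ <-] := hz i; exists u.
have mS n : measurable_fun setT (fun w => \sum_(i < n) l i * zeta i w).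
  by apply: measurable_sum => i; exact: measurable_funM.
have hS n : sub_gaussian P (powphi 2) (fun w => \sum_(i < n) l i * zeta i w) /\
    (tau P (powphi 2) (fun w => \sum_(i < n) l i * zeta i w)%R <=
     (l2norm P (fun w => \sum_(i < n) l i * zeta i w)%R)%:E)%E.
  apply: (centered_gaussian_sub_gaussian (mS n)).
  have := hy n (fun i => u i) (fun i => l i).
  suff -> : (fun w => \sum_(i < n) l i * zeta i w) = (fun w => \sum_(i < n) l i * y (u i) w) by [].
  by apply/funext => w; apply: eq_bigr => i _; rewrite hu.
move: cv => /ge0_cvg0P-/(_ (fun=> sqdist_ge0 _ _ _)) cv.
apply: (@tau_limit _ _ _ P 2 1 (fun n w => \sum_(i < n) l i * zeta i w)) => //.
- have [n _ /(_ n (leqnn n))] := cv 1 ltr01.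
  move=> /= hn; have := integral_sqr_le P ltr01 (mS n) (measurable_funPT xi).
  move=> /le_lt_trans; apply; rewrite lte_add_pinfty//.
    by apply: lte_mul_pinfty => //; apply: (sub_gaussian_L2 (mS n)); exact: (hS n).1.
  by apply: lte_mul_pinfty => //; apply: le_lt_trans hn _; exact: ltry.
- by move=> n; rewrite mul1r; exact: (hS n).2.
Qed.

End GaussianProcess.

(** * The solution field *)

Section LocallyLipschitz.
Context {R : realType}.
Implicit Types f g : R -> R.

(** A class closed under sums and products with explicit constants, hence containing the polynomial
    phase, and contained in the locally uniformly continuous functions on which the integrals are
    built. *)
Definition locally_lipschitz f := forall A B : R, A <= B -> exists2 L : R, 0 <= L &
  forall x z, A <= x <= B -> A <= z <= B -> `|f x - f z| <= L * `|x - z|.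

Lemma locally_lipschitz_luc f : locally_lipschitz f -> loc_unif_continuous f.
Proof.
move=> hf A B om om0; have [AB|BA] := leP A B; last first.
  by exists 1 => // x z /andP[Ax xB]; move: (le_trans Ax xB); rewrite leNgt BA.
have [L L0 hL] := hf _ _ AB; have L1 : 0 < L + 1 by rewrite ltr_wpDl.
exists (om / (L + 1)); first by rewrite divr_gt0.
move=> x z Ax Az; rewrite ltr_pdivlMr// => h; apply: le_trans (hL x z Ax Az) _.
by have := normr_ge0 (x - z); nra.
Qed.

Lemma locally_lipschitz_cst (k : R) : locally_lipschitz (fun=> k).
Proof. by move=> A B _; exists 0 => // x z _ _; rewrite subrr normr0 mul0r. Qed.

Lemma locally_lipschitz_id : locally_lipschitz id.
Proof. by move=> A B _; exists 1 => // x z _ _; rewrite mul1r. Qed.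

Lemma locally_lipschitzD f g : locally_lipschitz f -> locally_lipschitz g ->
  locally_lipschitz (fun x => f x + g x).
Proof.
move=> hf hg A B AB; have [L L0 hL] := hf _ _ AB; have [M M0 hM] := hg _ _ AB.
exists (L + M); first exact: addr_ge0.
move=> x z Ax Az; rewrite opprD addrACA mulrDl.
exact: le_trans (ler_normD _ _) (lerD (hL _ _ Ax Az) (hM _ _ Ax Az)).
Qed.

Lemma locally_lipschitzM f g : locally_lipschitz f -> locally_lipschitz g ->
  locally_lipschitz (fun x => f x * g x).
Proof.
move=> hf hg A B AB; have [L L0 hL] := hf _ _ AB; have [M M0 hM] := hg _ _ AB.
have bnd (h : R -> R) (K : R) : 0 <= K -> (forall x z, A <= x <= B -> A <= z <= B -> `|h x - h z| <= K * `|x - z|) ->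
    forall x : R, A <= x <= B -> `|h x| <= `|h A| + K * (B - A).
  move=> K0 hK x Ax; have /andP[A1 A2] := Ax; have AA : A <= A <= B by rewrite lexx.
  have := hK x A Ax AA; rewrite (ger0_norm (_ : 0 <= x - A)) ?subr_ge0// => h1.
  have h2 : K * (x - A) <= K * (B - A) by rewrite ler_wpM2l// lerD2r.
  by have := ler_normD (h x - h A) (h A); rewrite subrK; lra.
have bf := bnd f L L0 hL; have bg := bnd g M M0 hM.
set cf := `|f A| + L * (B - A) in bf; set cg := `|g A| + M * (B - A) in bg.
have cf0 : 0 <= cf by rewrite addr_ge0// mulr_ge0// subr_ge0.
have cg0 : 0 <= cg by rewrite addr_ge0// mulr_ge0// subr_ge0.
exists (cf * M + cg * L); first by rewrite addr_ge0// mulr_ge0.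
move=> x z Ax Az.
have -> : f x * g x - f z * g z = f x * (g x - g z) + g z * (f x - f z) by ring.
apply: le_trans (ler_normD _ _) _; rewrite !normrM mulrDl -!mulrA.
by apply: lerD; apply: ler_pM => //; [exact: bf|exact: hM|exact: bg|exact: hL].
Qed.

Lemma locally_lipschitzX f n : locally_lipschitz f -> locally_lipschitz (fun x => f x ^+ n).
Proof.
move=> hf; elim: n => [|n ih]; first exact: locally_lipschitz_cst.
by under eq_fun do rewrite exprS; exact: locally_lipschitzM.
Qed.

Lemma locally_lipschitz_comp f g : (forall x z, `|f x - f z| <= `|x - z|) ->
  locally_lipschitz g -> locally_lipschitz (fun x => f (g x)).
Proof.
move=> hf hg A B AB; have [L L0 hL] := hg _ _ AB; exists L => // x z Ax Az.
exact: le_trans (hf _ _) (hL _ _ Ax Az).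
Qed.

Lemma locally_lipschitz_dispersion N (coef : nat -> R) :
  locally_lipschitz (dispersion N coef).
Proof.
rewrite /dispersion; elim: N => [|N ih].
  by under eq_fun do rewrite big_geq//; exact: locally_lipschitz_cst.
under eq_fun do rewrite big_nat_recr//=.
apply: locally_lipschitzD => //; apply: locally_lipschitzM; last exact: locally_lipschitz_cst.
apply: locally_lipschitzM; first exact: locally_lipschitz_cst.
exact: (locally_lipschitzX _ locally_lipschitz_id).
Qed.

End LocallyLipschitz.

(** * Hoelder estimate of the kernel *)

Section Kernel.
Context {R : realType}.

Lemma derive_le1_lipschitz (f df : R -> R) : (forall x : R, is_derive x 1 f (df x)) ->
  (forall x, `|df x| <= 1) -> forall x z, `|f x - f z| <= `|x - z|.
Proof.
move=> fd df1 x z; wlog xz : x z / z <= x.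
  by move=> h; have [/h//|/ltW/h] := leP z x; rewrite distrC (distrC z).
have [|r _ ->] := MVT_segment xz (fun c _ => fd c).
  apply: continuous_subspaceT => c; apply: differentiable_continuous.
  by apply/derivable1_diffP; case: (fd c).
by rewrite normrM ler_piMl.
Qed.

(** [u <= u^r] for [u] in [[0, 1]], applied to the fractions [p / (p + q)] and [q / (p + q)], which
    add up to 1. *)
Lemma powR_subadd (p q r : R) : 0 <= p -> 0 <= q -> 0 < r <= 1 ->
  (p + q) `^ r <= p `^ r + q `^ r.
Proof.
move=> p0 q0 /andP[r0 r1]; have [s0|s0] := eqVneq (p + q) 0.
  by rewrite s0 powR0 ?gt_eqF// addr_ge0 ?powR_ge0.
have sp : 0 < p + q by rewrite lt_neqAle eq_sym s0 addr_ge0.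
have key z : 0 <= z -> z <= p + q -> z / (p + q) * (p + q) `^ r <= z `^ r.
  rewrite le_eqVlt => /predU1P[<- _|z0 zs]; first by rewrite !mul0r powR_ge0.
  have u1 : z / (p + q) <= 1 by rewrite ler_pdivrMr// mul1r.
  have u0 : 0 < z / (p + q) by rewrite divr_gt0.
  have -> : z `^ r = (z / (p + q)) `^ r * (p + q) `^ r.
    by rewrite -powRM ?(ltW u0) ?(ltW sp)// divfK.
  rewrite ler_wpM2r ?powR_ge0//.
  by rewrite -[leLHS]powRr1 ?(ltW u0)// ger_powR// u0.
apply: le_trans (lerD (key p p0 _) (key q q0 _)); rewrite ?lerDl ?lerDr//.
by rewrite -mulrDl -mulrDl divff// mul1r.
Qed.

Variables (kappa : R -> R) (N : nat) (coef : nat -> R) (rho : R).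
Hypothesis hkappa : kappa = cos \/ kappa = sin.
Hypothesis hrho : 0 < rho <= 1.

Lemma kappa_le1 x : `|kappa x| <= 1.
Proof. by case: hkappa => ->; [exact: cos_max|exact: sin_max]. Qed.

Lemma kappa_lipschitz x z : `|kappa x - kappa z| <= `|x - z|.
Proof.
case: hkappa => ->.
  apply: (derive_le1_lipschitz (df := fun x => - sin x)) => {}x.
  by rewrite normrN sin_max.
by apply: (derive_le1_lipschitz (df := cos)) => {}x; exact: cos_max.
Qed.

(** With [v = |x - z| / 2], the Lipschitz bound is [2 v <= 2 v^rho] for [v <= 1], and the trivial
    bound is [2 <= 2 v^rho] for [v > 1]. The halves in [C_Z] come from this scaling. *)
Lemma kappa_holder x z : `|kappa x - kappa z| <= 2 * (`|x - z| / 2) `^ rho.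
Proof.
have /andP[r0 r1] := hrho; set v := `|x - z| / 2.
have v0 : 0 <= v by rewrite divr_ge0.
have [v1|v1] := leP v 1.
  apply: (@le_trans _ _ (2 * v)).
    by rewrite /v mulrC divfK//; exact: kappa_lipschitz.
  rewrite ler_wpM2l//; move: v0; rewrite le_eqVlt => /predU1P[<-|v0]; first exact: powR_ge0.
  by rewrite -[leLHS]powRr1 ?(ltW v0)// ger_powR// v0.
apply: (@le_trans _ _ 2).
  by apply: le_trans (ler_normB _ _) _; have := kappa_le1 x; have := kappa_le1 z; lra.
rewrite -[leLHS]mulr1 ler_wpM2l// -(powRr0 v) ler_powR//; exact: ltW.
Qed.

Lemma kernelI_luc t x : loc_unif_continuous (kernelI kappa N coef t x).
Proof.
apply: locally_lipschitz_luc; apply: locally_lipschitz_comp; first exact: kappa_lipschitz.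
apply: locally_lipschitzD; apply: locally_lipschitzM.
- exact: locally_lipschitz_id.
- exact: locally_lipschitz_cst.
- exact: locally_lipschitz_cst.
- exact: locally_lipschitz_dispersion.
Qed.

Lemma kernelI_incr_luc t x t1 x1 : loc_unif_continuous
  (fun l => kernelI kappa N coef t x l - kernelI kappa N coef t1 x1 l).
Proof.
have h s z : locally_lipschitz (kernelI kappa N coef s z).
  apply: locally_lipschitz_comp; first exact: kappa_lipschitz.
  apply: locally_lipschitzD; apply: locally_lipschitzM.
  - exact: locally_lipschitz_id.
  - exact: locally_lipschitz_cst.
  - exact: locally_lipschitz_cst.
  - exact: locally_lipschitz_dispersion.
apply: locally_lipschitz_luc; apply: locally_lipschitzD => //.
under eq_fun do rewrite -mulN1r.
by apply: locally_lipschitzM => //; exact: locally_lipschitz_cst.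
Qed.

Lemma CZ_weight_ge0 l : 0 <= CZ_weight rho N coef l.
Proof. by rewrite addr_ge0 ?powR_ge0. Qed.

Lemma measurable_CZ_weight : measurable_fun setT (CZ_weight rho N coef).
Proof.
have mD : measurable_fun setT (dispersion N coef).
  by apply: measurable_luc; apply: locally_lipschitz_luc; exact: locally_lipschitz_dispersion.
apply: measurable_funD; apply: (measurableT_comp (measurable_powR rho)).
- by apply: measurable_funM => //; exact: measurableT_comp.
- by apply: measurableT_comp => //; exact: measurable_funM.
Qed.

(** The phase is linear in [(t, x)], so half of its increment is at most [h] times the sum of
    [|l| / 2] and half the absolute dispersion; subadditivity of the power separates the two. *)
Lemma kernelI_incr_le (t x t1 x1 h l : R) : `|t - t1| <= h -> `|x - x1| <= h ->
  `|kernelI kappa N coef t x l - kernelI kappa N coef t1 x1 l| <=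
  2 * h `^ rho * CZ_weight rho N coef l.
Proof.
move=> th xh; have h0 : 0 <= h by apply: le_trans th.
have /andP[r0 _] := hrho.
apply: le_trans (kappa_holder _ _) _; rewrite -mulrA ler_wpM2l//.
have -> : l * x + t * dispersion N coef l - (l * x1 + t1 * dispersion N coef l) =
  (x - x1) * l + (t - t1) * dispersion N coef l by ring.
apply: (@le_trans _ _ ((h * (`|l| / 2) + h * `|2^-1 * dispersion N coef l|) `^ rho)).
  rewrite ge0_ler_powR ?nnegrE ?(ltW r0) ?divr_ge0 ?addr_ge0 ?mulr_ge0//.
  rewrite normrM (ger0_norm (_ : 0 <= 2^-1)) ?invr_ge0//.
  rewrite [_^-1 * _]mulrC !mulrA -mulrDl ler_wpM2r ?invr_ge0//.
  apply: le_trans (ler_normD _ _) _; rewrite !normrM.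
  by apply: lerD; rewrite ler_wpM2r.
apply: le_trans (powR_subadd _ _ hrho) _; rewrite ?mulr_ge0 ?divr_ge0//.
by rewrite (powRM _ h0) ?divr_ge0// (powRM _ h0)// -mulrDr.
Qed.

End Kernel.

(** * Charges that vanish on half-open rectangles *)

Section RectangleCharge.
Context {R : realType}.

Definition half_open_rects : set (set (R * R)) :=
  [set A | exists s s' t t' : R, A = `]s, s'] `*` `]t, t']].

Let bigcup_half_open : \bigcup_n `](- n%:R)%R, (n%:R : R)]%classic = [set: R].
Proof.
apply/seteqP; split => // x _; have := archi_boundP (normr_ge0 x).
set n := Num.bound _ => xn; exists n => //=; rewrite in_itv/=.
by move: xn; rewrite ltr_norml => /andP[-> /ltW ->].
Qed.

(** Each strip over a half-open interval is a countable union of rectangles, so both coordinate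
    projections are measurable for the generated sigma-algebra. *)
Lemma half_open_rects_generate (A : set (R * R)) : measurable A -> <<s half_open_rects >> A.
Proof.
have ocitvE : (@measurable _ R) = <<s R.-ocitv.-measurable >> by [].
have gen (f : R * R -> R) (g : set R -> set R -> set (R * R)) :
    (forall I (J : nat -> set R), \bigcup_n J n = [set: R] -> f @^-1` I = \bigcup_n g I (J n)) ->
    (forall s s' t t' : R, half_open_rects (g `]s, s']%classic `]t, t']%classic)) ->
    preimage_set_system setT f measurable `<=` <<s half_open_rects >>.
  move=> fg gG _ [B mB <-].
  suff : @measurable_fun _ _ (g_sigma_algebraType half_open_rects) R setT f by apply.
  apply: (measurability _ ocitvE) => _ [_ [[u v] _ <-] <-] /=.
  rewrite (fg `]u, v]%classic _ bigcup_half_open) setTI; apply: bigcup_measurable => n _.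
  by apply: sub_sigma_algebra; exact: gG.
move: A; apply: smallest_sub; first exact: smallest_sigma_algebra.
rewrite subUset; split.
  apply: (gen fst (fun I J => I `*` J)); last by move=> s s' t t'; exists s, s', t, t'.
  by move=> I J JT; rewrite -setX_bigcupr JT; apply/seteqP; split => -[x z]//= [].
apply: (gen snd (fun I J => J `*` I)); last by move=> s s' t t'; exists t, t', s, s'.
by move=> I J JT; rewrite -setX_bigcupl JT; apply/seteqP; split => -[x z]//= [].
Qed.

(** The two Jordan parts agree on half-open rectangles, which are stable under intersection and
    generate; hence they agree everywhere and [nu = 0]. Then the negative part, a restriction of
    [- nu], vanishes, and the positive part with it. *)
Lemma charge_rects0 (nu : {charge set (R * R)%type -> \bar R}) (Pos Neg : set (R * R)%type)
    (hahn : hahn_decomposition nu Pos Neg) :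
  (forall s s' t t' : R, s < s' -> t < t' -> nu (`]s, s'] `*` `]t, t']) = 0%E) ->
  charge_variation hahn setT = 0%E.
Proof.
move=> nu0.
have mr (s s' t t' : R) : measurable (`]s, s'] `*` `]t, t'] : set (R * R)).
  by apply: measurableX; exact: measurable_itv.
have JJ A : measurable A -> jordan_pos hahn A = jordan_neg hahn A.
  move=> mA; apply: (@g_sigma_algebra_measure_unique _ _ _ half_open_rects _
    (fun n => `](- n%:R)%R, (n%:R : R)] `*` `](- n%:R)%R, (n%:R : R)])).
  - by move=> _ [s [s' [t [t' ->]]]].
  - by move=> n; exists (- n%:R), n%:R, (- n%:R), n%:R.
  - apply/seteqP; split => // -[x z] _; have := archi_boundP (addr_ge0 (normr_ge0 x) (normr_ge0 z)).
    set n := Num.bound _ => xn; exists n => //=; rewrite !in_itv/=.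
    have := ler_norm x; have := ler_norm z; have := ler_norm (- x); have := ler_norm (- z).
    by rewrite !normrN => h1 h2 h3 h4; split; apply/andP; split; lra.
  - move=> _ _ [s [s' [t [t' ->]]]] [p [p' [q [q' ->]]]]; rewrite -setXI.
    have itvI (u u' v v' : R) : `]u, u'] `&` `]v, v'] = `](Num.max u v), (Num.min u' v')]%classic.
      apply/seteqP; split => x /=; rewrite !in_itv/= gt_max le_min.
        by move=> [/andP[-> ->] /andP[-> ->]].
      by move=> /andP[/andP[-> ->] /andP[-> ->]].
    by rewrite !itvI; do 4 eexists.
  - move=> _ [s [s' [t [t' ->]]]].
    have [ss|ss] := ltP s s'; last first.
      by rewrite (set_itv_ge (_ : ~~ (BRight s < BRight s')%O)) ?bnd_simp -?leNgt// set0X !measure0.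
    have [tt'|tt'] := ltP t t'; last first.
      by rewrite (set_itv_ge (_ : ~~ (BRight t < BRight t')%O)) ?bnd_simp -?leNgt// setX0 !measure0.
    have := nu0 _ _ _ _ ss tt'; rewrite (jordan_decomp hahn)// /cadd/= cscaleN1.
    have fp : jordan_pos hahn (`]s, s'] `*` `]t, t']) \is a fin_num by exact: fin_num_measure.
    have fn : jordan_neg hahn (`]s, s'] `*` `]t, t']) \is a fin_num by exact: fin_num_measure.
    by move=> /eqP; rewrite sube_eq ?fin_num_adde_defl// add0e => /eqP.
  - by move=> n; rewrite ltey_eq fin_num_measure.
  - exact: half_open_rects_generate.
have [[mP _] [mN _] PN PN0] := hahn.
have nuA0 A : measurable A -> nu A = 0%E.
  move=> mA; rewrite (jordan_decomp hahn mA) /cadd/= cscaleN1 JJ// subee//.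
  exact: fin_num_measure.
rewrite /charge_variation/= JJ// jordan_negE cjordan_negE /crestr0 mem_set//.
by rewrite /crestr setTI nuA0// oppe0 add0e.
Qed.

End RectangleCharge.

(** * Negative determining constants *)

Section NegativeConstant.
Context {disp : measure_display} {T : measurableType disp} {R : realType}.
Variable P : probability T R.
Variable y : R -> {RV P >-> R}.

(** [0 <= tau <= C * l2norm] with [C < 0] leaves only [l2norm = 0]; a single value is a series with
    one nonzero coefficient. *)
Lemma strictly_sub_gaussian_lt0 (alpha C : R) : 0 < alpha -> C < 0 ->
  strictly_sub_gaussian (powphi alpha) (range y) C ->
  forall u, (\int[P]_w (y u w ^+ 2)%:E = 0)%E.
Proof.
move=> al0 C0 [hs hC] u.
have yu : range y (y u) by exists u.
have cv : sqdist P (fun w => \sum_(i < n) (i == 0%N :> nat)%:R * y u w) (y u) @[n --> \oo] --> 0%E.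
  apply: cvg_near_cst; exists 1%N => // -[//|n] _.
  rewrite -[RHS](sqdistxx P (y u)); congr (sqdist P _ _); apply/funext => w.
  by rewrite big_ord_recl/= mul1r big1 ?addr0// => i _; rewrite mul0r.
have := le_trans (tau_ge0 P (powphi alpha) (y u)) (hC (fun=> y u) (fun i => (i == 0%N)%:R) (y u) (fun=> yu) cv).
rewrite lee_fin nmulr_rge0// l2normE => h.
have y2 : (\int[P]_w (y u w ^+ 2)%:E < +oo)%E.
  by apply: (sub_gaussian_L2 (measurable_funPT (y u))); exact: hs.
have fy : (\int[P]_w (y u w ^+ 2)%:E)%E \is a fin_num by rewrite ge0_fin_numE ?integral_sqr_ge0.
apply/eqP; rewrite eq_le integral_sqr_ge0 andbT -(fineK fy) lee_fin.
by move: h; rewrite leNgt sqrtr_gt0 -leNgt.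
Qed.

Lemma cov_fun_eq0 : (forall u, (\int[P]_w (y u w ^+ 2)%:E = 0)%E) ->
  forall s t, cov_fun y s t = 0.
Proof.
move=> y0 s t; rewrite /cov_fun unlock.
have yt0 : {ae P, forall w, y t w = 0}.
  have m2 : measurable_fun setT (fun w => (y t w ^+ 2)%:E).
    by apply/measurable_EFinP; exact: measurable_funX.
  have : (\int[P]_w `|(y t w ^+ 2)%:E| = 0)%E.
    by under eq_integral do rewrite gee0_abs ?lee_fin ?sqr_ge0//; exact: y0.
  move=> /(ae_eq_integral_abs P measurableT m2); apply: filterS => w /(_ I)[] /eqP.
  by rewrite sqrf_eq0 => /eqP.
rewrite (ae_eq_integral (cst 0%E))//= ?integral0//.
- by apply/measurable_EFinP; exact: measurable_funM.
- by apply: filterS yt0 => w /= -> _; rewrite mul0r.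
Qed.

Lemma LS_generated_eq0 (nu : {charge set (R * R)%type -> \bar R}) (s s' t t' : R) :
  (forall s t, cov_fun y s t = 0) -> LS_generated (cov_fun y) nu ->
  s < s' -> t < t' -> nu (`]s, s'] `*` `]t, t']) = 0%E.
Proof.
move=> y0 hnu ss tt'; have := hnu _ _ _ _ ss tt'.
under eq_fun do rewrite /rect_incr !y0 subr0 subrr addr0.
move=> h; apply: (cvg_unique _ h) => //; exact: cvg_cst.
Qed.

End NegativeConstant.

(** * Estimates for the field and its continuous version *)

Section SolutionField.
Context {disp : measure_display} {T : measurableType disp} {R : realType}.
Variable P : probability T R.
Variables (y : R -> {RV P >-> R}) (nu : {charge set (R * R)%type -> \bar R}).
Variables (Pos Neg : set (R * R)%type) (hahn : hahn_decomposition nu Pos Neg).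
Variables (N : nat) (coef : nat -> R) (kappa : R -> R) (a b c d rho CZ : R).
Hypothesis yL2 : forall u, (\int[P]_w (y u w ^+ 2)%:E < +oo)%E.
Hypothesis Gfv : finite_variation2 (cov_fun y).
Hypothesis hnu : LS_generated (cov_fun y) nu.
Hypothesis hkappa : kappa = cos \/ kappa = sin.
Hypothesis hab : a <= b.
Hypothesis hcd : c <= d.
Hypothesis hrho : 0 < rho <= 1.
Hypothesis hCZ0 : 0 <= CZ.
Hypothesis hCZ : ((CZ ^+ 2)%:E = \int[charge_variation hahn]_z
   (CZ_weight rho N coef z.1 * CZ_weight rho N coef z.2)%:E)%E.
Local Notation mu := (charge_variation hahn).
Local Notation I t x := (kernelI kappa N coef t x).

Let kernelI_le1 t x l : `|I t x l| <= 1.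
Proof. by rewrite /kernelI; apply: kappa_le1. Qed.

Lemma field_sqr_le t x J : ms_integral (I t x) y J ->
  (\int[P]_w (J w ^+ 2)%:E <= mu setT)%E.
Proof.
move=> hJ; have fluc := kernelI_luc N coef hkappa t x.
apply: le_trans (ms_integral_sqr_le yL2 Gfv hahn hnu fluc (kernelI_le1 t x) hJ) _.
have mf : measurable_fun setT (fun l => `|I t x l|).
  by apply: measurableT_comp => //; exact: measurable_luc.
rewrite -[leRHS]mul1e -(integral_cst mu measurableT).
apply: ge0_le_integral => //.
- by apply/measurable_EFinP; exact: (measurable_prod_fun mf mf).
- by move=> z _; rewrite lee_fin -[1]mulr1 ler_pM.
Qed.

Lemma field_L2 t x J : ms_integral (I t x) y J -> (\int[P]_w (J w ^+ 2)%:E < +oo)%E.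
Proof.
by move=> /field_sqr_le/le_lt_trans; apply; rewrite ltey_eq variation_fin_num.
Qed.

Lemma field_incr_sqr_le (t t1 x x1 h : R) (J K JK : {RV P >-> R}) :
  JK = (fun w => J w - K w) :> (T -> R) ->
  ms_integral (I t x) y J -> ms_integral (I t1 x1) y K ->
  `|t - t1| <= h -> `|x - x1| <= h ->
  (\int[P]_w (JK w ^+ 2)%:E <= ((2 * CZ * h `^ rho) ^+ 2)%:E)%E.
Proof.
move=> JKE hJ hK th xh; have hJK := ms_integralB JKE hJ hK.
have fluc := kernelI_incr_luc N coef hkappa t x t1 x1.
have fb l : `|I t x l - I t1 x1 l| <= 2.
  apply: le_trans (ler_normB _ _) _.
  by have := kernelI_le1 t x l; have := kernelI_le1 t1 x1 l; lra.
apply: le_trans (ms_integral_sqr_le yL2 Gfv hahn hnu fluc fb hJK) _.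
have mf : measurable_fun setT (fun l => `|I t x l - I t1 x1 l|).
  by apply: measurableT_comp => //; exact: measurable_luc.
have mW := measurable_CZ_weight N coef rho.
have mWW := measurable_prod_fun mW mW.
have -> : ((2 * CZ * h `^ rho) ^+ 2)%:E = (((2 * h `^ rho) ^+ 2)%:E *
   \int[mu]_z (CZ_weight rho N coef z.1 * CZ_weight rho N coef z.2)%:E)%E.
  by rewrite -hCZ -EFinM; congr EFin; ring.
rewrite -ge0_integralZl_EFin ?sqr_ge0//; last 2 first.
- by move=> z _; rewrite lee_fin mulr_ge0 ?CZ_weight_ge0.
- exact/measurable_EFinP.
apply: ge0_le_integral => //.
- by apply/measurable_EFinP; exact: (measurable_prod_fun mf mf).
- by apply: measurable_funeM; exact/measurable_EFinP.
- move=> z _; rewrite -EFinM lee_fin.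
  apply: le_trans (ler_pM (normr_ge0 _) (normr_ge0 _)
    (kernelI_incr_le N coef hkappa hrho z.1 th xh)
    (kernelI_incr_le N coef hkappa hrho z.2 th xh)) _.
  by rewrite expr2 mulrACA.
Qed.

Variables (alpha C : R).
Hypothesis alpha0 : 0 < alpha.
Hypothesis hC : strictly_sub_gaussian (powphi alpha) (range y) C.

Let tau_field f (J : {RV P >-> R}) : (\int[P]_w (J w ^+ 2)%:E < +oo)%E -> ms_integral f y J ->
  (tau P (powphi alpha) J <= (`|C| * l2norm P J)%:E)%E.
Proof.
apply: tau_ms_integral => // s; exact: strictly_sub_gaussian_tau_lincomb.
Qed.

(** A bound uniform in [(t, x)], due to [|I| <= 1]; it makes [eps0] finite. *)
Lemma tau_field_le t x J : ms_integral (I t x) y J ->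
  (tau P (powphi alpha) J <= (`|C| * Num.sqrt (fine (mu setT)))%:E)%E.
Proof.
move=> hJ; have J2 := field_L2 hJ; apply: le_trans (tau_field J2 hJ) _.
rewrite lee_fin ler_wpM2l// l2normE ler_sqrt ?fine_ge0//.
apply: fine_le; rewrite ?variation_fin_num//; last exact: field_sqr_le hJ.
by rewrite ge0_fin_numE// integral_sqr_ge0.
Qed.

(* A negative [C] forces [y = 0], hence [nu = 0] and [CZ = 0]. *)
Lemma normC_CZ : `|C| * CZ = C * CZ.
Proof.
have [C0|C0] := leP 0 C; first by rewrite ger0_norm.
suff -> : CZ = 0 by rewrite !mulr0.
have mu0 : mu setT = 0%E.
  apply: charge_rects0 => s s' t t'; apply: (@LS_generated_eq0 _ _ _ _ y) => //.
  exact/cov_fun_eq0/(strictly_sub_gaussian_lt0 alpha0 C0 hC).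
have mW := measurable_CZ_weight N coef rho.
have mWW := measurable_prod_fun mW mW.
move: hCZ; rewrite null_set_integral//; last exact/measurable_EFinP.
by move=> [] /eqP; rewrite sqrf_eq0 => /eqP.
Qed.

Lemma tau_field_incr_le (t t1 x x1 h : R) (J K : {RV P >-> R}) :
  ms_integral (I t x) y J -> ms_integral (I t1 x1) y K ->
  `|t - t1| <= h -> `|x - x1| <= h ->
  (tau P (powphi alpha) (fun w => J w - K w)%R <= (2 * CZ * C * h `^ rho)%:E)%E.
Proof.
move=> hJ hK th xh.
have mJK : measurable_fun setT (fun w => J w - K w) by exact: measurable_funB.
have [JK JKE] := exists_RV P mJK; rewrite -JKE.
have le2 := field_incr_sqr_le JKE hJ hK th xh.
have JK2 : (\int[P]_w (JK w ^+ 2)%:E < +oo)%E by apply: le_lt_trans le2 _; rewrite ltry.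
apply: le_trans (tau_field JK2 (ms_integralB JKE hJ hK)) _; rewrite lee_fin.
have k0 : 0 <= 2 * CZ * h `^ rho by rewrite !mulr_ge0 ?powR_ge0.
have -> : 2 * CZ * C * h `^ rho = `|C| * (2 * CZ * h `^ rho).
  have -> : 2 * CZ * C * h `^ rho = C * CZ * (2 * h `^ rho) by ring.
  by rewrite -normC_CZ; ring.
rewrite ler_wpM2l// l2normE -[leRHS](ger0_norm k0) -sqrtr_sqr ler_sqrt ?sqr_ge0//.
by rewrite -lee_fin fineK// ge0_fin_numE// integral_sqr_ge0.
Qed.

Lemma exists_continuous_field : exists U : R -> R -> {RV P >-> R},
  is_field kappa N coef y a b c d U /\ as_continuous a b c d U.
Proof.
have /andP[rho0 _] := hrho.
have /choice[V hV] : forall p : R * R, exists J : {RV P >-> R}, ms_integral (I p.1 p.2) y J.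
  by move=> p; apply: (exists_ms_integral yL2 Gfv (kernelI_luc _ _ hkappa _ _) (kernelI_le1 _ _)).
(* [K] dominates both the constant [2 CZ C] of the norm and the constant [2 CZ] of the mean square,
   and the summand 1 keeps it positive when [CZ = 0]. *)
pose K := 2 * CZ * (`|C| + 1) + 1.
have K0 : 0 < K by rewrite ltr_wpDl// !mulr_ge0// addr_ge0.
have hK1 h : 2 * CZ * C * h `^ rho <= K * h `^ rho.
  rewrite ler_wpM2r ?powR_ge0//; have := ler_wpM2l hCZ0 (ler_norm C); have := hCZ0.
  by rewrite /K; lra.
have hK2 h : 0 <= 2 * CZ * h `^ rho <= K * h `^ rho.
  rewrite !mulr_ge0 ?powR_ge0//= ler_wpM2r ?powR_ge0//.
  by have := mulr_ge0 hCZ0 (normr_ge0 C); have := hCZ0; rewrite /K; lra.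
have [| |U' [U'c VU']] := exists_continuous_modification (U := fun t x => V (t, x)) (K := K) hab hcd alpha0 rho0 _ K0.
- move=> t t1 x x1 h _ _ _ _ th xh.
  apply: le_trans (tau_field_incr_le (hV (t, x)) (hV (t1, x1)) th xh) _.
  by rewrite lee_fin.
- move=> t t1 x x1 h _ _ _ _ th xh.
  have mJK : measurable_fun setT (fun w => V (t, x) w - V (t1, x1) w) by exact: measurable_funB.
  have [JK JKE] := exists_RV P mJK.
  have := field_incr_sqr_le JKE (hV (t, x)) (hV (t1, x1)) th xh.
  rewrite JKE sqdistE => /le_trans; apply; rewrite lee_fin.
  by have /andP[k0 kK] := hK2 h; rewrite lerXn2r// nnegrE (le_trans k0).
exists U'; split => // t x tab xcd.
(* The modification equals the integral almost surely at each point, so the same truncated integrals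
   converge to it. *)
have [JJ [hJJ cJJ]] := hV (t, x); exists JJ; split => //.
suff E A B : sqdist P (JJ A B) (U' t x) = sqdist P (JJ A B) (V (t, x)).
  by under eq_fun do rewrite E.
by apply/esym/sqdist_ae_eq => //; exact: VU'.
Qed.

Variable U : R -> R -> {RV P >-> R}.
Hypothesis hU : is_field kappa N coef y a b c d U.

Lemma sup_tau_incr_le (h : R) : (sup_tau_incr (powphi alpha) a b c d U h <= (2 * CZ * C * h `^ rho)%:E)%E.
Proof.
apply: ge_ereal_sup => _ [t [t1 [x [x1 [[t_ t1_ tt] [x_ x1_ xx] ->]]]]].
exact: tau_field_incr_le (hU t_ x_) (hU t1_ x1_) tt xx.
Qed.

Lemma sup_tau_ge0 : (0 <= sup_tau (powphi alpha) a b c d U)%E.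
Proof.
apply: le_trans (tau_ge0 P (powphi alpha) (U a c)) _; apply: ereal_sup_ubound.
by exists (a, c) => //; split; rewrite /= in_itv/= lexx.
Qed.

Lemma sup_tau_fin_num : sup_tau (powphi alpha) a b c d U \is a fin_num.
Proof.
rewrite ge0_fin_numE ?sup_tau_ge0//.
apply: (@le_lt_trans _ _ (`|C| * Num.sqrt (fine (mu setT)))%:E); last exact: ltry.
apply: ge_ereal_sup => _ [[t x] [/= t_ x_] <-].
by move: t_ x_; rewrite !in_itv/= => t_ x_; exact: tau_field_le (hU t_ x_).
Qed.

Let eps0 := fine (sup_tau (powphi alpha) a b c d U).

Lemma tau_le_sup_tau t x : a <= t <= b -> c <= x <= d ->
  (tau P (powphi alpha) (U t x) <= eps0%:E)%E.
Proof.
move=> t_ x_; rewrite fineK ?sup_tau_fin_num//; apply: ereal_sup_ubound.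
by exists (t, x) => //; split; rewrite /= in_itv.
Qed.

Lemma field_sup_tail (gamma theta u : R) : alpha^-1 + gamma^-1 = 1 -> 0 < gamma ->
  as_continuous a b c d U -> 0 < theta < 1 ->
  theta * eps0 < 2 * CZ * C * (Num.max (b - a) (d - c) / 2) `^ rho -> 0 < u ->
  (prob_sup_exceeds a b c d U u <=
     (2 * expR (- (u `^ gamma * (1 - theta) `^ gamma / (gamma * eps0 `^ gamma)))
        * (2 * expR 1 * CZ * C) `^ (2 / rho) * Num.max (b - a) (d - c) ^+ 2
        * (theta * eps0) `^ (- (2 / rho)))%:E)%E.
Proof.
move=> ag gamma0 Uc /andP[th0 th1] small u0; have /andP[rho0 _] := hrho.
have : 0 <= eps0 by rewrite fine_ge0// sup_tau_ge0.
rewrite le_eqVlt => /predU1P[e0|e0].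
  (* [0 `^ p = 0] for [p != 0]: the claimed bound is [0] when [eps0 = 0]. *)
  have -> : theta * eps0 = 0 by rewrite -e0 mulr0.
  rewrite powR0 ?oppr_eq0 ?gt_eqF ?divr_gt0// mulr0.
  by apply: (sup_tail0 hab hcd alpha0 Uc tau_le_sup_tau u0); rewrite -e0.
have vk0 : 0 <= (Num.max (b - a) (d - c) / 2) `^ rho by rewrite powR_ge0.
have K0 : 0 < 2 * CZ * C.
  have := lt_trans (mulr_gt0 th0 e0) small.
  by rewrite ltNge; apply: contraLR; rewrite -!leNgt => h; rewrite mulr_le0_ge0.
have hinc (t t1 x x1 h : R) (t_ : a <= t <= b) (t1_ : a <= t1 <= b) (x_ : c <= x <= d)
    (x1_ : c <= x1 <= d) : `|t - t1| <= h -> `|x - x1| <= h ->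
    (tau P (powphi alpha) (fun w => U t x w - U t1 x1 w)%R <= (2 * CZ * C * h `^ rho)%:E)%E.
  exact: tau_field_incr_le (hU t_ x_) (hU t1_ x1_).
have th01 : 0 < theta < 1 by rewrite th0.
apply: le_trans (sup_tail hab hcd alpha0 rho0 hinc ag gamma0 th01 Uc tau_le_sup_tau small u0 e0) _.
rewrite lee_fin le_eqVlt; apply/orP; left; apply/eqP.
have -> : (u * (1 - theta) / eps0) `^ gamma / gamma =
    u `^ gamma * (1 - theta) `^ gamma / (gamma * eps0 `^ gamma).
  have q0 : 0 <= u * (1 - theta) / eps0 by rewrite divr_ge0 ?mulr_ge0 ?(ltW u0) ?(ltW e0)//; lra.
  have eg : eps0 `^ gamma != 0 by rewrite gt_eqF ?powR_gt0.
  have -> : u `^ gamma * (1 - theta) `^ gamma = (u * (1 - theta) / eps0) `^ gamma * eps0 `^ gamma.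
    rewrite -[RHS]powRM// ?(ltW e0)// divfK ?gt_eqF// powRM ?(ltW u0)//; lra.
  by field; rewrite eg gt_eqF.
(* The factor [e^(2/rho)] left by the chaining enters the power as the factor [e] of its base. *)
have -> : (2 * expR 1 * CZ * C) `^ (2 / rho) = (2 * CZ * C) `^ (2 / rho) * expR (2 / rho).
  have -> : 2 * expR 1 * CZ * C = 2 * CZ * C * expR 1 by ring.
  rewrite powRM ?(ltW K0) ?expR_ge0//; congr (_ * _).
  by rewrite /powR gt_eqF ?expR_gt0// expRK mulr1.
by ring.
Qed.

End SolutionField.

Theorem corollary3p1 (R : realType) (disp : measure_display)
  (T : measurableType disp) (P : probability T R)
  (alpha gamma : R) (y : R -> {RV P >-> R})
  (nu : {charge set (R * R)%type -> \bar R}) (Pos Neg : set (R * R)%type)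
  (hahn : hahn_decomposition nu Pos Neg)
  (N : nat) (coef : nat -> R) (kappa : R -> R) (a b c d rho CZ : R)
  (halpha : 1 < alpha <= 2) (hgamma : alpha^-1 + gamma^-1 = 1)
  (hvar : finite_variation2 (cov_fun y))
  (hnu : LS_generated (cov_fun y) nu)
  (hN : (1 <= N)%N) (hkappa : kappa = cos \/ kappa = sin)
  (hab : a <= b) (hcd : c <= d)
  (hrho : 0 < rho <= 1)
  (hint : (\int[charge_variation hahn]_z
             (`|z.1| `^ ((2 * N + 1)%:R * (rho + 1)) *
              `|z.2| `^ ((2 * N + 1)%:R * (rho + 1)))%:E < +oo)%E)
  (hCZ0 : 0 <= CZ)
  (hCZ : ((CZ ^+ 2)%:E = \int[charge_variation hahn]_z
             (CZ_weight rho N coef z.1 * CZ_weight rho N coef z.2)%:E)%E) :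
  let vk := Num.max (b - a) (d - c) in
  (forall Cy : R, strictly_sub_gaussian (powphi alpha) (range y) Cy ->
    (exists U : R -> R -> {RV P >-> R},
       is_field kappa N coef y a b c d U /\ as_continuous a b c d U) /\
    (forall U : R -> R -> {RV P >-> R}, is_field kappa N coef y a b c d U ->
       (forall h : R, 0 < h < vk ->
          (sup_tau_incr (powphi alpha) a b c d U h
             <= (2 * CZ * Cy * h `^ rho)%:E)%E) /\
       sup_tau (powphi alpha) a b c d U \is a fin_num /\
       (as_continuous a b c d U ->
        let eps0 := fine (sup_tau (powphi alpha) a b c d U) in
        forall theta u : R, 0 < theta < 1 ->
          theta * eps0 < 2 * CZ * Cy * (vk / 2) `^ rho -> 0 < u ->
          (prob_sup_exceeds a b c d U u <=
             (2 * expR (- (u `^ gamma * (1 - theta) `^ gamma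
                            / (gamma * eps0 `^ gamma)))
                * (2 * expR 1 * CZ * Cy) `^ (2 / rho) * vk ^+ 2
                * (theta * eps0) `^ (- (2 / rho)))%:E)%E))) /\
  (centered_gaussian_process y ->
    strictly_sub_gaussian (powphi 2) (range y) 1 /\
    forall U : R -> R -> {RV P >-> R}, is_field kappa N coef y a b c d U ->
      as_continuous a b c d U ->
      let eps0 := fine (sup_tau (powphi 2) a b c d U) in
      forall theta u : R, 0 < theta < 1 ->
        theta * eps0 < 2 * CZ * (vk / 2) `^ rho -> 0 < u ->
        (prob_sup_exceeds a b c d U u <=
           (2 * expR (- (u ^+ 2 * (1 - theta) ^+ 2 / (2 * eps0 ^+ 2)))
              * (2 * expR 1 * CZ) `^ (2 / rho) * vk ^+ 2
              * (theta * eps0) `^ (- (2 / rho)))%:E)%E).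
Proof.
move=> vk.
have al0 : 0 < alpha by case/andP: halpha => /(lt_trans ltr01).
have ga0 : 0 < gamma.
  have /andP[al1 _] := halpha; rewrite -invr_gt0.
  have -> : gamma^-1 = 1 - alpha^-1 by rewrite -hgamma addrC addKr.
  by rewrite subr_gt0 invf_lt1.
have L2 (al : R) C : strictly_sub_gaussian (powphi al) (range y) C ->
    forall u, (\int[P]_w (y u w ^+ 2)%:E < +oo)%E.
  move=> [hs _] u; apply: (sub_gaussian_L2 (measurable_funPT (y u))).
  by apply: hs; exists u.
split=> [Cy hC|hy].
  have yL2 := L2 _ _ hC; split.
    exact: (exists_continuous_field yL2 hvar hnu hkappa hab hcd hrho hCZ0 hCZ al0 hC).
  move=> U hU; split; last split.
  - by move=> h _; exact: (sup_tau_incr_le yL2 hvar hnu hkappa hrho hCZ0 hCZ al0 hC hU h).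
  - exact: (sup_tau_fin_num hahn yL2 hvar hnu hkappa hab hcd al0 hC hU).
  - move=> Uc eps0 theta u th small u0.
    exact: (field_sup_tail yL2 hvar hnu hkappa hab hcd hrho hCZ0 hCZ al0 hC hU hgamma ga0 Uc th small u0).
have hC := centered_gaussian_process_strictly_sub_gaussian hy; split => //.
have yL2 := L2 _ _ hC.
move=> U hU Uc eps0 theta u th small u0.
(* For a Gaussian process both exponents are 2, whatever the given [alpha], and the constant is
   1. *)
have two : (2 : R)^-1 + 2^-1 = 1 by lra.
have e0 : 0 <= eps0 by rewrite fine_ge0// sup_tau_ge0.
have th1 : 0 <= 1 - theta by case/andP: th => _ /ltW; rewrite subr_ge0.
have := @field_sup_tail _ _ _ P y nu Pos Neg hahn N coef kappa a b c d rho CZ yL2 hvar hnu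
  hkappa hab hcd hrho hCZ0 hCZ 2 1 (ltr0n R 2) hC U hU 2 theta u two (ltr0n R 2) Uc th.
rewrite !mulr1 -/eps0 !powR_mulrn ?(ltW u0)//; exact.
Qed.
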